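(* Let $\mathbb{F}_r$ be the free group on $r\ge 2$ free generators, and let $B_{2n}$ be the ball of radius $2n$ centered at the identity with respect to the word length $\ell$ of the free generating set. Let $a>0$ be a Hölder exponent. (1) Consider an isometric action of $\mathbb{F}_r$ on a compact manifold $X$. Let $\mu$ be an ergodic ($\mathbb{F}_r$-invariant) smooth probability measure on $X$ with full support such that the unitary representation of $\mathbb{F}_r$ on $L^2_0(X,\mu)$ has a spectral gap. Then there is $\theta_a>0$, which besides $a$ and $r$ depends only on the spectral gap and $\dim(X)$, such that for every $f\in C^a(X)_1$ and every $x\in X$, $$\frac{1}{\#B_{2n}}\sum_{\gamma\in B_{2n}} f(\gamma^{-1}x)= \mathcal{P}f(x)+O\left(e^{-\theta_a n}\right),\qquad ( * )$$ with implied constant independent of $f$, $x$ and $n$, where $$\mathcal{P}f=\int_X f\,d\mu+\frac{r-1}{r}\left(\int_X f\,\overline{f_0}\,d\mu\right)f_0 .$$ Here $f_0\equiv 0$ when $\mathcal{H}^{\varepsilon_0}=0$, which is always the case when $X$ is connected; otherwise $\mathcal{H}^{\varepsilon_0}$ is $1$-dimensional and $f_0$ denotes a unit vector that spans $\mathcal{H}^{\varepsilon_0}$. (2) Let $\Gamma_i\subset \mathbb{F}_r$ be a decreasing family of finite index subgroups such that $|\Gamma_i:\Gamma_{i+1}|$ is uniformly bounded, and the family of representations of $\mathbb{F}_r$ on $L_0^2(\mathbb{F}_r/\Gamma_i)$ satisfies property $(\tau)$ (i.e. has a uniform spectral gap). Let $\hat{\mathbb{F}}_r$ be the profinite completion associated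 with the family $\Gamma_i$, with its Haar probability measure $\mu$. Then for every $f\in C^a(\hat{\mathbb{F}}_r)_1$ and every $x\in \hat{\mathbb{F}}_r$, the estimate $( * )$ holds as well for some $\theta_a>0$, with $X=\hat{\mathbb{F}}_r$ and $\mathcal{P}$ given by the same formula with respect to $\mu$.
   Context: Notation. $\varepsilon_0:\mathbb{F}_r\to\{\pm1\}$ is the sign character, $\varepsilon_0(\gamma)=(-1)^{\ell(\gamma)}$. $\mathcal{H}=L^2(X,\mu)$ with the representation $\pi(\gamma)f(x)=f(\gamma^{-1}x)$, and $\mathcal{H}^{\varepsilon_0}=\{f\in\mathcal{H}:\pi(\gamma)f=(-1)^{\ell(\gamma)}f \text{ for all }\gamma\}$. $L^2_0$ denotes the orthogonal complement of the constants in $L^2$. A unitary representation has a spectral gap if it has no almost invariant sequence of unit vectors; a family of representations has a uniform spectral gap (property $(\tau)$) if this holds uniformly over the family (equivalently for its direct sum). For a metric space $(X,d)$, $$C^a(X)_1=\Big\{f\in C(X):\ \sup_{x\in X}|f(x)|+\sup_{x\ne y}\frac{|f(x)-f(y)|}{d(x,y)^a}\le 1\Big\}.$$ In (1), $X$ carries the distance $d$ of a Riemannian metric and the action is by isometries of it. In (2), $\hat{\mathbb{F}}_r$ is the inverse limit of the $\mathbb{F}_r/\Gamma_i$, on which $\mathbb{F}_r$ acts by left translations, with the invariant metric $$d(\gamma_1,\gamma_2)=\max\{|\mathbb{F}_r:\Gamma_i|^{-1}:\ \gamma_1^{-1}\gamma_2\notin\hat\Gamma_i\}$$ (where $\hat\Gamma_i$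 is the closure of $\Gamma_i$; the condition $\gamma_1^{-1}\gamma_2\notin\hat\Gamma_i$ means that $\gamma_1,\gamma_2$ have distinct images in $\mathbb{F}_r/\Gamma_i$; the maximum of the empty set is $0$). The Haar probability measure is the unique translation-invariant probability measure.
   Formalization: In (1), ''depends only on the spectral gap'' is read with the two-sided gap: 1 minus the norm of the generator average on the complement of the constants and H^{ε0}; dependence on the gap at 1 alone fails for nearly bipartite expander actions. *)

(* Defs.v *)
From HB Require Import structures.
From mathcomp Require Import all_boot all_order all_algebra.
From mathcomp Require Import all_classical all_reals all_analysis.
From mathcomp Require Import finmap complex.

Set Implicit Arguments.
Unset Strict Implicit.
Unset Printing Implicit Defensive.

Import Order.TTheory GRing.Theory Num.Theory.
Import numFieldNormedType.Exports.

Local Open Scope classical_set_scope.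
Local Open Scope ring_scope.

(* [(i, true)] is the i-th free generator and [(i, false)] its inverse. *)
Definition letter (r : nat) : Type := ('I_r * bool)%type.
HB.instance Definition _ r := Finite.on (letter r).

Section FreeGroup.
Variable r : nat.
Implicit Types (a b : letter r) (u v w : seq (letter r)).

Definition letterV a : letter r := (a.1, ~~ a.2).

Definition reduced w : bool := sorted (fun a b => b != letterV a) w.

Definition push a w : seq (letter r) :=
  if w is b :: w' then if b == letterV a then w' else a :: w else [:: a].

Lemma letterVK : involutive letterV.
Proof. by case=> i b; rewrite /letterV /= negbK. Qed.

Lemma push_reduced a w : reduced w -> reduced (push a w).
Proof.
case: w => [|b w] //= bw; case: ifPn => [_|nba /=]; first exact: path_sorted bw.
by rewrite nba.
Qed.

Lemma pushK a w : reduced w -> push a (push (letterV a) w) = w.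
Proof.
case: w => [|b w] /=; first by rewrite eqxx.
rewrite letterVK; case: ifPn => [/eqP -> |nba _] /=; last by rewrite eqxx.
by case: w => [|c w] //= /andP[/negbTE ->].
Qed.

Lemma foldr_push_reduced u v : reduced v -> reduced (foldr push v u).
Proof. by move=> rv; elim: u => //= a u IH; exact: push_reduced. Qed.

Lemma foldr_push_push a u v : reduced v ->
  foldr push v (push a u) = push a (foldr push v u).
Proof.
move=> rv; case: u => [|b u] //=; case: ifPn => [/eqP ->|] //=.
by rewrite pushK ?foldr_push_reduced.
Qed.

Lemma foldr_push_id u : reduced u -> foldr push [::] u = u.
Proof.
elim: u => //= a u IH pu; rewrite (IH (path_sorted pu)).
by case: u pu {IH} => [|b u] //= /andP[/negbTE ->].
Qed.

Definition wordV u : seq (letter r) := rev (map letterV u).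

Lemma wordV_reduced u : reduced u -> reduced (wordV u).
Proof.
rewrite /reduced /wordV rev_sorted sorted_map.
apply: sub_sorted => a b /=; apply: contraNneq => ->.
by rewrite !letterVK.
Qed.

Lemma wordVK : involutive wordV.
Proof. by move=> u; rewrite /wordV map_rev revK mapK //; exact: letterVK. Qed.

Lemma foldr_push_wordV u : foldr push u (wordV u) = [::].
Proof.
elim: u => // a u IH; rewrite /wordV /= rev_cons -cats1 foldr_cat /=.
by rewrite letterVK eqxx.
Qed.

Record freeGroup : Type := FreeGroup {
  word :> seq (letter r);
  _ : reduced word }.

HB.instance Definition _ := [isSub for word].
HB.instance Definition _ := [Choice of freeGroup by <:].

Lemma word_reduced (g : freeGroup) : reduced (word g).
Proof. exact: valP. Qed.

Definition free_one : freeGroup := @FreeGroup [::] isT.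
Definition free_mul (g h : freeGroup) : freeGroup :=
  FreeGroup (foldr_push_reduced (word g) (word_reduced h)).
Definition free_inv (g : freeGroup) : freeGroup :=
  FreeGroup (wordV_reduced (word_reduced g)).

Lemma free_mulA : associative free_mul.
Proof.
move=> g h k; apply/val_inj => /=; elim: (word g) => //= a u ->.
by rewrite foldr_push_push ?word_reduced.
Qed.

Lemma free_mul1g : left_id free_one free_mul.
Proof. by move=> g; exact/val_inj. Qed.

Lemma free_mulg1 : right_id free_one free_mul.
Proof. by move=> g; apply/val_inj; rewrite /= foldr_push_id ?word_reduced. Qed.

Lemma free_mulVg : left_inverse free_one free_inv free_mul.
Proof. by move=> g; apply/val_inj; rewrite /= foldr_push_wordV. Qed.

Lemma free_mulgV : right_inverse free_one free_inv free_mul.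
Proof.
move=> g; apply/val_inj.
have := foldr_push_wordV (wordV (word g)); rewrite wordVK; exact.
Qed.

HB.instance Definition _ := isGroup.Build freeGroup
  free_mulA free_mul1g free_mulg1 free_mulVg free_mulgV.

Definition free_gen (i : 'I_r) : freeGroup := @FreeGroup [:: (i, true)] isT.

Definition wlen (g : freeGroup) : nat := size (word g).

Definition wball (m : nat) : set freeGroup := [set g | (wlen g <= m)%N].

Lemma finite_wball m : finite_set (wball m).
Proof.
apply: (@sub_finite_set _ _
  ((fun b : m.-bseq (letter r) => insubd free_one (bseqval b)) @` setT)).
  move=> g gm /=; exists (@Bseq m _ (word g) gm) => //=.
  by apply/val_inj; rewrite val_insubd /= word_reduced.
exact/finite_image/finite_finset.
Qed.

End FreeGroup.

Arguments free_gen {r} i.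
Arguments wball r m : clear implicits.

Definition is_action r (T : Type) (act : freeGroup r -> T -> T) : Prop :=
  (forall x, act 1%g x = x) /\
  (forall g h x, act (g * h)%g x = act g (act h x)).

Section Functions.
Variable R : realType.
Local Notation C := R[i].

Definition cabs (z : C) : R := ComplexField.Normc.normc z.

Definition ccontinuous (X : topologicalType) (f : X -> C) : Prop :=
  continuous (fun x => complex.Re (f x)) /\
  continuous (fun x => complex.Im (f x)).

(* The unit ball C^a(X)_1.  Distances may be infinite; a pair of points at
   infinite distance contributes 0 to the Hoelder seminorm.  The [maxe 0] only
   matters when there is no pair of distinct points at finite distance. *)
Definition holder_ball (X : topologicalType) (d : X -> X -> \bar R) (a : R) :
    set (X -> C) :=
  [set f | ccontinuous f /\
    (ereal_sup [set (cabs (f x))%:E | x in [set: X]] +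
     maxe 0 (ereal_sup [set q | exists x y, [/\ x <> y, d x y < +oo &
       q = (cabs (f x - f y) / (fine (d x y)) `^ a)%:E]]) <= 1)%E].

Section Koopman.
Context (disp : measure_display) (T : measurableType disp) (r : nat).
Variables (mu : probability T R) (act : freeGroup r -> T -> T).
Implicit Types f g : T -> C.

Definition cint f : C :=
  Complex (\int[mu]_x complex.Re (f x)) (\int[mu]_x complex.Im (f x)).

Definition L2norm f : R := Num.sqrt (\int[mu]_x (cabs (f x) ^+ 2)).

Definition L2dot f g : C := cint (fun x => f x * (g x)^*%C).

(* Functions, not classes: equality in the Hilbert space L^2 is rendered by
   equality almost everywhere. *)
Definition L2 : set (T -> C) :=
  [set f | [/\ measurable_fun setT (fun x => complex.Re (f x)),
               measurable_fun setT (fun x => complex.Im (f x)) &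
               (\int[mu]_x (cabs (f x) ^+ 2)%:E < +oo)%E]].

Definition L20 : set (T -> C) := [set f | L2 f /\ cint f = 0].

Definition koopman (g : freeGroup r) f : T -> C := fun x => f (act g^-1%g x).

Definition Heps : set (T -> C) :=
  [set f | L2 f /\ forall g : freeGroup r,
     {ae mu, forall x, koopman g f x = (-1) ^+ wlen g * f x}].

Definition Heps_trivial : Prop :=
  forall f, Heps f -> {ae mu, forall x, f x = 0}.

Definition Heps_unit_generator f0 : Prop :=
  [/\ Heps f0, L2norm f0 = 1 &
      forall f, Heps f -> exists c : C, {ae mu, forall x, f x = c * f0 x}].

Definition invariant_measure : Prop :=
  forall (g : freeGroup r) (A : set T), measurable A ->
    mu (act g @^-1` A) = mu A.

Definition ergodic : Prop :=
  forall A : set T, measurable A ->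
    (forall g : freeGroup r, act g @^-1` A = A) -> mu A = 0%E \/ mu A = 1%E.

Definition gen_average f : T -> C := fun x =>
  (2 * r)%:R^-1 *
  \sum_(i < r) (koopman (free_gen i) f x + koopman (free_gen i)^-1%g f x).

(* The distance to {1, -1} of the spectrum of the averaging operator on the
   orthogonal complement of the constants and of Heps.  The endpoint -1 cannot
   be ignored: the rate in the ergodic theorem is not controlled by the distance
   to 1 alone (on nearly bipartite expander Schreier graphs the spectrum stays
   away from 1 while an eigenvalue tends to -1).  A spectral gap of L20 forces
   [0 < gap_size]. *)
Definition gap_size : R :=
  1 - sup [set L2norm (gen_average f) | f in
    [set f | [/\ L20 f, (forall g, Heps g -> L2dot f g = 0) & L2norm f <= 1]]].

End Koopman.

(* A family of (pre-)unitary representations of the free group on spaces of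
   functions on [T], all given by f |-> f (g^-1 . _): there is no sequence of
   unit vectors, taken from members of the family, that is almost invariant. *)
Definition uniform_spectral_gap r (T I : Type) (act : freeGroup r -> T -> T)
    (space : I -> set (T -> C)) (nrm : I -> (T -> C) -> R) : Prop :=
  ~ exists (i : nat -> I) (v : nat -> T -> C),
      (forall n, space (i n) (v n) /\ nrm (i n) (v n) = 1) /\
      forall g : freeGroup r,
        (fun n => nrm (i n) (fun x => v n (act g^-1%g x) - v n x)) @ \oo
          --> (0 : R).

Definition spectral_gap_L20 disp (T : measurableType disp) r
    (mu : probability T R) (act : freeGroup r -> T -> T) : Prop :=
  @uniform_spectral_gap r T unit act (fun=> L20 mu) (fun=> L2norm mu).

End Functions.

Notation borelType X := (g_sigma_algebraType (@open X)).

Section BallAverages.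
Variables (R : realType) (r : nat) (X : ptopologicalType).
Variables (mu : probability (borelType X) R) (act : freeGroup r -> X -> X).
Local Notation C := R[i].

(* f0 is the continuous representative of its class, so that f0 x makes sense.
   When mu has full support it is unique up to a scalar of modulus 1, on the
   choice of which [limit_op] does not depend. *)
Definition is_f0 (f0 : X -> C) : Prop :=
  ccontinuous f0 /\
  ((Heps_trivial mu act /\ f0 = fun=> 0) \/ Heps_unit_generator mu act f0).

Definition ball_average (m : nat) (f : X -> C) (x : X) : C :=
  (#|` fset_set (wball r m)|)%:R^-1 *
  \sum_(g <- fset_set (wball r m)) f (act g^-1%g x).

Definition limit_op (f0 f : X -> C) (x : X) : C :=
  cint mu f + (r%:R - 1) / r%:R * L2dot mu f f0 * f0 x.

Definition ball_average_estimate (d : X -> X -> \bar R) (a theta : R) : Prop :=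
  (exists f0, is_f0 f0) /\
  exists K : R, forall f0, is_f0 f0 -> forall f, holder_ball d a f ->
    forall (x : X) (n : nat),
      cabs (ball_average (2 * n) f x - limit_op f0 f x) <=
        K * expR (- (theta * n%:R)).

End BallAverages.

Section Smooth.
Variables (R : realType) (m : nat) (W : normedModType R).

Fixpoint iter_derive (vs : seq 'rV[R]_m) (f : 'rV[R]_m -> W) : 'rV[R]_m -> W :=
  if vs is v :: vs' then fun x => 'D_v (iter_derive vs' f) x else f.

(* C^oo on the open set U. *)
Definition smooth_on (U : set 'rV[R]_m) (f : 'rV[R]_m -> W) : Prop :=
  forall (vs : seq 'rV[R]_m) (x : 'rV[R]_m), U x ->
    {for x, continuous (iter_derive vs f)} /\
    forall v, derivable (iter_derive vs f) x v.

End Smooth.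

Record chart (R : realType) (X : topologicalType) (D : nat) := Chart {
  cdom : set X;
  cmap : X -> 'rV[R]_D;
  cinv : 'rV[R]_D -> X;
  cdom_open : open cdom;
  cimg_open : open (cmap @` cdom);
  cmapK : forall x, cdom x -> cinv (cmap x) = x;
  cmap_continuous : forall x, cdom x -> {for x, continuous cmap};
  cinv_continuous : forall v, (cmap @` cdom) v -> {for v, continuous cinv} }.

Definition cimg (R : realType) (X : topologicalType) D (k : chart R X D) :
  set 'rV[R]_D := cmap k @` cdom k.

Definition quad (R : realType) D (G : 'M[R]_D) (v : 'rV[R]_D) : R :=
  (v *m G *m v^T) 0 0.

(* Compact, not necessarily connected, smooth manifold of dimension D, with a
   Riemannian metric given by its matrices in the charts of the atlas. *)
Record compactRiemannianManifold (R : realType) (D : nat) := {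
  mcarrier :> ptopologicalType;
  m_hausdorff : hausdorff_space mcarrier;
  m_compact : compact [set: mcarrier];
  atlas : set (chart R mcarrier D);
  atlas_cover : forall x : mcarrier, exists2 k, atlas k & cdom k x;
  atlas_smooth : forall k l, atlas k -> atlas l ->
    smooth_on (cmap k @` (cdom k `&` cdom l)) (fun v => cmap l (cinv k v));
  metric : chart R mcarrier D -> 'rV[R]_D -> 'M[R]_D;
  metric_smooth : forall k, atlas k -> forall i j : 'I_D,
    smooth_on (cimg k) (fun v => (metric k v i j : R^o));
  metric_sym : forall k v, atlas k -> cimg k v -> (metric k v)^T = metric k v;
  metric_pos : forall k v w, atlas k -> cimg k v -> w != 0 ->
    0 < quad (metric k v) w;
  metric_compat : forall k l x (w : 'rV[R]_D),
    atlas k -> atlas l -> cdom k x -> cdom l x ->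
    quad (metric k (cmap k x)) w =
    quad (metric l (cmap l x))
      ('D_w (fun v => cmap l (cinv k v)) (cmap k x)) }.

Section RiemannianDistance.
Variables (R : realType) (D : nat) (X : compactRiemannianManifold R D).

Definition C1_curve_in (U : set 'rV[R]_D) (c : R -> 'rV[R]_D) : Prop :=
  [/\ forall t, derivable c t 1, continuous (derive1 c) &
      forall t, 0 <= t <= 1 -> U (c t)].

Definition chart_length (k : chart R X D) (c : R -> 'rV[R]_D) : R :=
  \int[lebesgue_measure]_(t in `[0, 1])
     Num.sqrt (quad (metric k (c t)) (derive1 c t)).

(* [curve_length x y l]: some piecewise C^1 curve from x to y, cut into finitely
   many C^1 pieces each of which lies in one chart, has length l. *)
Inductive curve_length : X -> X -> R -> Prop :=
| CurveNil x : curve_length x x 0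
| CurveCons (k : chart R X D) (c : R -> 'rV[R]_D) y l :
    atlas k -> C1_curve_in (cimg k) c ->
    curve_length (cinv k (c 1)) y l ->
    curve_length (cinv k (c 0)) y (chart_length k c + l).

(* Infinite between points of distinct connected components. *)
Definition riemannian_dist (x y : X) : \bar R :=
  ereal_inf [set l%:E | l in curve_length x y].

End RiemannianDistance.

(* Lebesgue integral over R^n of a nonnegative Borel function, as an iterated
   integral. *)
Fixpoint lebesgue_int (R : realType) (n : nat) :
    ('rV[R]_n -> \bar R) -> \bar R :=
  match n return ('rV[R]_n -> \bar R) -> \bar R with
  | 0 => fun f => f 0
  | n'.+1 => fun f => (\int[lebesgue_measure]_(t in [set: R])
      lebesgue_int (fun v : 'rV[R]_n' =>
        f (row_mx (t%:M : 'rV[R]_1) v : 'rV[R]_(n'.+1))))%E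
  end.

Definition smooth_measure (R : realType) D (X : compactRiemannianManifold R D)
    (mu : probability (borelType X) R) : Prop :=
  forall k : chart R X D, atlas k -> exists rho : 'rV[R]_D -> R,
    [/\ smooth_on (cimg k) (rho : 'rV[R]_D -> R^o),
        forall v, cimg k v -> 0 <= rho v &
        forall A : set (borelType X), measurable A -> A `<=` cdom k ->
          mu A = lebesgue_int (fun v => (\1_(cmap k @` A) v * rho v)%:E)].

Definition full_support (R : realType) (X : ptopologicalType)
    (mu : probability (borelType X) R) : Prop :=
  forall U : set X, open U -> U !=set0 -> (0 < mu U)%E.

Definition isometric_action (R : realType) r (X : Type) (d : X -> X -> \bar R)
    (act : freeGroup r -> X -> X) : Prop :=
  forall g x y, d (act g x) (act g y) = d x y.

Section Cosets.
Variable r : nat.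
Implicit Types H K : set (freeGroup r).

Definition is_subgroup H : Prop :=
  H 1%g /\ forall g h, H g -> H h -> H (g^-1 * h)%g.

Definition ltrans (g : freeGroup r) (A : set (freeGroup r)) :
  set (freeGroup r) := [set (g * h)%g | h in A].

(* The cosets hK, h in H; for K a subgroup of H this is H/K. *)
Definition lcosets_in H K : set (set (freeGroup r)) := [set ltrans h K | h in H].

Definition index_in H K : nat := #|` fset_set (lcosets_in H K)|.

Lemma ltransA g h A : ltrans g (ltrans h A) = ltrans (g * h)%g A.
Proof.
rewrite eqEsubset; split=> x /=.
  by case=> _ [k Ak <-] <-; exists k => //; rewrite mulgA.
by case=> k Ak <-; exists (h * k)%g; [exists k|rewrite mulgA].
Qed.

End Cosets.

Record subgroupChain (r : nat) := SubgroupChain {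
  chain :> nat -> set (freeGroup r);
  chain_subgroup : forall i, is_subgroup (chain i);
  chain_decreasing : forall i, chain i.+1 `<=` chain i;
  chain_finite_index : forall i, finite_set (lcosets_in setT (chain i)) }.

Section Profinite.
Variables (r : nat) (Gam : subgroupChain r).

(* The inverse limit of the F_r/Gam_i: the projection F_r/Gam_{i+1} -> F_r/Gam_i
   sends a coset to the coset that contains it. *)
Definition compatible_cosets (x : nat -> set (freeGroup r)) : Prop :=
  forall i, lcosets_in setT (Gam i) (x i) /\ x i.+1 `<=` x i.

Record profinite : Type := Profinite {
  proj :> nat -> set (freeGroup r);
  proj_compatible : compatible_cosets proj }.

HB.instance Definition _ := gen_eqMixin profinite.
HB.instance Definition _ := gen_choiceMixin profinite.

Lemma compatible_base : compatible_cosets (fun i => ltrans 1%g (Gam i)).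
Proof.
move=> i; split; first by exists 1%g.
by move=> _ [k /chain_decreasing Gk <-]; exists k.
Qed.

HB.instance Definition _ := isPointed.Build profinite
  (Profinite compatible_base).

Lemma compatible_ltrans (g : freeGroup r) (x : profinite) :
  compatible_cosets (fun i => ltrans g (x i)).
Proof.
move=> i; have [[h _ <-] sx] := proj_compatible x i.
split; first by exists (g * h)%g => //; rewrite ltransA.
by move=> _ [k xk <-]; exists k => //; exact: sx.
Qed.

Definition profinite_act (g : freeGroup r) (x : profinite) : profinite :=
  Profinite (compatible_ltrans g x).

(* The inverse limit topology, with basis the fibres of the projections. *)
Definition profinite_open (A : set profinite) : Prop :=
  forall x, A x -> exists i, forall y : profinite, y i = x i -> A y.

Lemma proj_eq_le (x y : profinite) i j :
  (i <= j)%N -> y j = x j -> y i = x i.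
Proof.
elim: j => [|j IH]; first by rewrite leqn0 => /eqP ->.
rewrite leq_eqVlt => /orP[/eqP -> //|]; rewrite ltnS => ij yx; apply: IH => //.
have [[h _ xE] xS] := proj_compatible x j.
have [[k _ yE] yS] := proj_compatible y j.
have [[l _ lE] _] := proj_compatible x j.+1.
have [G1 GV] := chain_subgroup Gam j; have [H1 _] := chain_subgroup Gam j.+1.
have inx : x j l by apply: xS; rewrite -lE; exists 1%g => //; rewrite mulg1.
have iny : y j l.
  by apply: yS; rewrite yx -lE; exists 1%g => //; rewrite mulg1.
have inV p : Gam j p -> Gam j p^-1%g.
  by move=> Gp; rewrite -[(_^-1)%g]mulg1; exact: GV.
have inM p q : Gam j p -> Gam j q -> Gam j (p * q)%g.
  by move=> Gp Gq; rewrite -[p]invgK; exact/GV/Gq/inV.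
suff cosetE p A : ltrans p (Gam j) = A -> A l -> A = ltrans l (Gam j).
  by rewrite (cosetE _ _ xE inx) (cosetE _ _ yE iny).
move=> <- [q Gq ql]; rewrite -ql eqEsubset; split=> z [s Gs <-].
  by exists (q^-1 * s)%g; [exact: GV|rewrite -mulgA mulVKg].
by exists (q * s)%g; [exact: inM|rewrite mulgA].
Qed.

Lemma profinite_openT : profinite_open setT.
Proof. by move=> x _; exists 0%N. Qed.

Lemma profinite_openI : setI_closed profinite_open.
Proof.
move=> A B oA oB x [/oA[i iA] /oB[j jB]]; exists (maxn i j) => y yx.
split; [apply: iA|apply: jB]; apply: proj_eq_le yx;
  by rewrite ?leq_maxl ?leq_maxr.
Qed.

Lemma profinite_open_bigU (I : Type) (f : I -> set profinite) :
  (forall i, profinite_open (f i)) -> profinite_open (\bigcup_i f i).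
Proof.
by move=> of_ x [i _ /of_[j jf]]; exists j => y /jf fy; exists i.
Qed.

HB.instance Definition _ := @isOpenTopological.Build profinite
  profinite_open profinite_openT profinite_openI profinite_open_bigU.

(* The supremum of the empty set is 0. *)
Definition profinite_dist (R : realType) (x y : profinite) : \bar R :=
  (sup [set ((index_in setT (Gam i))%:R : R)^-1 | i in
        [set i | x i <> y i]])%:E.

Definition bounded_steps : Prop :=
  exists M : nat, forall i, (index_in (Gam i) (Gam i.+1) <= M)%N.

(* Property (tau) for the representations on the spaces L^2_0(F_r/Gam_i);
   only the values of v at the cosets of Gam_i matter. *)
Definition property_tau (R : realType) : Prop :=
  @uniform_spectral_gap R r (set (freeGroup r)) nat (@ltrans r)
    (fun i => [set v | \sum_(c <- fset_set (lcosets_in setT (Gam i))) v c = 0])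
    (fun i v => Num.sqrt
       (\sum_(c <- fset_set (lcosets_in setT (Gam i))) cabs (v c) ^+ 2)).

End Profinite.

(* Main.v *)
(* Let h be the average of the generators and their inverses.  The sphere averages
   satisfy a three-term recurrence in h.  Orthogonally to the constants and to
   H^eps, h is a self-adjoint operator of norm 1 - g, and a quadratic energy of two
   consecutive terms of the recurrence decays geometrically, at a rate depending
   on g and r only; hence ball averages decay exponentially in L^2.  On constants
   and on H^eps the sphere averages are 1 and (-1)^n, and the alternating sum of the
   sphere sizes up to 2n, divided by #B_2n, tends to (r - 1) / r.

   That g > 0 follows from the spectral gap: an almost anti-invariant unit vector
   is close to a function with values +-1, and the product of two such functions is
   almost invariant, hence nearly constant, so that these functions accumulate at
   an element of H^eps.

   To pass from L^2 to pointwise bounds, note that the ball averages of a Hoelder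
   function are equi-Hoelder because the action is isometric, so a large value at a
   point forces a large L^2 norm as soon as balls of radius e have measure at least
   c e^D.  By invariance and density of the orbits it is enough to check this lower
   bound at one point.  For a manifold it holds where the density of the smooth
   measure is positive; for the profinite completion it is immediate, with D = 1. *)

Require Import Defs.
From mathcomp Require Import all_boot all_order all_algebra.
From mathcomp Require Import all_classical all_reals all_analysis.
From mathcomp Require Import measurable_realfun finmap complex ring lra zify.

Set Implicit Arguments.
Unset Strict Implicit.
Unset Printing Implicit Defensive.

Import Order.TTheory GRing.Theory Num.Theory.
Import numFieldNormedType.Exports.

Local Open Scope classical_set_scope.
Local Open Scope ring_scope.

(** * Sums over reduced words *)

(** Elements of [Heps] are classes modulo null sets while the estimate is pointwise, so a continuous
    [f0] has to be produced. It comes out of the L^2 convergence itself. Differences of two ball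
    averages of one Lipschitz function are small in L^2 and equi-Lipschitz, hence uniformly small;
    this uses only an abstract element of [Heps], and the uniform limit is affine in [f0]. Being
    Lipschitz with values +-1, the function obtained is constant on balls of a fixed radius, so
    subtracting the limit term does not spoil the Hoelder bound of the averages at small scales.
    Both cases are instances of [metric_ball_average], stated for a finite invariant distance [dd]
    that defines the topology. The Riemannian distance may be infinite and has to be modified to
    fit; for this reason Hoelder bounds are used only for pairs of points at [dd] below 1. *)

Section Words.
Variable r : nat.
Implicit Types (a b : letter r) (w : seq (letter r)).

Definition extends a w : bool := if w is b :: _ then b != letterV a else true.

Lemma pushE a w : push a w = if extends a w then a :: w else behead w.
Proof. by case: w => [|b w] //=; case: eqP. Qed.

Lemma reduced_cons a w : reduced (a :: w) = extends a w && reduced w.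
Proof. by case: w. Qed.

Lemma letter_eqV a b : (a == letterV b) = (b == letterV a).
Proof. by apply/eqP/eqP => ->; rewrite letterVK. Qed.

Lemma card_letter : #|{: letter r}| = (2 * r)%N.
Proof. by rewrite card_prod card_ord card_bool mulnC. Qed.

Lemma card_extends a w : #|[pred b | extends b (a :: w)]| = (2 * r).-1.
Proof.
rewrite (eq_card (B := predC1 (letterV a))) ?cardC1 ?card_letter //.
by move=> b; rewrite !inE /= letter_eqV.
Qed.

Fixpoint words n : seq (seq (letter r)) :=
  if n is n'.+1 then
    [seq a :: w | w <- words n', a <- [seq a <- enum {: letter r} | extends a w]]
  else [:: [::]].

Lemma mem_words n w : (w \in words n) = reduced w && (size w == n).
Proof.
elim: n w => [|n IH] w; first by rewrite inE; case: w => // a w; rewrite andbF.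
apply/allpairsPdep/andP => [[v [a [vn + ->]]]|[]].
  by move: vn; rewrite IH mem_filter reduced_cons /= => /andP[-> /eqP ->] /andP[->].
case: w => // a w; rewrite reduced_cons => /andP[aw rw] sw.
exists w, a; rewrite IH rw mem_filter aw mem_enum; split=> //.
Qed.

Lemma words_uniq n : uniq (words n).
Proof.
elim: n => // n IH; apply: allpairs_uniq_dep => // [w _|].
  by rewrite filter_uniq ?enum_uniq.
by move=> [w a] [v b] _ _ /= [-> ->].
Qed.

Section WordSum.
Variable V : nmodType.
Implicit Types P Q : seq (letter r) -> V.

(** The first letter of the word is summed innermost, so [word_sum n.+2] unfolds to a sum over words
    of length [n] with two letters prepended; [word_sum_pushS] compares sums in that form. *)
Fixpoint word_sum n P : V :=
  if n is n'.+1 then word_sum n' (fun w => \sum_(a | extends a w) P (a :: w))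
  else P [::].

Lemma eq_word_sum n P Q : P =1 Q -> word_sum n P = word_sum n Q.
Proof.
elim: n P Q => [|n IH] P Q PQ /=; first exact: PQ.
by apply: IH => w; apply: eq_bigr => a _; exact: PQ.
Qed.

Lemma word_sumE n P : word_sum n P = \sum_(w <- words n) P w.
Proof.
elim: n P => [|n IH] P /=; first by rewrite big_seq1.
rewrite IH big_allpairs_dep; apply: eq_bigr => w _.
by rewrite big_filter big_enum_cond.
Qed.

Lemma word_sumD n P Q :
  word_sum n (fun w => P w + Q w) = word_sum n P + word_sum n Q.
Proof. by rewrite !word_sumE big_split. Qed.

(** Pushing a letter on a word of length [n + 1] either lengthens it, which yields every word of
    length [n + 2] once, or cancels its first letter. A word of length [n] arises by cancellation
    once for each letter that can precede it: [2 r] letters for the empty word, one less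
    otherwise. *)
Lemma word_sum_pushS n P :
  word_sum n.+1 (fun w => \sum_a P (push a w)) =
  word_sum n.+2 P + word_sum n P *+ (if n is 0 then 2 * r else (2 * r).-1).
Proof.
have -> : word_sum n.+1 (fun w => \sum_a P (push a w)) =
    word_sum n.+2 P + word_sum n (fun w => \sum_(a | extends a w) P w).
  rewrite -[word_sum n.+2 P]/(word_sum n (fun w => \sum_(a | extends a w)
    \sum_(b | extends b (a :: w)) P (b :: a :: w))).
  rewrite -[LHS]/(word_sum n (fun w => \sum_(a | extends a w)
    \sum_b P (push b (a :: w)))).
  rewrite -word_sumD; apply: eq_word_sum => w; rewrite -big_split.
  apply: eq_bigr => a _; rewrite (bigID (fun b => extends b (a :: w))) /=.
  congr (_ + _); first by apply: eq_bigr => b aw; rewrite ifN.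
  rewrite (big_pred1 (letterV a)) => [|b]; first by rewrite letterVK eqxx.
  by rewrite /= negbK letter_eqV.
congr (_ + _); case: n => [|n]; first by rewrite /= sumr_const card_letter.
rewrite !word_sumE -sumrMnl; apply: eq_big_seq => w.
rewrite mem_words => /andP[_]; case: w => // a w _.
by rewrite sumr_const card_extends.
Qed.

Lemma sum_wball m P :
  \sum_(g <- fset_set (wball r m)) P (word g) = \sum_(k < m.+1) word_sum k P.
Proof.
rewrite -(big_map (@word r) xpredT P).
rewrite (perm_big [seq w | k <- iota 0 m.+1, w <- words k]); last first.
  apply: uniq_perm.
  - by rewrite map_inj_uniq; [exact: fset_uniq|exact: val_inj].
  - apply: (@allpairs_uniq_dep _ (fun=> seq (letter r)) _ (fun _ w => w))
      => [|k _|]; first exact: iota_uniq.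
      exact: words_uniq.
    move=> [k w] [l v] /allpairsPdep[k' [w' [_ + [-> ->]]]].
    rewrite mem_words => /andP[_ /eqP <-] /allpairsPdep[l' [v' [_ + [-> ->]]]].
    by rewrite mem_words => /andP[_ /eqP <-] /= ->.
  - move=> w; apply/mapP/allpairsPdep => [[g + ->]|[k [v [+ + ->]]]].
      rewrite in_fset_set; last exact: finite_wball.
      move=> gm; exists (size (word g)), (word g); split=> //.
        by rewrite mem_iota; move: gm => /set_mem.
      by rewrite mem_words word_reduced eqxx.
    rewrite mem_iota /= add0n ltnS mem_words => km /andP[rv /eqP sv].
    exists (FreeGroup rv) => //; rewrite in_fset_set; last exact: finite_wball.
    by apply: mem_set; rewrite /wball /= /wlen /= sv.
rewrite big_allpairs_dep -[iota 0 m.+1]/(index_iota 0 m.+1) big_mkord.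
by apply: eq_bigr => k _; rewrite word_sumE.
Qed.

End WordSum.

Lemma word_sum_wlen (n : nat) (V : nmodType) (P : nat -> V) :
  word_sum n (fun w => P (size w)) =
  P n *+ (if n is n'.+1 then 2 * r * (2 * r).-1 ^ n' else 1).
Proof.
elim: n P => [|n IH] P; first by rewrite mulr1n.
case: n IH => [|n] IH; first by rewrite /= sumr_const card_letter muln1.
rewrite -[LHS]/(word_sum n.+1 (fun w => \sum_(a | extends a w) P (size w).+1)).
rewrite (_ : word_sum n.+1 _ =
   word_sum n.+1 (fun w => P (size w).+1 *+ (2 * r).-1)).
  by rewrite (IH (fun k => P k.+1 *+ (2 * r).-1)) -mulrnA mulnC -mulnA -expnSr.
rewrite !word_sumE; apply: eq_big_seq => w.
rewrite mem_words => /andP[_]; case: w => // a w _.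
by rewrite sumr_const card_extends.
Qed.

End Words.

(** * Real square-integrable functions *)

Section SquareIntegrable.
Context (disp : measure_display) (T : measurableType disp) (R : realType).
Variable mu : probability T R.
Implicit Types (f g h : T -> R) (k : R).

Definition sqint f : Prop :=
  measurable_fun setT f /\ mu.-integrable setT (EFin \o (fun x => f x ^+ 2)).

Definition ip f g : R := \int[mu]_x (f x * g x).

Lemma integrableR_cst k : mu.-integrable setT (EFin \o (fun=> k)).
Proof. exact: finite_measure_integrable_cst. Qed.

Lemma integrableR_D f g : mu.-integrable setT (EFin \o f) ->
  mu.-integrable setT (EFin \o g) ->
  mu.-integrable setT (EFin \o (fun x => f x + g x)).
Proof. by move=> fi gi; exact: (integrableD measurableT fi gi). Qed.

Lemma integrableR_Z k f : mu.-integrable setT (EFin \o f) ->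
  mu.-integrable setT (EFin \o (fun x => k * f x)).
Proof. by move=> fi; exact: (integrableZl measurableT k fi). Qed.

Lemma integrableR_le f g : measurable_fun setT f ->
  (forall x, `|f x| <= g x) -> mu.-integrable setT (EFin \o g) ->
  mu.-integrable setT (EFin \o f).
Proof.
move=> mf fg; apply: le_integrable => //; first exact/measurable_EFinP.
by move=> x _; rewrite /= lee_fin (le_trans (fg x)) ?ler_norm.
Qed.

Lemma sqintM f g : sqint f -> sqint g ->
  mu.-integrable setT (EFin \o (fun x => f x * g x)).
Proof.
move=> [mf fi] [mg gi].
apply: (integrableR_le (g := fun x => f x ^+ 2 + g x ^+ 2)).
- exact: measurable_funM.
- move=> x; rewrite normrM -(real_normK (num_real (f x))).
  rewrite -(real_normK (num_real (g x))).
  have := sqr_ge0 (`|f x| - `|g x|); have := normr_ge0 (f x).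
  have := normr_ge0 (g x); nra.
- exact: integrableR_D.
Qed.

Lemma sqint_cst k : sqint (fun=> k).
Proof. by split; [exact: measurable_cst|exact: integrableR_cst]. Qed.

Lemma sqintZ k f : sqint f -> sqint (fun x => k * f x).
Proof.
move=> [mf fi]; split; first exact: measurable_funM.
have := integrableR_Z (k ^+ 2) fi; apply: eq_integrable => // x _ /=.
by rewrite exprMn.
Qed.

Lemma sqintD f g : sqint f -> sqint g -> sqint (fun x => f x + g x).
Proof.
move=> sf sg; split; first by apply: measurable_funD; [case: sf|case: sg].
apply: (integrableR_le (g := fun x => 2 * (f x ^+ 2 + g x ^+ 2))).
- by apply: measurable_funX; apply: measurable_funD; [case: sf|case: sg].
- move=> x; rewrite ger0_norm ?sqr_ge0 //.
  by have := sqr_ge0 (f x - g x); nra.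
- by apply/integrableR_Z/integrableR_D; [case: sf|case: sg].
Qed.

Lemma sqintN f : sqint f -> sqint (fun x => - f x).
Proof.
move=> /(sqintZ (-1)); congr sqint; apply/funext => x; exact: mulN1r.
Qed.

Lemma sqintB f g : sqint f -> sqint g -> sqint (fun x => f x - g x).
Proof. by move=> sf /sqintN; exact: sqintD. Qed.

Lemma sqint_sum (I : Type) (s : seq I) (P : pred I) (F : I -> T -> R) :
  (forall i, sqint (F i)) -> sqint (fun x => \sum_(i <- s | P i) F i x).
Proof.
move=> sF; elim: s => [|i s IH].
  by under eq_fun do rewrite big_nil; exact: sqint_cst.
under eq_fun do rewrite big_cons; case: (P i) => //; exact: sqintD.
Qed.

Lemma sqint_le f g : measurable_fun setT f -> (forall x, `|f x| <= `|g x|) ->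
  sqint g -> sqint f.
Proof.
move=> mf fg [mg gi]; split=> //; apply: integrableR_le gi.
  exact: measurable_funX.
move=> x; rewrite ger0_norm ?sqr_ge0 // -(real_normK (num_real (f x))).
by rewrite -(real_normK (num_real (g x))) lerXn2r ?nnegrE.
Qed.

Lemma sqint_norm f : sqint f -> sqint (fun x => `|f x|).
Proof.
move=> sf; apply: (sqint_le _ _ sf) => [|x]; last by rewrite normr_id.
by apply: measurableT_comp => //; case: sf.
Qed.

Lemma sqint_bounded f k : measurable_fun setT f -> (forall x, `|f x| <= k) ->
  sqint f.
Proof.
move=> mf fk; apply: (sqint_le mf _ (sqint_cst k)) => x.
by rewrite (le_trans (fk x)) ?ler_norm.
Qed.

Lemma sqint_integrable f : sqint f -> mu.-integrable setT (EFin \o f).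
Proof.
move=> /sqintM/(_ (sqint_cst 1)); apply: eq_integrable => // x _ /=.
by rewrite mulr1.
Qed.

Lemma ip1 f : ip f (fun=> 1) = \int[mu]_x f x.
Proof. by apply: eq_Rintegral => x _; rewrite mulr1. Qed.

Lemma Rintegral_prob_cst k : \int[mu]_x k = k.
Proof.
rewrite Rintegral_cst // -[RHS]mulr1; congr (_ * _).
exact: (congr1 fine (probability_setT mu)).
Qed.

Lemma ip11 : ip (fun=> 1) (fun=> 1) = 1.
Proof. by rewrite ip1 Rintegral_prob_cst. Qed.

Lemma ipC f g : ip f g = ip g f.
Proof. by apply: eq_Rintegral => x _; rewrite mulrC. Qed.

Lemma ipDl f g h : sqint f -> sqint g -> sqint h ->
  ip (fun x => f x + g x) h = ip f h + ip g h.
Proof.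
move=> sf sg sh; rewrite -RintegralD ?sqintM //.
by apply: eq_Rintegral => x _; rewrite mulrDl.
Qed.

Lemma ipZl k f h : sqint f -> sqint h ->
  ip (fun x => k * f x) h = k * ip f h.
Proof.
move=> sf sh; rewrite -RintegralZl ?sqintM //.
by apply: eq_Rintegral => x _; rewrite mulrA.
Qed.

Lemma ipNl f h : sqint f -> sqint h -> ip (fun x => - f x) h = - ip f h.
Proof.
move=> sf sh; rewrite -mulN1r -ipZl //; congr ip.
by apply/funext => x; rewrite mulN1r.
Qed.

Lemma ipBl f g h : sqint f -> sqint g -> sqint h ->
  ip (fun x => f x - g x) h = ip f h - ip g h.
Proof. by move=> sf sg sh; rewrite ipDl ?ipNl //; exact: sqintN. Qed.

Lemma ip_suml (I : Type) (s : seq I) (P : pred I) (F : I -> T -> R) h :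
  (forall i, sqint (F i)) -> sqint h ->
  ip (fun x => \sum_(i <- s | P i) F i x) h = \sum_(i <- s | P i) ip (F i) h.
Proof.
move=> sF sh; elim: s => [|i s IH].
  rewrite big_nil -[RHS](mul0r (ip (fun=> 0) h)) -ipZl //; last exact: sqint_cst.
  by congr ip; apply/funext => x; rewrite big_nil mul0r.
rewrite big_cons; under eq_fun do rewrite big_cons.
by case: (P i) => //; rewrite ipDl ?IH //; exact: sqint_sum.
Qed.

Lemma ip_ge0 f : 0 <= ip f f.
Proof. by apply: Rintegral_ge0 => x _; rewrite -expr2 sqr_ge0. Qed.

Lemma ip_comb a b f g : sqint f -> sqint g ->
  ip (fun x => a * f x + b * g x) (fun x => a * f x + b * g x) =
  a ^+ 2 * ip f f + 2 * a * b * ip f g + b ^+ 2 * ip g g.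
Proof.
move=> sf sg; have sa := sqintZ a sf; have sb := sqintZ b sg.
have sab := sqintD sa sb.
rewrite ipDl // !ipZl // ![ip _ (fun x => _ + _)]ipC !ipDl // !ipZl //.
by rewrite [ip g f]ipC; ring.
Qed.

Lemma ip_combD s f g : sqint f -> sqint g ->
  ip (fun x => f x + s * g x) (fun x => f x + s * g x) =
  ip f f + 2 * s * ip f g + s ^+ 2 * ip g g.
Proof.
move=> sf sg; transitivity (ip (fun x => 1 * f x + s * g x) (fun x => 1 * f x + s * g x)).
  by apply: eq_Rintegral => x _; rewrite mul1r.
by rewrite ip_comb //; ring.
Qed.

Lemma ip_combB s f g : sqint f -> sqint g ->
  ip (fun x => f x - s * g x) (fun x => f x - s * g x) =
  ip f f - 2 * s * ip f g + s ^+ 2 * ip g g.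
Proof.
move=> sf sg; transitivity (ip (fun x => f x + (- s) * g x) (fun x => f x + (- s) * g x)).
  by apply: eq_Rintegral => x _; rewrite mulNr.
by rewrite ip_combD //; ring.
Qed.

Lemma ip_subb f g : sqint f -> sqint g ->
  ip (fun x => f x - g x) (fun x => f x - g x) =
  ip f f - 2 * ip f g + ip g g.
Proof.
move=> sf sg; transitivity (ip (fun x => f x - 1 * g x) (fun x => f x - 1 * g x)).
  by apply: eq_Rintegral => x _; rewrite mul1r.
by rewrite ip_combB //; ring.
Qed.

Lemma cauchy_schwarz f g : sqint f -> sqint g ->
  ip f g ^+ 2 <= ip f f * ip g g.
Proof.
move=> sf sg; have ffp := ip_ge0 f; have ggp := ip_ge0 g.
have K a b : 0 <= a ^+ 2 * ip f f + 2 * a * b * ip f g + b ^+ 2 * ip g g.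
  by rewrite -ip_comb // ip_ge0.
have [gg0|gg_neq0] := eqVneq (ip g g) 0.
  rewrite gg0 mulr0 exprn_even_le0 //=; apply/eqP; apply: contrapT => fg0.
  (* This coefficient makes the quadratic form equal to -1 when [ip g g] vanishes, against its
     positivity. *)
  have := K 1 (- (ip f f + 1) / (2 * ip f g)); rewrite gg0.
  suff -> : 2 * 1 * (- (ip f f + 1) / (2 * ip f g)) * ip f g =
     - (ip f f + 1) by lra.
  by field; apply/eqP.
have gg_gt0 : 0 < ip g g by rewrite lt_neqAle eq_sym gg_neq0.
have := K (ip g g) (- ip f g).
rewrite (_ : _ + _ = ip g g * (ip f f * ip g g - ip f g ^+ 2)); last by ring.
by rewrite pmulr_rge0 // subr_ge0.
Qed.

Definition nrm2 f : R := Num.sqrt (ip f f).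

Lemma nrm2_ge0 f : 0 <= nrm2 f. Proof. exact: sqrtr_ge0. Qed.

Lemma sqr_nrm2 f : nrm2 f ^+ 2 = ip f f.
Proof. by rewrite sqr_sqrtr ?ip_ge0. Qed.

Lemma ler_ip f g : sqint f -> sqint g -> `|ip f g| <= nrm2 f * nrm2 g.
Proof.
move=> sf sg; rewrite -(@ler_pXn2r _ 2) ?nnegrE ?mulr_ge0 ?nrm2_ge0 //.
by rewrite exprMn !sqr_nrm2 (real_normK (num_real (ip f g))) cauchy_schwarz.
Qed.

Lemma ler_nrm2D f g : sqint f -> sqint g ->
  nrm2 (fun x => f x + g x) <= nrm2 f + nrm2 g.
Proof.
move=> sf sg; rewrite -(@ler_pXn2r _ 2) ?nnegrE ?addr_ge0 ?nrm2_ge0 //.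
have := ip_comb 1 1 sf sg; rewrite (_ : (fun x => _) = fun x => f x + g x).
  rewrite sqr_nrm2 => ->; rewrite sqrrD !sqr_nrm2.
  by have := le_trans (ler_norm _) (ler_ip sf sg); lra.
by apply/funext => x; rewrite !mul1r.
Qed.

Lemma nrm2Z k f : sqint f -> nrm2 (fun x => k * f x) = `|k| * nrm2 f.
Proof.
move=> sf; rewrite /nrm2 ipZl ?[ip f _]ipC ?ipZl //; last exact: sqintZ.
by rewrite mulrA -expr2 sqrtrM ?sqr_ge0 // sqrtr_sqr.
Qed.

Lemma nrm2N f : nrm2 (fun x => - f x) = nrm2 f.
Proof.
by congr Num.sqrt; apply: eq_Rintegral => x _; rewrite mulrNN.
Qed.

Lemma ler_nrm2B f g : sqint f -> sqint g ->
  nrm2 (fun x => f x - g x) <= nrm2 f + nrm2 g.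
Proof. by move=> sf sg; rewrite -(nrm2N g) ler_nrm2D //; exact: sqintN. Qed.

Lemma nrm2_cst k : nrm2 (fun=> k) = `|k|.
Proof. by rewrite /nrm2 /ip Rintegral_prob_cst -expr2 sqrtr_sqr. Qed.

Lemma ler_nrm2 f g : measurable_fun setT f -> (forall x, `|f x| <= `|g x|) ->
  sqint g -> nrm2 f <= nrm2 g.
Proof.
move=> mf fg sg; have sf := sqint_le mf fg sg.
apply: ler_wsqrtr; apply: le_Rintegral; rewrite ?sqintM// => x _.
rewrite -!expr2 -(real_normK (num_real (f x))).
by rewrite -(real_normK (num_real (g x))) lerXn2r ?nnegrE.
Qed.

Lemma ler_nrm2_sum (I : Type) (s : seq I) (P : pred I) (F : I -> T -> R) :
  (forall i, sqint (F i)) ->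
  nrm2 (fun x => \sum_(i <- s | P i) F i x) <= \sum_(i <- s | P i) nrm2 (F i).
Proof.
move=> sF; elim: s => [|i s IH].
  by rewrite big_nil; under eq_fun do rewrite big_nil; rewrite nrm2_cst normr0.
rewrite big_cons; under eq_fun do rewrite big_cons; case: (P i) => //.
by rewrite (le_trans (ler_nrm2D _ _)) ?lerD2l //; exact: sqint_sum.
Qed.

Lemma ip_eq0_ae f : sqint f -> ip f f = 0 -> {ae mu, forall x, f x = 0}.
Proof.
move=> sf f0; have /integrableP[mff _] := sqintM sf sf.
have [+ _] := ae_eq_integral_abs mu measurableT mff.
have -> : (\int[mu]_x `|(EFin \o (fun x => f x * f x)%R) x| =
           \int[mu]_x (f x * f x)%R%:E)%E.
  by apply: eq_integral => x _; rewrite /= ger0_norm // -[f x * f x]expr2 sqr_ge0.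
have -> : (\int[mu]_x (f x * f x)%R%:E = (ip f f)%:E)%E.
  by rewrite /ip /Rintegral fineK //; exact: integrable_fin_num (sqintM sf sf).
rewrite f0 => /(_ erefl); apply: filterS => x /(_ Logic.I) [] /eqP.
by rewrite -expr2 sqrf_eq0 => /eqP.
Qed.

Lemma eq_ae_Rintegral f g : measurable_fun setT f -> measurable_fun setT g ->
  {ae mu, forall x, f x = g x} -> \int[mu]_x f x = \int[mu]_x g x.
Proof.
move=> mf mg fg; congr fine; apply: ae_eq_integral => //.
- exact/measurable_EFinP.
- exact/measurable_EFinP.
- by apply: filterS fg => x /= ->.
Qed.

Lemma ae_imp (P Q : T -> Prop) : (forall x, P x -> Q x) ->
  {ae mu, forall x, P x} -> {ae mu, forall x, Q x}.
Proof. by move=> PQ; apply: filterS. Qed.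

Lemma ae_imp2 (P Q S : T -> Prop) : (forall x, P x -> Q x -> S x) ->
  {ae mu, forall x, P x} -> {ae mu, forall x, Q x} -> {ae mu, forall x, S x}.
Proof. by move=> PQS; apply: filterS2. Qed.

(** * Measure-preserving maps *)

Section MeasurePreserving.
Variable phi : T -> T.
Hypothesis mphi : measurable_fun setT phi.
Hypothesis phi_mu : forall A, measurable A -> mu (phi @^-1` A) = mu A.

Lemma ge0_integral_preserving (f : T -> \bar R) : measurable_fun setT f ->
  (forall x, 0 <= f x)%E -> (\int[mu]_x f (phi x) = \int[mu]_x f x)%E.
Proof.
move=> mf f0; rewrite -[LHS]/(\int[mu]_(x in phi @^-1` setT) (f \o phi) x)%E.
rewrite -(ge0_integral_pushforward mphi) //; apply/esym.
by apply: eq_measure_integral => A mA _; rewrite /= /pushforward phi_mu.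
Qed.

Lemma integrable_preserving f : mu.-integrable setT (EFin \o f) ->
  mu.-integrable setT (EFin \o (f \o phi)).
Proof.
move=> /integrableP[mf foo]; apply/integrableP; split.
  exact: (measurableT_comp mf mphi).
rewrite (ge0_integral_preserving (f := fun x => `|(f x)%:E|)%E) //.
exact: measurableT_comp.
Qed.

Lemma Rintegral_preserving f : mu.-integrable setT (EFin \o f) ->
  \int[mu]_x f (phi x) = \int[mu]_x f x.
Proof.
move=> fi; have /integrableP[mf _] := fi; congr fine.
rewrite -[LHS]/(\int[mu]_(x in phi @^-1` setT) ((EFin \o f) \o phi) x)%E.
rewrite -(integral_pushforward mphi) //; last exact: integrable_preserving.
apply/esym.
by apply: eq_measure_integral => A mA _; rewrite /= /pushforward phi_mu.
Qed.

Lemma sqint_preserving f : sqint f -> sqint (f \o phi).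
Proof.
move=> [mf fi]; split; first exact: measurableT_comp.
exact: integrable_preserving fi.
Qed.

Lemma ip_preserving f g : sqint f -> sqint g ->
  ip (f \o phi) (g \o phi) = ip f g.
Proof. by move=> sf sg; exact: Rintegral_preserving (sqintM sf sg). Qed.

Lemma nrm2_preserving f : sqint f -> nrm2 (f \o phi) = nrm2 f.
Proof. by move=> sf; rewrite /nrm2 ip_preserving. Qed.

End MeasurePreserving.

End SquareIntegrable.

(** * Sphere and ball averages *)

Section Generators.
Variable r : nat.
Implicit Types (a : letter r) (w : seq (letter r)).

(** Defined for all words, reduced or not, so that summands over words carry no proofs of
    reducedness. *)
Definition word_elt w : freeGroup r := FreeGroup (foldr_push_reduced w (v := [::]) isT).

Definition letter_elt a : freeGroup r := word_elt [:: a].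

Lemma word_eltK (g : freeGroup r) : word_elt (word g) = g.
Proof. by apply/val_inj; rewrite /= foldr_push_id // word_reduced. Qed.

Lemma word_elt_push a w : word_elt (push a w) = (letter_elt a * word_elt w)%g.
Proof. by apply/val_inj; rewrite /= foldr_push_push. Qed.

Lemma word_elt_cons a w : word_elt (a :: w) = (letter_elt a * word_elt w)%g.
Proof. exact/val_inj. Qed.

Lemma letter_eltV a : (letter_elt a)^-1%g = letter_elt (letterV a).
Proof. exact/val_inj. Qed.

Lemma letter_elt_gen (i : 'I_r) (b : bool) :
  letter_elt (i, b) = (if b then free_gen i else (free_gen i)^-1)%g.
Proof. by case: b; apply/val_inj. Qed.

Lemma wlen_letter a : wlen (letter_elt a) = 1%N.
Proof. by []. Qed.

Lemma freeGroup_ind (P : freeGroup r -> Prop) : P 1%g ->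
  (forall a g, P g -> P (letter_elt a * g)%g) -> forall g, P g.
Proof.
move=> P1 PS g; rewrite -(word_eltK g); elim: (word g) => [|a w IH].
  by rewrite (_ : word_elt [::] = 1%g) //; exact/val_inj.
by rewrite word_elt_cons; exact: PS.
Qed.

Lemma odd_push a w : odd (size (push a w)) = ~~ odd (size w).
Proof. by rewrite pushE; case: w => [|b w] //=; case: ifP => //=; rewrite negbK. Qed.

(** Each [push] changes the length by exactly one. This is what makes [eps] a character. *)
Lemma odd_wlenM (g h : freeGroup r) :
  odd (wlen (g * h)%g) = odd (wlen g) (+) odd (wlen h).
Proof.
rewrite /wlen /=; elim: (word g) => //= a u IH.
by rewrite odd_push IH addNb.
Qed.

Variable R : pzRingType.
Definition eps (g : freeGroup r) : R := (-1) ^+ wlen g.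

Lemma epsE g : eps g = (-1) ^+ odd (wlen g).
Proof. by rewrite signr_odd. Qed.

Lemma epsM g h : eps (g * h)%g = eps g * eps h.
Proof. by rewrite !epsE odd_wlenM signr_addb. Qed.

Lemma eps_letter a : eps (letter_elt a) = -1.
Proof. by rewrite /eps wlen_letter expr1. Qed.

End Generators.

Section Averages.
Context (R : realType) (r : nat) (T : Type) (act : freeGroup r -> T -> T).
Hypothesis actP : is_action act.
Implicit Types (f : T -> R) (x : T).

Lemma act1 x : act 1%g x = x. Proof. by case: actP => + _; exact. Qed.

Lemma actM g h x : act (g * h)%g x = act g (act h x).
Proof. by case: actP => _; exact. Qed.

Lemma actK g x : act g^-1%g (act g x) = x.
Proof. by rewrite -actM mulVg act1. Qed.

Lemma actVK g x : act g (act g^-1%g x) = x.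
Proof. by rewrite -actM mulgV act1. Qed.

Definition sphere_size n : nat :=
  if n is n'.+1 then 2 * r * (2 * r).-1 ^ n' else 1.

Definition sphere_sum n f x : R :=
  word_sum n (fun w => f (act (word_elt w)^-1%g x)).

Definition gen_avg f x : R :=
  (2 * r)%:R^-1 * \sum_a f (act (letter_elt a)^-1%g x).

Definition sphere_avg n f x : R := (sphere_size n)%:R^-1 * sphere_sum n f x.

Definition ball_avg m f x : R :=
  (\sum_(k < m.+1) sphere_size k)%:R^-1 * \sum_(k < m.+1) sphere_sum k f x.

Lemma card_wball m :
  #|` fset_set (wball r m)| = (\sum_(k < m.+1) sphere_size k)%N.
Proof.
rewrite -sum1_size (sum_wball m (fun=> 1%N)); apply: eq_bigr => k _.
by rewrite (word_sum_wlen r k (fun=> 1%N)) -mulr_natr mul1r natn.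
Qed.

Lemma ball_avgE m f x : ball_avg m f x =
  (#|` fset_set (wball r m)|)%:R^-1 *
  \sum_(g <- fset_set (wball r m)) f (act g^-1%g x).
Proof.
rewrite card_wball; congr (_ * _).
rewrite -(sum_wball m (fun w => f (act (word_elt w)^-1%g x))).
by apply: eq_bigr => g _; rewrite word_eltK.
Qed.

Lemma sphere_sum0 f x : sphere_sum 0 f x = f x.
Proof.
rewrite /sphere_sum /= (_ : word_elt [::] = 1%g) ?invg1 ?act1 //.
exact/val_inj.
Qed.

Hypothesis r_gt1 : (1 < r)%N.

Lemma natr2r_neq0 : (2 * r)%:R != 0 :> R.
Proof. by rewrite pnatr_eq0; lia. Qed.

Lemma sphere_sum1 f x : sphere_sum 1 f x = (2 * r)%:R * gen_avg f x.
Proof.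
rewrite /gen_avg mulrA divff ?natr2r_neq0 // mul1r.
by rewrite /sphere_sum /=; apply: eq_bigl; case.
Qed.

(** The inverse in the action on functions turns an outer average over letters into prepending a
    letter to the word, so the combinatorial recurrence [word_sum_pushS] applies. *)
Lemma sphere_sumSS n f x : sphere_sum n.+2 f x =
  (2 * r)%:R * gen_avg (sphere_sum n.+1 f) x -
  (if n is 0 then 2 * r else (2 * r).-1)%:R * sphere_sum n f x.
Proof.
have := word_sum_pushS n (fun w => f (act (word_elt w)^-1%g x)).
move=> E; rewrite [X in _ - X]mulr_natl.
rewrite /gen_avg mulrA divff ?natr2r_neq0 // mul1r.
rewrite -[sphere_sum n.+2 f x](addrK (sphere_sum n f x *+
  (if n is 0 then 2 * r else (2 * r).-1))) -E.
congr (_ - _).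
rewrite word_sumE exchange_big /=; apply: eq_bigr => a _.
rewrite /sphere_sum word_sumE; apply: eq_bigr => w _.
by rewrite word_elt_push invgM actM.
Qed.

End Averages.

(** * Energy decay *)

(* [gamma] and [rho_gap] are chosen so that
   [rho N_n - N_(n+1) = (rho - gamma) |a_(n+1)|^2 - 2 b (rho - c) <a_(n+1), h a_n>
     + (rho gamma - c^2) |a_n|^2 >= 0]
   where [N_n = |a_(n+1)|^2 - 2 b <a_(n+1), h a_n> + gamma |a_n|^2], [b = (1 + c) / 2]
   and [a_(n+2) = 2 b h a_(n+1) - c a_n]: the terms in [h^2] cancel, so that no
   spectral theorem is needed for the self-adjoint operator [h]. *)
Section Rate.
Variables (R : realType) (r : nat).

Definition backtrack : R := (2 * r%:R - 1)^-1.

Definition rho_gap (g : R) : R := 1 - (1 - backtrack ^+ 2) / 2 * g.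

Hypothesis r_gt1 : (1 < r)%N.

Let r2 : 2 <= r%:R :> R. Proof. by rewrite (ler_nat _ 2). Qed.

Lemma backtrack_bound : 0 < backtrack <= 3^-1.
Proof.
have r2' := r2; apply/andP; rewrite /backtrack; split; first by rewrite invr_gt0; lra.
by rewrite lef_pV2 ?posrE; lra.
Qed.

Let coef_gt0 : 0 < (1 - backtrack ^+ 2) / 2.
Proof. by have /andP[] := backtrack_bound; move: backtrack => c; nra. Qed.

Lemma rho_gap_bound g : 0 <= g <= 1 ->
  (1 + backtrack ^+ 2) / 2 <= rho_gap g <= 1.
Proof.
move=> /andP[g0 g1]; rewrite /rho_gap; have A0 := coef_gt0.
have Ag : 0 <= (1 - backtrack ^+ 2) / 2 * g by rewrite mulr_ge0 // ltW.
have gA : (1 - backtrack ^+ 2) / 2 * g <= (1 - backtrack ^+ 2) / 2.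
  by rewrite ler_piMr // ltW.
by apply/andP; split; lra.
Qed.

Lemma rho_gap_lt1 g : 0 < g -> rho_gap g < 1.
Proof. by move=> g0; rewrite /rho_gap gtrBl mulr_gt0 // coef_gt0. Qed.

(** From [2 c <= 1 + c^2]. Sphere sizes thus grow at least as fast as squared norms decay, which
    lets the outermost sphere dominate a ball average. *)
Lemma backtrack_le_rho g : 0 <= g <= 1 -> backtrack <= rho_gap g.
Proof.
move=> /rho_gap_bound /andP[+ _]; have := sqr_ge0 (1 - backtrack); lra.
Qed.

Lemma rho_gap_gt0 g : 0 <= g <= 1 -> 0 < rho_gap g.
Proof. by move=> /backtrack_le_rho; have /andP[+ _] := backtrack_bound; lra. Qed.

End Rate.

Section Energy.
Context (disp : measure_display) (T : measurableType disp) (R : realType).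
Variables (mu : probability T R) (r : nat).
Hypothesis r_gt1 : (1 < r)%N.
Variables (h : (T -> R) -> T -> R) (a_ : nat -> T -> R) (q : R).
Hypothesis q01 : 0 <= q <= 1.
Hypothesis sqint_a : forall n, sqint mu (a_ n).
Hypothesis sqint_h : forall f, sqint mu f -> sqint mu (h f).
Hypothesis h_sym : forall f g, sqint mu f -> sqint mu g ->
  ip mu (h f) g = ip mu f (h g).
Hypothesis h_contr : forall n, nrm2 mu (h (a_ n)) <= q * nrm2 mu (a_ n).
Local Notation c := (backtrack R r).
Local Notation rho := (rho_gap r (1 - q)).
Hypothesis a1E : a_ 1 = h (a_ 0).
Hypothesis aSSE : forall n x, a_ n.+2 x = (1 + c) * h (a_ n.+1) x - c * a_ n x.

Let gam := (1 + c ^+ 2) / 2.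

Let energy n := ip mu (a_ n.+1) (a_ n.+1)
  - (1 + c) * ip mu (a_ n.+1) (h (a_ n)) + gam * ip mu (a_ n) (a_ n).

Let cross n : `|ip mu (a_ n.+1) (h (a_ n))| <=
  q * (nrm2 mu (a_ n.+1) * nrm2 mu (a_ n)).
Proof.
rewrite (le_trans (ler_ip (sqint_a _) (sqint_h (sqint_a _)))) //.
by rewrite mulrCA ler_wpM2l ?nrm2_ge0.
Qed.

Lemma energy_decr n : energy n.+1 <= rho * energy n.
Proof.
have [sx sy] := (sqint_a n.+1, sqint_a n); have sh := sqint_h sx.
have E : a_ n.+2 = fun x => (1 + c) * h (a_ n.+1) x + (- c) * a_ n x.
  by apply/funext => x; rewrite aSSE mulNr.
have E1 : ip mu (a_ n.+2) (h (a_ n.+1)) = (1 + c) *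
    ip mu (h (a_ n.+1)) (h (a_ n.+1)) - c * ip mu (a_ n.+1) (h (a_ n)).
  rewrite E ipDl ?ipZl //; try exact: sqintZ.
  by rewrite mulNr -(h_sym sy sx) [ip mu (h (a_ n)) _]ipC.
rewrite /energy E1 {1 2}E ip_comb // (h_sym sx sy).
have := cross n; rewrite -!sqr_nrm2 /rho_gap /gam.
have /andP[c0 c3] := backtrack_bound R r_gt1.
have [X0 Y0] := (nrm2_ge0 mu (a_ n.+1), nrm2_ge0 mu (a_ n)).
move: (nrm2 mu (a_ n.+1)) (nrm2 mu (a_ n)) X0 Y0 => X Y X0 Y0.
move: (nrm2 _ _) (ip _ _ _) => Z s; rewrite ler_norml => /andP[s1 s2].
move: c c0 c3 => c c0 c3; have /andP[q0 q1] := q01.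
set A := (1 - c ^+ 2) / 2.
have A0 : 0 <= A by rewrite /A; nra.
rewrite -subr_ge0.
(* The [Z] terms cancel; what remains is a sum of nonnegative terms, the third one by the bound
   [s <= q X Y] on the cross term. *)
have -> : (1 - A * (1 - q)) * (X ^+ 2 - (1 + c) * s + (1 + c ^+ 2) / 2 * Y ^+ 2)
  - ((1 + c) ^+ 2 * Z ^+ 2 + 2 * (1 + c) * - c * s + (- c) ^+ 2 * Y ^+ 2 -
     (1 + c) * ((1 + c) * Z ^+ 2 - c * s) + (1 + c ^+ 2) / 2 * X ^+ 2) =
  A * q * (X - Y) ^+ 2 + A ^+ 2 * (1 - q) * Y ^+ 2
  + (2 * A - (1 + c) * A * (1 - q)) * (q * (X * Y) - s)
  + (1 + c) * A * (1 - q) * (q * (X * Y)).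
  by rewrite /A; field.
have XY : 0 <= q * (X * Y) by rewrite !mulr_ge0.
have Aq : 0 <= A * (1 - q) by rewrite mulr_ge0 // subr_ge0.
have KA : 0 <= 2 * A - (1 + c) * A * (1 - q) by rewrite -mulrA; nra.
have c1 : 0 <= 1 + c by rewrite addr_ge0 // ltW.
apply: addr_ge0; [apply: addr_ge0; [apply: addr_ge0|]|].
- apply: mulr_ge0; [exact: mulr_ge0|exact: sqr_ge0].
- apply: mulr_ge0; last exact: sqr_ge0.
  by apply: mulr_ge0; [exact: sqr_ge0|rewrite subr_ge0].
- by apply: mulr_ge0 => //; rewrite subr_ge0.
- by rewrite mulr_ge0 // -mulrA mulr_ge0.
Qed.

Lemma energy_decay n : ip mu (a_ n) (a_ n) <= 9 * rho ^+ n * ip mu (a_ 0) (a_ 0).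
Proof.
have /andP[c0 c3] := backtrack_bound R r_gt1; have /andP[q0 q1] := q01.
have rho0 : 0 < rho by apply: rho_gap_gt0 => //; apply/andP; split; lra.
(* Completing the square in [X], the energy is at least [(1 - c)^2 / 4] times [Y^2], and [c <= 1/3]
   makes this coefficient at least [1/9]. *)
have lo : ip mu (a_ n) (a_ n) <= 9 * energy n.
  rewrite /energy; have := cross n; rewrite -!sqr_nrm2 /gam.
  have [X0 Y0] := (nrm2_ge0 mu (a_ n.+1), nrm2_ge0 mu (a_ n)).
  move: (nrm2 mu (a_ n.+1)) (nrm2 mu (a_ n)) X0 Y0 => X Y X0 Y0.
  move: (ip _ _ _) => s; rewrite ler_norml => /andP[s1 s2].
  have sXY : s <= X * Y by rewrite (le_trans s2) // ler_piMl // mulr_ge0.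
  have := sqr_ge0 (2 * X - (1 + c) * Y); move: c c0 c3 => c c0 c3.
  have := sqr_ge0 Y.
  have : (1 + c) * s <= (1 + c) * (X * Y) by rewrite ler_wpM2l //; lra.
  have : 1 / 9 * Y ^+ 2 <= (1 - c) ^+ 2 / 4 * Y ^+ 2.
    by rewrite ler_wpM2r ?sqr_ge0 //; nra.
  by lra.
have hi : energy n <= rho ^+ n * energy 0.
  elim: n {lo} => [|n IH]; first by rewrite mul1r.
  by rewrite (le_trans (energy_decr n)) // exprS -mulrA ler_wpM2l // ltW.
have e0 : energy 0 <= ip mu (a_ 0) (a_ 0).
  rewrite /energy a1E; have := ip_ge0 mu (h (a_ 0)); have := ip_ge0 mu (a_ 0).
  move: (ip _ _ _) (ip _ _ _) => X Y Y0 X0; rewrite /gam.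
  have : 0 <= c * X by rewrite mulr_ge0 // ltW.
  have : (1 + c ^+ 2) / 2 * Y <= Y by apply: ler_piMl => //; nra.
  by lra.
rewrite (le_trans lo) // -mulrA ler_pM2l ?ltr0n // (le_trans hi) // ler_wpM2l //.
by rewrite exprn_ge0 // ltW.
Qed.

Lemma nrm2_decay n :
  nrm2 mu (a_ n) <= 3 * Num.sqrt rho ^+ n * nrm2 mu (a_ 0).
Proof.
have /andP[q0 q1] := q01.
have rho0 : 0 < rho by apply: rho_gap_gt0 => //; apply/andP; split; lra.
rewrite -(@ler_pXn2r _ 2) ?nnegrE ?mulr_ge0 ?nrm2_ge0 ?exprn_ge0 ?sqrtr_ge0 //.
rewrite !exprMn !sqr_nrm2 -exprM mulnC exprM sqr_sqrtr ?(ltW rho0) //.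
by rewrite (_ : 3 ^+ 2 = 9) ?energy_decay //; lra.
Qed.

End Energy.

(** * Decay of sphere and ball averages in L^2 *)

Section AverageDecay.
Context (disp : measure_display) (T : measurableType disp) (R : realType).
Variables (mu : probability T R) (r : nat) (act : freeGroup r -> T -> T).
Hypothesis r_gt1 : (1 < r)%N.
Hypothesis actP : is_action act.
Hypothesis act_meas : forall g, measurable_fun setT (act g).
Hypothesis act_mu : invariant_measure mu act.
Implicit Types (f u v : T -> R) (g : freeGroup r) (q : R).

Lemma sqint_act g f : sqint mu f -> sqint mu (fun x => f (act g x)).
Proof. exact: sqint_preserving (act_meas g) (act_mu g) f. Qed.

Lemma ip_act g f u : sqint mu f -> sqint mu u ->
  ip mu (fun x => f (act g x)) (fun x => u (act g x)) = ip mu f u.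
Proof. exact: ip_preserving (act_meas g) (act_mu g) f u. Qed.

Lemma nrm2_act g f : sqint mu f -> nrm2 mu (fun x => f (act g x)) = nrm2 mu f.
Proof. exact: nrm2_preserving (act_meas g) (act_mu g) f. Qed.

Lemma Rintegral_act g f : mu.-integrable setT (EFin \o f) ->
  \int[mu]_x f (act g x) = \int[mu]_x f x.
Proof. exact: Rintegral_preserving (act_meas g) (act_mu g) f. Qed.

Lemma ip_actV g f u : sqint mu f -> sqint mu u ->
  ip mu (fun x => f (act g^-1%g x)) u = ip mu f (fun x => u (act g x)).
Proof.
move=> sf su; rewrite -(ip_act g^-1%g sf (sqint_act g su)).
by congr ip; apply/funext => x; rewrite actVK.
Qed.

Lemma sqint_gen_avg f : sqint mu f -> sqint mu (gen_avg act f).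
Proof.
by move=> sf; apply/sqintZ/sqint_sum => a; exact: sqint_act.
Qed.

Lemma nrm2_gen_avg f : sqint mu f -> nrm2 mu (gen_avg act f) <= nrm2 mu f.
Proof.
move=> sf; rewrite nrm2Z; last by apply: sqint_sum => a; exact: sqint_act.
rewrite ger0_norm ?invr_ge0 ?ler0n // ler_pdivrMl ?ltr0n; last lia.
rewrite (le_trans (ler_nrm2_sum _ _ _)) => [//|a|]; first exact: sqint_act.
rewrite (eq_bigr (fun=> nrm2 mu f)); last by move=> a _; rewrite nrm2_act.
by rewrite sumr_const card_letter mulr_natl.
Qed.

(** The adjoint of a letter acts as its inverse, and inversion permutes the letters. *)
Lemma gen_avg_sym f u : sqint mu f -> sqint mu u ->
  ip mu (gen_avg act f) u = ip mu f (gen_avg act u).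
Proof.
move=> sf su; rewrite [RHS]ipC.
have ss h : sqint mu h -> sqint mu
    (fun x => \sum_a h (act (letter_elt a)^-1%g x)).
  by move=> sh; apply: sqint_sum => a; exact: sqint_act.
have sa h a : sqint mu h -> sqint mu (fun x => h (act (letter_elt a)^-1%g x)).
  exact: sqint_act.
rewrite ipZl //; last exact: ss.
rewrite ipZl //; last exact: ss.
congr (_ * _); rewrite ip_suml // => [|a]; last exact: sa.
rewrite ip_suml // => [|a]; last exact: sa.
rewrite (reindex_inj (inv_inj (@letterVK r))); apply: eq_bigr => a _.
by rewrite ip_actV // ipC -letter_eltV.
Qed.

(** Real counterpart of [Heps]: the averaging operators have real coefficients, so the complex
    problem splits into real and imaginary parts. *)
Definition hepsR u : Prop := sqint mu u /\
  forall g, {ae mu, forall x, u (act g^-1%g x) = eps R g * u x}.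

Definition ortho1eps v : Prop := [/\ sqint mu v, \int[mu]_x v x = 0 &
  forall u, hepsR u -> ip mu v u = 0].

Lemma gen_avg_cst (k : R) : gen_avg act (fun=> k) = fun=> k.
Proof.
apply/funext => x; rewrite /gen_avg sumr_const card_letter -[k *+ _]mulr_natl mulrA.
by rewrite mulVf ?mul1r // natr2r_neq0.
Qed.

(** Group elements are enumerated by the codes of their words, so only countably many null sets are
    discarded. *)
Lemma ae_foral_freeGroup (P : freeGroup r -> T -> Prop) :
  (forall g, {ae mu, forall x, P g x}) -> {ae mu, forall x, forall g, P g x}.
Proof.
move=> aeP; pose Q (n : nat) x :=
  if choice.unpickle n is Some w then P (word_elt w) x else True.
have : {ae mu, forall x, forall n, Q n x}.
  apply: ae_foralln => n; rewrite /Q; case: (choice.unpickle n) => [w|].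
    exact: aeP.
  exact: aeW.
apply: filterS => x Px g.
by have := Px (choice.pickle (word g)); rewrite /Q choice.pickleK word_eltK.
Qed.

Lemma gen_avg_heps u : hepsR u -> {ae mu, forall x, gen_avg act u x = - u x}.
Proof.
case=> su ue; apply: filterS (ae_foral_freeGroup ue) => x ux.
rewrite /gen_avg (eq_bigr (fun=> - u x)) => [|a _].
  rewrite sumr_const card_letter -[- u x *+ _]mulr_natl mulrA.
  by rewrite mulVf ?mul1r // natr2r_neq0.
by rewrite ux eps_letter mulN1r.
Qed.

Lemma ortho1epsD v w : ortho1eps v -> ortho1eps w ->
  ortho1eps (fun x => v x + w x).
Proof.
move=> [sv v1 vu] [sw w1 wu]; split; first exact: sqintD.
  by rewrite RintegralD ?v1 ?w1 ?addr0 //; exact: sqint_integrable.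
by move=> u hu; have [su _] := hu; rewrite ipDl // vu ?wu ?addr0.
Qed.

Lemma ortho1epsZ k v : ortho1eps v -> ortho1eps (fun x => k * v x).
Proof.
move=> [sv v1 vu]; split; first exact: sqintZ.
  by rewrite RintegralZl ?v1 ?mulr0 //; exact: sqint_integrable.
by move=> u hu; have [su _] := hu; rewrite ipZl // vu ?mulr0.
Qed.

(** By self-adjointness, since the average fixes constants and acts as -1 on [hepsR]. *)
Lemma ortho1eps_gen_avg v : ortho1eps v -> ortho1eps (gen_avg act v).
Proof.
move=> [sv v1 vu]; split; first exact: sqint_gen_avg.
  rewrite -ip1 gen_avg_sym //; last exact: sqint_cst.
  by rewrite gen_avg_cst ip1.
move=> u hu; have [su _] := hu; rewrite gen_avg_sym //.
have -> : ip mu v (gen_avg act u) = ip mu v (fun x => - u x).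
  apply: eq_ae_Rintegral.
  - by apply: measurable_funM; [case: sv|case: (sqint_gen_avg su)].
  - by apply: measurable_funM; [case: sv|case: (sqintN su)].
  - by apply: filterS (gen_avg_heps hu) => x ->.
by rewrite ipC ipNl // ipC vu ?oppr0.
Qed.

Local Notation c := (backtrack R r).

Lemma gen_avgZ k f x : gen_avg act (fun x => k * f x) x = k * gen_avg act f x.
Proof. by rewrite /gen_avg -mulr_sumr mulrCA. Qed.

Lemma sphere_avg0 v : sphere_avg act 0 v = v.
Proof. by apply/funext => x; rewrite /sphere_avg invr1 mul1r sphere_sum0. Qed.

Lemma sphere_avg1 v : sphere_avg act 1 v = gen_avg act v.
Proof.
apply/funext => x; rewrite /sphere_avg sphere_sum1 //= muln1.
by rewrite mulrA mulVf ?mul1r // natr2r_neq0.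
Qed.

(** Dividing by the sphere sizes absorbs the exceptional first coefficient of [sphere_sumSS], so
    that one recurrence holds for all [n]. *)
Lemma sphere_avgSS n v x : sphere_avg act n.+2 v x =
  (1 + c) * gen_avg act (sphere_avg act n.+1 v) x - c * sphere_avg act n v x.
Proof.
rewrite /sphere_avg gen_avgZ sphere_sumSS //.
have r2 : 2 <= r%:R :> R by rewrite (ler_nat _ 2).
have -> : (2 * r)%:R = 2 * r%:R :> R by rewrite natrM.
have E : ((2 * r).-1)%:R = 2 * r%:R - 1 :> R.
  by rewrite -subn1 natrB ?natrM //; lia.
have M0 : 2 * r%:R - 1 != 0 :> R by apply/eqP; lra.
have r0 : r%:R != 0 :> R by apply/eqP; lra.
rewrite /sphere_size /backtrack; case: n => [|n].
  rewrite expn0 expn1 muln1 !natrM E; field; rewrite M0 r0 //.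
rewrite !expnS !natrM natrX E.
have P0 : (2 * r%:R - 1) ^+ n != 0 :> R by rewrite expf_eq0 (negbTE M0) andbF.
by field; rewrite P0 M0 r0.
Qed.

Lemma ortho1eps_sphere_avg n v : ortho1eps v -> ortho1eps (sphere_avg act n v).
Proof.
move=> Kv; suff: ortho1eps (sphere_avg act n v) /\ ortho1eps (sphere_avg act n.+1 v).
  by case.
elim: n => [|n [K0 K1]].
  by rewrite sphere_avg0 sphere_avg1; split=> //; exact: ortho1eps_gen_avg.
split=> //; have -> : sphere_avg act n.+2 v = fun x =>
    (1 + c) * gen_avg act (sphere_avg act n.+1 v) x +
    (- c) * sphere_avg act n v x.
  by apply/funext => x; rewrite sphere_avgSS mulNr.
by apply: ortho1epsD; apply: ortho1epsZ => //; exact: ortho1eps_gen_avg.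
Qed.

Lemma sqint_ball_avg m f : sqint mu f -> sqint mu (ball_avg act m f).
Proof.
move=> sf; apply/sqintZ/sqint_sum => k; rewrite /sphere_sum.
under eq_fun do rewrite word_sumE.
by apply: sqint_sum => w; exact: sqint_act.
Qed.

Definition contracts q : Prop := forall v, ortho1eps v ->
  nrm2 mu (gen_avg act v) <= q * nrm2 mu v.

Variable q : R.
Hypothesis q01 : 0 <= q <= 1.
Hypothesis gen_avg_contr : contracts q.
Local Notation rho := (rho_gap r (1 - q)).

Lemma nrm2_sphere_avg n v : ortho1eps v ->
  nrm2 mu (sphere_avg act n v) <= 3 * Num.sqrt rho ^+ n * nrm2 mu v.
Proof.
move=> Kv; have K k := ortho1eps_sphere_avg k Kv.
have := @nrm2_decay _ _ _ mu _ r_gt1 (gen_avg act) (fun n => sphere_avg act n v) q.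
rewrite sphere_avg0; apply=> //.
- by move=> k; case: (K k).
- exact: sqint_gen_avg.
- exact: gen_avg_sym.
- by move=> k; exact: gen_avg_contr.
- exact: sphere_avg1.
- by move=> k x; exact: sphere_avgSS.
Qed.

Lemma sphere_size_bound k :
  (2 * r%:R - 1 : R) ^+ k <= (sphere_size r k)%:R <= 2 * (2 * r%:R - 1 : R) ^+ k.
Proof.
have r2 : 2 <= r%:R :> R by rewrite (ler_nat _ 2).
case: k => [|k]; first by rewrite /sphere_size !expr0; apply/andP; split; lra.
have E : ((2 * r).-1)%:R = 2 * r%:R - 1 :> R.
  by rewrite -subn1 natrB ?natrM //; lia.
rewrite /sphere_size !natrM natrX E exprS.
have : 0 <= (2 * r%:R - 1) ^+ k :> R by rewrite exprn_ge0 //; lra.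
by move: (_ ^+ k) => p p0; apply/andP; split; nra.
Qed.

(** Sphere [k] contributes at most [2 M^k * 3 tau^k], and this geometric sum is at most three times
    its last term, whence [18 = 2 * 3 * 3]. The factor [M^(2n)] is absorbed by the size of the
    ball. *)
Lemma nrm2_ball_avg n v : ortho1eps v ->
  nrm2 mu (ball_avg act (2 * n) v) <= 18 * rho ^+ n * nrm2 mu v.
Proof.
move=> Kv; have K k := ortho1eps_sphere_avg k Kv.
have sK k : sqint mu (sphere_avg act k v) by case: (K k).
have r2 : 2 <= r%:R :> R by rewrite (ler_nat _ 2).
set N := (\sum_(k < (2 * n).+1) sphere_size r k)%N.
have rho0 : 0 < rho.
  by case/andP: q01 => ? ?; apply: rho_gap_gt0 => //; apply/andP; split; lra.
set tau := Num.sqrt rho; have tau0 : 0 <= tau := sqrtr_ge0 _.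
have tau2 : tau ^+ 2 = rho by rewrite sqr_sqrtr // ltW.
set M : R := 2 * r%:R - 1; have M3 : 3 <= M by rewrite /M; lra.
have NM : M ^+ (2 * n) <= N%:R.
  rewrite /N big_ord_recr /= natrD.
  by have /andP[+ _] := sphere_size_bound (2 * n); rewrite -/M; have := ler0n R
    (\sum_(i < 2 * n) sphere_size r i); lra.
have N0 : 0 < N%:R :> R by apply: lt_le_trans NM; rewrite exprn_gt0 //; lra.
have -> : ball_avg act (2 * n) v = fun x => N%:R^-1 *
    \sum_(k < (2 * n).+1) (sphere_size r k)%:R * sphere_avg act k v x.
  apply/funext => x; congr (_ * _); apply: eq_bigr => k _.
  rewrite /sphere_avg mulrA divff ?mul1r // gt_eqF //.
  have /andP[+ _] := sphere_size_bound k; rewrite -/M => /(lt_le_trans _); apply.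
  by rewrite exprn_gt0 //; lra.
rewrite nrm2Z; last by apply: sqint_sum => k; exact: sqintZ.
rewrite gtr0_norm ?invr_gt0 // ler_pdivrMl //.
rewrite (le_trans (ler_nrm2_sum _ _ _)) => [//|k|]; first exact: sqintZ.
(* As [M rho >= 1] and [M >= 3], the ratio [M tau] is at least [3/2], which is what the induction
   for the factor 3 requires. *)
have s32 : 3 <= 2 * (M * tau).
  rewrite -(@ler_pXn2r _ 2) ?nnegrE //; last by rewrite !mulr_ge0 //; lra.
  have : 1 <= M * rho.
    rewrite -ler_pdivrMl ?mulr1; last by lra.
    by case/andP: q01 => ? ?; apply: backtrack_le_rho => //; apply/andP; split; lra.
  by rewrite !exprMn tau2; nra.
have geo m : \sum_(k < m.+1) (M * tau) ^+ k <= 3 * (M * tau) ^+ m.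
  elim: m => [|m IH]; first by rewrite big_ord1 !expr0; lra.
  rewrite big_ord_recr /= exprS; move: IH s32; set s := M * tau.
  set S := \sum_(_ < _) _; move=> IH s32.
  have : 0 <= s ^+ m by rewrite exprn_ge0 //; lra.
  by move: (s ^+ m) S IH => p S IH; nra.
apply: (@le_trans _ _ (\sum_(k < (2 * n).+1) 6 * nrm2 mu v * (M * tau) ^+ k)).
  apply: ler_sum => k _; rewrite nrm2Z // ger0_norm ?ler0n //.
  have := nrm2_sphere_avg k Kv; rewrite -/tau => /(ler_wpM2l (ler0n _ _)).
  move=> /(_ (sphere_size r k)) /le_trans; apply.
  have -> : 6 * nrm2 mu v * (M * tau) ^+ k =
     2 * M ^+ k * (3 * tau ^+ k * nrm2 mu v) by rewrite exprMn; ring.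
  rewrite ler_wpM2r //; last by case/andP: (sphere_size_bound k).
  by rewrite !mulr_ge0 ?nrm2_ge0 ?exprn_ge0.
rewrite -mulr_sumr (le_trans (ler_wpM2l _ (geo _))) //.
  by rewrite mulr_ge0 ?nrm2_ge0.
rewrite exprMn [tau ^+ _]exprM tau2 -subr_ge0.
have -> : N%:R * (18 * rho ^+ n * nrm2 mu v) -
  6 * nrm2 mu v * (3 * (M ^+ (2 * n) * rho ^+ n)) =
  18 * rho ^+ n * nrm2 mu v * (N%:R - M ^+ (2 * n)) by ring.
by rewrite mulr_ge0 ?subr_ge0 // !mulr_ge0 ?nrm2_ge0 ?exprn_ge0 // ltW.
Qed.

End AverageDecay.

(** * Almost invariant vectors and the gap *)

Section GapPositive.
Context (disp : measure_display) (T : measurableType disp) (R : realType).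
Variables (mu : probability T R) (r : nat) (act : freeGroup r -> T -> T).
Hypothesis r_gt1 : (1 < r)%N.
Hypothesis actP : is_action act.
Hypothesis act_meas : forall g, measurable_fun setT (act g).
Hypothesis act_mu : invariant_measure mu act.
Implicit Types (f u v w : T -> R) (g : freeGroup r) (a : letter r).

Local Notation shift a f := (fun x => f (act (letter_elt a)^-1%g x)).

(** Total squared deviation over the letters: from invariance for [s = -1], from anti-invariance for
    [s = 1]. *)
Definition defect (s : R) v : R :=
  \sum_a ip mu (fun x => shift a v x + s * v x) (fun x => shift a v x + s * v x).

Definition almost_inv_gap (kappa : R) : Prop := forall v, sqint mu v ->
  \int[mu]_x v x = 0 -> kappa * ip mu v v <= defect (-1) v.

Lemma ip_le3 f u v w : measurable_fun setT f -> sqint mu u -> sqint mu v ->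
  sqint mu w -> (forall x, f x ^+ 2 <= 3 * (u x ^+ 2 + v x ^+ 2 + w x ^+ 2)) ->
  ip mu f f <= 3 * (ip mu u u + ip mu v v + ip mu w w).
Proof.
move=> mf su sv sw fle.
have I h : sqint mu h -> mu.-integrable setT (EFin \o (fun x => h x * h x)).
  by move=> sh; exact: sqintM.
rewrite -!RintegralD ?I //; last exact: integrableR_D (I _ su) (I _ sv).
rewrite -RintegralZl //; last first.
  by apply: integrableR_D; [exact: integrableR_D (I _ su) (I _ sv)|exact: I].
have ib : mu.-integrable setT
    (EFin \o (fun x => 3 * (u x * u x + v x * v x + w x * w x))).
  apply: integrableR_Z; apply: integrableR_D; last exact: I.
  exact: integrableR_D (I _ su) (I _ sv).
apply: le_Rintegral => // [|x _]; last by have := fle x; rewrite !expr2.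
apply: integrableR_le ib => [|x]; first exact: measurable_funM.
by rewrite -expr2 ger0_norm ?sqr_ge0 //; have := fle x; rewrite !expr2.
Qed.

Lemma sqint_shift a f : sqint mu f -> sqint mu (shift a f).
Proof. exact: sqint_act. Qed.

Lemma ip_shift a f u : sqint mu f -> sqint mu u ->
  ip mu (shift a f) (shift a u) = ip mu f u.
Proof. exact: ip_act. Qed.

Lemma defectE s v : s ^+ 2 = 1 -> sqint mu v ->
  defect s v = (4 * r%:R) * (ip mu v v + s * ip mu (gen_avg act v) v).
Proof.
move=> s2 sv; rewrite /defect.
rewrite (eq_bigr (fun a => 2 * ip mu v v + 2 * s * ip mu (shift a v) v)); last first.
  move=> a _; have sa := sqint_shift a sv.
  by rewrite ip_combD // ip_shift // s2; ring.
rewrite big_split /= -mulr_sumr sumr_const card_letter.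
rewrite /gen_avg ipZl //; last by apply: sqint_sum => a; exact: sqint_shift.
rewrite ip_suml // => [|a]; last exact: sqint_shift.
rewrite -[_ *+ (2 * r)]mulr_natl natrM.
have r0 : r%:R != 0 :> R by rewrite pnatr_eq0; lia.
by rewrite -mulr_sumr; field.
Qed.

Lemma defect_ge0 s v : 0 <= defect s v.
Proof. by apply: sumr_ge0 => a _; exact: ip_ge0. Qed.

Lemma centered f (m : R) : sqint mu f -> \int[mu]_x f x = m ->
  [/\ sqint mu (fun x => f x - m), \int[mu]_x (f x - m) = 0 &
   ip mu (fun x => f x - m) (fun x => f x - m) = ip mu f f - m ^+ 2].
Proof.
move=> sf fm; have sc : sqint mu (fun=> 1) by exact: sqint_cst.
split.
- by apply: sqintB => //; exact: sqint_cst.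
- rewrite RintegralB ?fm ?Rintegral_prob_cst ?subrr //.
    exact: sqint_integrable.
  exact: integrableR_cst.
- have := ip_combB m sf sc; rewrite ip11 ip1 fm.
  rewrite (_ : _ + _ = ip mu f f - m ^+ 2); last by ring.
  by move=> <-; apply: eq_Rintegral => x _; rewrite mulr1.
Qed.

Lemma defect_shiftc f (m : R) : defect (-1) (fun x => f x - m) = defect (-1) f.
Proof.
by apply: eq_bigr => a _; congr ip; apply/funext => x; rewrite !mulN1r; ring.
Qed.

Variable kappa : R.
Hypothesis kappa_gt0 : 0 < kappa.
Hypothesis kappaP : almost_inv_gap kappa.

Lemma variance_le_defect f : sqint mu f ->
  kappa * (ip mu f f - (\int[mu]_x f x) ^+ 2) <= defect (-1) f.
Proof.
move=> sf; have [s0 i0 <-] := centered sf erefl.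
by rewrite -(defect_shiftc f (\int[mu]_x f x)) kappaP.
Qed.

(** The vector [z = v - h (h v)] is [(1 - h) (1 + h) v]. It is small when the norm of [h v] is close
    to 1, and the gap bounds [1 - h] from below on mean-zero functions, so [w = (1 + h) v] is small
    too. *)
Lemma defect_anti v : sqint mu v -> \int[mu]_x v x = 0 -> ip mu v v = 1 ->
  (kappa * defect 1 v) ^+ 2 <=
    2 * (16 * r%:R ^+ 2) ^+ 2 * (1 - nrm2 mu (gen_avg act v) ^+ 2).
Proof.
move=> sv v0 v1; set h := gen_avg act.
have sh f : sqint mu f -> sqint mu (h f) by exact: sqint_gen_avg.
have sv1 := sh _ sv; have sv2 := sh _ sv1.
pose w x := v x + h v x; have sw : sqint mu w by exact: sqintD.
have hw : h w = fun x => h v x + h (h v) x.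
  by apply/funext => x; rewrite /h /w /gen_avg big_split mulrDr.
have w0 : \int[mu]_x w x = 0.
  rewrite RintegralD ?v0 ?add0r //; try exact: sqint_integrable.
  rewrite -ip1 (gen_avg_sym actP act_meas act_mu) //; last exact: sqint_cst.
  by rewrite gen_avg_cst // ip1 v0.
have D1 : defect 1 v = 4 * r%:R * ip mu w v.
  by rewrite defectE ?expr1n // mul1r -ipDl.
have r0 : 0 <= r%:R :> R by rewrite ler0n.
have nv : nrm2 mu v = 1 by rewrite /nrm2 v1 sqrtr1.
have wv : ip mu w v <= nrm2 mu w.
  by rewrite (le_trans (ler_norm _)) // (le_trans (ler_ip _ _)) // nv mulr1.
have wv0 : 0 <= defect 1 v by exact: defect_ge0.
pose z x := v x - h (h v) x; have sz : sqint mu z by exact: sqintB.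
have kw : kappa * nrm2 mu w ^+ 2 <= 4 * r%:R * (nrm2 mu z * nrm2 mu w).
  rewrite sqr_nrm2 (le_trans (kappaP sw w0)) // defectE ?sqrrN ?expr1n //.
  rewrite ler_wpM2l ?mulr_ge0 // mulN1r -ipBl //; last exact: sh.
  rewrite (le_trans (ler_norm _)) // -/h hw (_ : (fun x => _) = z).
    exact: ler_ip.
  by apply/funext => x; rewrite /w /z; ring.
have {}kw : kappa * nrm2 mu w <= 4 * r%:R * nrm2 mu z.
  have := nrm2_ge0 mu w; rewrite le_eqVlt => /predU1P[<-|wp].
    by rewrite mulr0 !mulr_ge0 ?nrm2_ge0.
  by move: kw; rewrite expr2 !mulrA ler_pM2r.
have zle : nrm2 mu z ^+ 2 <= 2 * (1 - nrm2 mu (h v) ^+ 2).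
  have -> : nrm2 mu z ^+ 2 = 1 + nrm2 mu (h (h v)) ^+ 2 - 2 * nrm2 mu (h v) ^+ 2.
    rewrite sqr_nrm2 /z ip_subb // v1.
    have -> : ip mu v (h (h v)) = nrm2 mu (h v) ^+ 2.
      by rewrite sqr_nrm2 /h (gen_avg_sym actP act_meas act_mu).
    by rewrite !sqr_nrm2; ring.
  have := nrm2_gen_avg r_gt1 act_meas act_mu sv1.
  have := nrm2_gen_avg r_gt1 act_meas act_mu sv; rewrite nv -/h => b1 ab.
  have : nrm2 mu (h (h v)) ^+ 2 <= 1 by rewrite expr_le1 ?nrm2_ge0 // (le_trans ab).
  by lra.
apply: (@le_trans _ _ ((16 * r%:R ^+ 2) ^+ 2 * nrm2 mu z ^+ 2)).
  rewrite -exprMn lerXn2r ?nnegrE ?mulr_ge0 ?nrm2_ge0 ?sqr_ge0 ?(ltW kappa_gt0) //.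
  rewrite D1; have := ler_wpM2l (ltW kappa_gt0) wv => kwv.
  have : 4 * r%:R * (kappa * ip mu w v) <= 4 * r%:R * (4 * r%:R * nrm2 mu z).
    by rewrite ler_wpM2l ?mulr_ge0 // (le_trans kwv).
  by lra.
by rewrite -mulrA [2 * _]mulrCA ler_wpM2l ?sqr_ge0.
Qed.

(** Zeros get the value 1 so that the square is 1 everywhere, not only almost everywhere. *)
Definition sgn_fun v : T -> R := fun x => if 0 <= v x then 1 else -1.

Lemma sgn_fun_sqr v x : sgn_fun v x ^+ 2 = 1.
Proof. by rewrite /sgn_fun; case: ifP => _; rewrite ?sqrrN expr1n. Qed.

Lemma sqint_pm1 u : measurable_fun setT u -> (forall x, u x ^+ 2 = 1) ->
  sqint mu u /\ ip mu u u = 1.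
Proof.
move=> mu_ u2; split.
  apply: (@sqint_bounded _ _ _ _ _ 1) => // x.
  by rewrite -(@ler_pXn2r _ 2) ?nnegrE // real_normK ?num_real // u2 expr1n.
rewrite /ip (_ : (fun x => u x * u x) = fun=> 1) ?Rintegral_prob_cst //.
by apply/funext => x; rewrite -expr2.
Qed.

Lemma measurable_sgn_fun v : measurable_fun setT v -> measurable_fun setT (sgn_fun v).
Proof.
move=> mv; apply: measurable_fun_if => //.
- apply: (measurable_fun_bool true); rewrite setTI.
  rewrite (_ : _ @^-1` _ = v @^-1` `[0, +oo[%classic).
    by rewrite -[X in measurable X]setTI; exact: mv.
  by apply/seteqP; split => x /=; rewrite in_itv /= andbT.
Qed.

(** Absolute values turn almost anti-invariant into almost invariant, because
    [| |x| - |y| | <= |x + y|]; so [|v|] is close to its mean [m]. The squared distance from [v] to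
    its sign is that from [|v|] to 1, namely [2 - 2 m <= 2 (1 - m^2)]. *)
Lemma sgn_fun_approx v : sqint mu v -> ip mu v v = 1 ->
  kappa * ip mu (fun x => v x - sgn_fun v x) (fun x => v x - sgn_fun v x) <=
  2 * defect 1 v.
Proof.
move=> sv v1; have sa := sqint_norm sv; set m := \int[mu]_x `|v x|.
have m0 : 0 <= m by apply: Rintegral_ge0.
have aa : ip mu (fun x => `|v x|) (fun x => `|v x|) = 1.
  by rewrite -v1; apply: eq_Rintegral => x _; rewrite -expr2 real_normK ?num_real.
have kd : kappa * (1 - m ^+ 2) <= defect 1 v.
  have := variance_le_defect sa; rewrite aa -/m => /le_trans; apply.
  apply: ler_sum => a _.
  have sva := sqint_shift a sv; have := sqint_shift a sa => /= saa.
  have mD : sqint mu (fun x => shift a v x + 1 * v x).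
    by apply: sqintD => //; exact: sqintZ.
  rewrite -!sqr_nrm2 lerXn2r ?nnegrE ?nrm2_ge0 //.
  apply: ler_nrm2 => [|x|]; last exact: mD.
    by apply: measurable_funD; [case: saa|case: (sqintZ (-1) sa)].
  rewrite mul1r mulN1r; have := ler_dist_dist (shift a v x) (- v x).
  by rewrite normrN opprK.
have m1 : m <= 1.
  have := cauchy_schwarz sa (sqint_cst mu 1); rewrite aa ip11 mulr1 ip1 -/m.
  by move=> m21; rewrite -(@ler_pXn2r _ 2) ?nnegrE // expr1n.
have -> : ip mu (fun x => v x - sgn_fun v x) (fun x => v x - sgn_fun v x) = 2 - 2 * m.
  have := ip_subb sa (sqint_cst mu 1); rewrite aa ip11 ip1 -/m.
  rewrite (_ : _ + _ = 2 - 2 * m); last by ring.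
  move=> <-; apply: eq_Rintegral => x _; rewrite /sgn_fun.
  by case: ifPn => [?|]; [rewrite ger0_norm|rewrite -ltNge => ?; rewrite ltr0_norm //; ring].
by have := mulr_ge0 (ltW kappa_gt0) m0; nra.
Qed.

Lemma defect_perturb u v : sqint mu u -> sqint mu v ->
  defect 1 u <= 3 * defect 1 v +
    12 * r%:R * ip mu (fun x => v x - u x) (fun x => v x - u x).
Proof.
move=> su sv; have sd : sqint mu (fun x => v x - u x) by exact: sqintB.
rewrite /defect mulr_sumr.
(* Spread over the [2 r] letters, with 6 for each: [v - u] enters [ip_le3] once shifted and once
   unshifted. *)
have -> : 12 * r%:R * ip mu (fun x => v x - u x) (fun x => v x - u x) =
  \sum_(a : letter r) 6 * ip mu (fun x => v x - u x) (fun x => v x - u x).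
  by rewrite sumr_const card_letter -[RHS]mulr_natl natrM; ring.
rewrite -big_split; apply: ler_sum => a _ /=.
have E := ip_shift a sd sd.
apply: le_trans (_ : 3 * (ip mu (fun x => shift a v x + 1 * v x) (fun x => shift a v x + 1 * v x)
  + ip mu (shift a (fun x => v x - u x)) (shift a (fun x => v x - u x))
  + ip mu (fun x => v x - u x) (fun x => v x - u x)) <= _); last by rewrite E; lra.
apply: ip_le3 => // [|||x].
- by apply: measurable_funD; [case: (sqint_shift a su)|case: (sqintZ 1 su)].
- by apply: sqintD; [exact: sqint_shift|exact: sqintZ].
- exact: (sqint_shift a sd).
- set x' := act _ x; have := sqr_ge0 ((v x' + v x) + (v x' - u x')).
  have := sqr_ge0 ((v x' + v x) + (v x - u x)).
  by have := sqr_ge0 ((v x' - u x') - (v x - u x)); nra.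
Qed.

Lemma defect_sgn_fun v : sqint mu v -> ip mu v v = 1 ->
  kappa * defect 1 (sgn_fun v) <= (3 * kappa + 24 * r%:R) * defect 1 v.
Proof.
move=> sv v1; set u := sgn_fun v.
have [su _] := sqint_pm1 (measurable_sgn_fun (proj1 sv)) (sgn_fun_sqr v).
have := defect_perturb su sv.
have := sgn_fun_approx sv v1; rewrite -/u.
have := kappa_gt0; have : 0 <= r%:R :> R by rewrite ler0n.
move: (defect _ _) (defect _ _) (ip _ _ _) => du dv i r0 k0 ki dle.
have := ler_wpM2l (ltW k0) dle.
have : 12 * r%:R * (kappa * i) <= 12 * r%:R * (2 * dv) by rewrite ler_wpM2l ?mulr_ge0.
by lra.
Qed.

(** The product [p] of [u] and [w] is close to its mean [m], and [p^2 = 1] forces [|m|] close to 1.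
    With [s] the sign of [m], the squared distance from [u] to [s w] is [2 - 2 |m|]. *)
Lemma pm1_close u w : measurable_fun setT u -> (forall x, u x ^+ 2 = 1) ->
  measurable_fun setT w -> (forall x, w x ^+ 2 = 1) ->
  exists2 s : R, s ^+ 2 = 1 &
    kappa * ip mu (fun x => u x - s * w x) (fun x => u x - s * w x) <=
    6 * (defect 1 u + defect 1 w).
Proof.
move=> mu_ u2 mw w2; have [su u1] := sqint_pm1 mu_ u2.
have [sw w1] := sqint_pm1 mw w2.
pose p x := u x * w x; have mp : measurable_fun setT p by exact: measurable_funM.
have p2 x : p x ^+ 2 = 1 by rewrite exprMn u2 w2 mulr1.
have [sp p1] := sqint_pm1 mp p2; set m := \int[mu]_x p x.
have dp : defect (-1) p <= 3 * (defect 1 u + defect 1 w).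
  rewrite /defect -big_split mulr_sumr; apply: ler_sum => a _ /=.
  apply: le_trans (_ : 3 * (ip mu (fun x => shift a u x + 1 * u x) (fun x => shift a u x + 1 * u x)
    + ip mu (fun x => shift a w x + 1 * w x) (fun x => shift a w x + 1 * w x)
    + ip mu (fun=> 0) (fun=> 0)) <= _).
    have sD f : sqint mu f -> sqint mu (fun x => shift a f x + 1 * f x).
      by move=> sf; apply: sqintD; [exact: sqint_shift|exact: sqintZ].
    apply: ip_le3 => // [||||x].
    - by apply: measurable_funD; [case: (sqint_shift a sp)|case: (sqintZ (-1) sp)].
    - exact: sD.
    - exact: sD.
    - exact: sqint_cst.
    - set x' := act _ x; rewrite /p.
      (* A Leibniz rule, arranged so that only the sums measuring anti-invariance occur. *)
      have -> : u x' * w x' + -1 * (u x * w x) =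
        u x' * (w x' + w x) - w x * (u x' + u x) by ring.
      set A := w x' + w x; set B := u x' + u x; rewrite !mul1r -/A -/B.
      have : (u x' * A) ^+ 2 = A ^+ 2 by rewrite exprMn u2 mul1r.
      have : (w x * B) ^+ 2 = B ^+ 2 by rewrite exprMn w2 mul1r.
      have := sqr_ge0 (u x' * A + w x * B); rewrite expr0n /= addr0.
      by move: (u x' * A) (w x * B) => P Q; have := sqr_ge0 A; have := sqr_ge0 B; nra.
  have -> : ip mu (fun=> 0) (fun=> 0) = 0 :> R.
    by rewrite /ip mulr0 Rintegral_prob_cst.
  by rewrite addr0.
have km := le_trans (variance_le_defect sp) dp; rewrite p1 -/m in km.
have m21 : m ^+ 2 <= 1.
  by have := cauchy_schwarz sp (sqint_cst mu 1); rewrite p1 ip11 mulr1 ip1.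
have E s : s ^+ 2 = 1 ->
    ip mu (fun x => u x - s * w x) (fun x => u x - s * w x) = 2 - 2 * (s * m).
  by move=> s2; rewrite ip_combB // u1 w1 s2 /ip -/m; ring.
pose s : R := if 0 <= m then 1 else -1.
have s2 : s ^+ 2 = 1 by rewrite /s; case: ifP => _; rewrite ?sqrrN expr1n.
exists s => //; rewrite E //.
have -> : s * m = `|m|.
  rewrite /s; case: ifPn => [?|]; first by rewrite ger0_norm // mul1r.
  by rewrite -ltNge => ?; rewrite ltr0_norm // mulN1r.
move: km m21; rewrite -(real_normK (num_real m)); have := normr_ge0 m.
have := kappa_gt0; move: (defect _ _) (defect _ _) `|m| => D1 D2 n k0 n0 kn n2.
have n1 : n <= 1 by rewrite -(@ler_pXn2r _ 2) ?nnegrE // expr1n.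
have : kappa * (1 - n) <= kappa * (1 - n ^+ 2) by rewrite ler_wpM2l ?(ltW k0) //; nra.
by lra.
Qed.

Lemma ae_act (P : T -> Prop) g :
  {ae mu, forall x, P x} -> {ae mu, forall x, P (act g x)}.
Proof.
move=> [A [mA A0 PA]]; exists (act g @^-1` A); split.
- by rewrite -[X in measurable X]setTI; exact: act_meas.
- by rewrite act_mu.
- by move=> x /= nPx; exact: PA.
Qed.

(** A vanishing sum of squares gives anti-invariance under each letter; induction on words, with
    invariance of null sets, extends it to the group. *)
Lemma defect0_heps u : sqint mu u -> defect 1 u = 0 -> hepsR mu act u.
Proof.
move=> su d0; split=> //.
have L a : {ae mu, forall x, u (act (letter_elt a)^-1%g x) = - u x}.
  have s1 : sqint mu (fun x => shift a u x + 1 * u x).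
    by apply: sqintD; [exact: sqint_shift|exact: sqintZ].
  have : ip mu (fun x => shift a u x + 1 * u x) (fun x => shift a u x + 1 * u x) = 0.
    apply/eqP; move/eqP: d0; rewrite psumr_eq0 => [/allP/(_ a)|b _]; last exact: ip_ge0.
    by rewrite mem_index_enum; exact.
  move=> /(ip_eq0_ae s1); apply: filterS => x /eqP.
  by rewrite mul1r addr_eq0 => /eqP.
apply: freeGroup_ind => [|a g IH].
  by apply: aeW => x; rewrite invg1 act1 // /eps expr0 mul1r.
have := ae_act (letter_elt a)^-1%g IH.
apply: filterS2 (L a) => x ux.
by rewrite invgM actM // => ->; rewrite ux epsM eps_letter mulN1r mulNr mulrN.
Qed.

(** Turns L^2 distances into measures of sets, so that [pm1_limit] can argue as in the
    Borel-Cantelli lemma. *)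
Lemma pm1_dist u w : measurable_fun setT u -> (forall x, u x ^+ 2 = 1) ->
  measurable_fun setT w -> (forall x, w x ^+ 2 = 1) ->
  measurable [set x | u x != w x] /\
  mu [set x | u x != w x] =
    (ip mu (fun x => u x - w x) (fun x => u x - w x) / 4)%:E.
Proof.
move=> mu_ u2 mw w2; set D := [set x | u x != w x].
have mD : measurable D.
  rewrite (_ : D = (fun x => u x - w x) @^-1` (~` [set 0])).
    rewrite -[X in measurable X]setTI.
    by apply: (measurable_funB mu_ mw) => //; exact: measurableC.
  by apply/seteqP; split => x /=; rewrite /D /= -subr_eq0 => /eqP.
split=> //.
have E x : (u x - w x) * (u x - w x) = 4 * \1_D x.
  rewrite indicE; have [xD|] := boolP (x \in D).
    have /eqP : (u x - w x) * (u x + w x) = 0 by rewrite -subr_sqr u2 w2 subrr.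
    rewrite mulf_eq0 subr_eq0 addr_eq0 (negbTE (set_mem xD)) /= => /eqP uw.
    rewrite uw (_ : _ * _ = 4 * w x ^+ 2); last by ring.
    by rewrite w2.
  move=> /negP xD; have -> : u x = w x.
    by apply/eqP/negPn/negP => ?; apply: xD; exact: mem_set.
  by rewrite subrr mul0r mulr0.
have fD : mu D \is a fin_num by exact: fin_num_measure.
rewrite -[LHS]fineK // /ip; congr EFin.
transitivity ((\int[mu]_x (4 * \1_D x)) / 4); last first.
  by congr (_ / _); apply: eq_Rintegral => x _.
rewrite RintegralZl //; last first.
  apply: integrableR_le (integrableR_cst mu 1) => [|x]; first exact: measurable_indic.
  by rewrite indicE; case: (_ \in _); rewrite ?normr1 ?normr0.
by rewrite /Rintegral integral_indic // setIT; field.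
Qed.

(** The sets where consecutive functions differ have summable measures, so almost every sequence
    [w n x] is eventually constant. The limit is 1 on the set [A] where it is eventually 1, and -1
    elsewhere, which keeps its square equal to 1 at every point. *)
Lemma pm1_limit (w : nat -> T -> R) :
  (forall n, measurable_fun setT (w n)) -> (forall n x, w n x ^+ 2 = 1) ->
  (forall n, ip mu (fun x => w n x - w n.+1 x) (fun x => w n x - w n.+1 x)
     <= 4 / (2 ^ n.+1)%:R) ->
  exists u, [/\ measurable_fun setT u, forall x, u x ^+ 2 = 1 & forall n,
    ip mu (fun x => u x - w n x) (fun x => u x - w n x) <= 4 / (2 ^ n)%:R].
Proof.
move=> mw w2 wle.
pose A := \bigcup_n \bigcap_(k in [set k | (n <= k)%N]) (w k @^-1` [set 1]).
have mA : measurable A.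
  apply: bigcup_measurable => n _; apply: bigcap_measurable => [|k _].
    by exists n => /=.
  by rewrite -[X in measurable X]setTI; exact: mw.
pose u x : R := if x \in A then 1 else -1.
have mu_ : measurable_fun setT u.
  apply: measurable_fun_if => //.
  apply: (measurable_fun_bool true); rewrite setTI.
  rewrite (_ : _ @^-1` _ = A) //.
  by apply/seteqP; split => x /=; [move/set_mem|move/mem_set].
have u2 x : u x ^+ 2 = 1 by rewrite /u; case: ifP => _; rewrite ?sqrrN expr1n.
exists u; split=> // n.
have [mE E] := pm1_dist mu_ u2 (mw n) (w2 n).
pose D k := [set x | w (n + k)%N x != w (n + k).+1 x].
have mD k : measurable (D k).
  by case: (pm1_dist (mw (n + k)%N) (w2 (n + k)%N) (mw (n + k).+1) (w2 _)).
have sub : [set x | u x != w n x] `<=` \bigcup_k D k.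
  move=> x /= /eqP uw; apply: contrapT => nD; apply: uw.
  have wc k : w (n + k)%N x = w n x.
    elim: k => [|k IH]; first by rewrite addn0.
    rewrite -IH addnS; apply/esym/eqP/negPn/negP => Dk; apply: nD.
    by exists k.
  have := w2 n x => /eqP; rewrite sqrf_eq1 => /orP[]/eqP w1.
    rewrite w1 /u ifT //; apply/mem_set; exists n => // k /= nk.
    by rewrite -(subnKC nk) wc.
  rewrite w1 /u ifF //; apply/negP => /set_mem[m _ /= mk].
  have /= := mk (n + m)%N (leq_addl _ _); rewrite wc w1 => /eqP.
  by rewrite eqNr oner_eq0.
have := @generalized_Boole_inequality _ _ _ mu D mD (bigcup_measurable (fun k _ => mD k)).
have le2 : (mu [set x | u x != w n x] <= mu (\bigcup_k D k))%E.
  by apply: le_measure => //; apply: mem_set => //; exact: bigcup_measurable.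
move=> /(le_trans le2) {le2}.
have e0 : 0 <= (2 ^ n)%:R^-1 :> R by rewrite invr_ge0 ler0n.
have le3 : (\sum_(0 <= k <oo) mu (D k) <= ((2 ^ n)%:R^-1 : R)%:E)%E.
  apply: le_trans (epsilon_trick0 xpredT e0).
  apply: lee_nneseries => // k _.
  have [_ ->] := pm1_dist (mw (n + k)%N) (w2 (n + k)%N) (mw (n + k).+1) (w2 _).
  rewrite lee_fin ler_pdivrMr //.
  rewrite (le_trans (wle _)) // mulrC ler_wpM2r //.
  by rewrite -addnS expnD natrM invfM.
move=> /le_trans/(_ le3); rewrite E lee_fin ler_pdivrMr //.
by rewrite mulrC.
Qed.

Lemma exists_small_defect (delta : R) : 0 < delta ->
  (forall q, 0 <= q < 1 -> ~ contracts mu act q) ->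
  exists v, [/\ ortho1eps mu act v, ip mu v v = 1 & defect 1 v < delta].
Proof.
move=> d0 ncontr; set C : R := 2 * (16 * r%:R ^+ 2) ^+ 2; set y := (kappa * delta) ^+ 2.
have y0 : 0 < y by rewrite exprn_gt0 // mulr_gt0.
have C0 : 0 <= C by rewrite mulr_ge0 // sqr_ge0.
have Cy : 0 < 2 * C + y by lra.
(* Chosen in [(0, 1]] with [2 C t < y]: a normalised function not contracted by [1 - t] satisfies
   [1 - |h v|^2 <= 2 t], and [defect_anti] concludes. *)
set t := y / (2 * C + y); have t0 : 0 < t by exact: divr_gt0.
have t1 : t <= 1 by rewrite ler_pdivrMr // mul1r; lra.
have Ct : 2 * C * t < y.
  rewrite /t mulrA ltr_pdivrMr // mulrC ltr_pM2l //; lra.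
have q01 : 0 <= 1 - t < 1 by apply/andP; split; lra.
have /existsNP[v /not_implyP[Kv /negP]] := ncontr _ q01; rewrite -ltNge => vq.
have [sv v1 vu] := Kv.
have nv : 0 < nrm2 mu v.
  rewrite lt_neqAle nrm2_ge0 andbT; apply/eqP => n0.
  have := nrm2_gen_avg r_gt1 act_meas act_mu sv.
  by rewrite -n0 leNgt (le_lt_trans _ vq) // -n0 mulr0.
pose v' x := (nrm2 mu v)^-1 * v x.
have Kv' : ortho1eps mu act v' by exact: ortho1epsZ.
have [sv' v1' _] := Kv'.
have vv : ip mu v' v' = 1.
  rewrite -sqr_nrm2 nrm2Z // gtr0_norm ?invr_gt0 // mulVf ?expr1n //.
  by rewrite gt_eqF.
exists v'; split=> //.
have dle := defect_anti sv' v1' vv.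
have gle : 1 - t < nrm2 mu (gen_avg act v').
  have -> : gen_avg act v' = fun x => (nrm2 mu v)^-1 * gen_avg act v x.
    by apply/funext => x; rewrite /v' gen_avgZ.
  rewrite nrm2Z; last exact: sqint_gen_avg.
  by rewrite gtr0_norm ?invr_gt0 // ltr_pdivlMl // mulrC.
have {}dle : (kappa * defect 1 v') ^+ 2 < (kappa * delta) ^+ 2.
  apply: le_lt_trans dle _; rewrite -/y -/C; apply: le_lt_trans Ct.
  rewrite [2 * C]mulrC -(mulrA C) ler_wpM2l //.
  by move/andP: q01 => [q0 _]; move: gle q0; move: (nrm2 _ _) => N; nra.
rewrite -(ltr_pM2l kappa_gt0) -(@ltr_pXn2r _ 2) // nnegrE mulr_ge0 ?defect_ge0 //.
- exact: ltW.
- exact: ltW.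
- exact: ltW.
Qed.

(* If no such [q] exists, there are unit vectors [v_n] orthogonal to [Heps] with
   summable defects from being anti-invariant.  By the gap their squares are
   nearly constant, so they are close to their signs [u_n]; the products
   [u_n u_(n+1)] are almost invariant, hence nearly constant, so [u_n] converges
   up to sign, and the limit is a unit vector of [Heps] close to [v_n]. *)
Lemma exists_contraction : exists2 q, 0 <= q < 1 & contracts mu act q.
Proof.
apply: contrapT => nq.
have {}nq q : 0 <= q < 1 -> ~ contracts mu act q by move=> q01 cq; apply: nq; exists q.
have r0 : 0 <= r%:R :> R by rewrite ler0n.
have k0 := kappa_gt0.
set M := 3 * kappa + 24 * r%:R; have M0 : 0 < M by rewrite /M; lra.
(* Calibrated so that [pm1_close] yields exactly the bound [4 / 2^(n+1)] required by [pm1_limit]. *)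
set eta := kappa ^+ 2 / (3 * M); have eta0 : 0 < eta.
  by rewrite divr_gt0 ?exprn_gt0 // mulr_gt0.
have dlt n : 0 < eta / (2 ^ n.+1)%:R by rewrite divr_gt0 // ltr0n expn_gt0.
have /choice[v vP] n := exists_small_defect (dlt n) nq.
have sv n : sqint mu (v n) by case: (vP n) => -[].
have v1 n : ip mu (v n) (v n) = 1 by case: (vP n).
have dv n : defect 1 (v n) <= eta / (2 ^ n.+1)%:R by case: (vP n) => _ _ /ltW.
pose u n := sgn_fun (v n).
have mu_ n : measurable_fun setT (u n) by apply: measurable_sgn_fun; case: (sv n).
have u2 n x : u n x ^+ 2 = 1 := sgn_fun_sqr (v n) x.
have du n : kappa * defect 1 (u n) <= M * (eta / (2 ^ n.+1)%:R).
  by rewrite (le_trans (defect_sgn_fun (sv n) (v1 n))) // ler_wpM2l ?(ltW M0).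
have /choice[s sP] n : exists s : R, s ^+ 2 = 1 /\
    ip mu (fun x => u n x - s * u n.+1 x) (fun x => u n x - s * u n.+1 x)
     <= 4 / (2 ^ n.+1)%:R.
  have [s s2 sle] := pm1_close (mu_ n) (u2 n) (mu_ n.+1) (u2 n.+1).
  exists s; split=> //; rewrite -(ler_pM2l k0) -(ler_pM2l k0).
  apply: le_trans (_ : kappa * (6 * (defect 1 (u n) + defect 1 (u n.+1))) <= _).
    by rewrite ler_wpM2l // ltW.
  have -> : kappa * (kappa * (4 / (2 ^ n.+1)%:R)) =
      12 * (M * (eta / (2 ^ n.+1)%:R)).
    rewrite /eta; have : (2 ^ n.+1)%:R != 0 :> R by rewrite pnatr_eq0 -lt0n expn_gt0.
    by have : M != 0 by [rewrite gt_eqF]; move=> ? ?; field; apply/andP.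
  have := du n; have := du n.+1.
  have : M * (eta / (2 ^ n.+2)%:R) <= M * (eta / (2 ^ n.+1)%:R).
    rewrite ler_wpM2l ?(ltW M0) // ler_wpM2l ?(ltW eta0) // lef_pV2 ?posrE ?ltr0n ?expn_gt0 //.
    by rewrite ler_nat leq_exp2l.
  by lra.
(* Accumulated signs, which align each function with its predecessor. *)
pose sg := fix sg n : R := if n is n'.+1 then sg n' * s n' else 1.
have sg2 n : sg n ^+ 2 = 1.
  by elim: n => [|n IH]; rewrite /= ?expr1n // exprMn IH mul1r; case: (sP n).
pose w n x := sg n * u n x.
have [|||U [mU U2 wU]] := @pm1_limit w.
- by move=> n; exact: measurable_funM.
- by move=> n x; rewrite exprMn sg2 u2 mul1r.
- move=> n; have [_] := sP n; apply: le_trans; rewrite le_eqVlt; apply/predU1P; left.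
  apply: eq_Rintegral => x _; rewrite /w /=.
  have -> : (sg n * u n x - sg n * s n * u n.+1 x) * (sg n * u n x - sg n * s n * u n.+1 x)
    = sg n ^+ 2 * ((u n x - s n * u n.+1 x) * (u n x - s n * u n.+1 x)) by ring.
  by rewrite sg2 mul1r.
have [sU U1] := sqint_pm1 mU U2.
have su n : sqint mu (u n) by case: (sqint_pm1 (mu_ n) (u2 n)).
have sw n : sqint mu (w n) by exact: sqintZ.
have archi (x K : R) : 0 <= K -> (forall n, x <= K / (2 ^ n)%:R) -> x <= 0.
  move=> K0 xK; rewrite leNgt; apply/negP => x0.
  have [n nK] : exists n : nat, K / x < n%:R.
    by exists (Num.truncn (K / x)).+1; exact: truncnS_gt.
  have := xK n; rewrite leNgt ltr_pdivrMr ?ltr0n ?expn_gt0 //.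
  move: nK; rewrite ltr_pdivrMr // mulrC => /lt_le_trans->//.
  by rewrite ler_pM2l // ler_nat ltnW // ltn_expl.
have dw n : defect 1 (w n) = defect 1 (u n).
  apply: eq_bigr => a _; apply: eq_Rintegral => x _; rewrite /w /= !mul1r.
  set x' := act _ x.
  have -> : (sg n * u n x' + sg n * u n x) * (sg n * u n x' + sg n * u n x) =
    sg n ^+ 2 * ((u n x' + u n x) * (u n x' + u n x)) by ring.
  by rewrite sg2 mul1r.
have hU : hepsR mu act U.
  apply: defect0_heps => //; apply/eqP; rewrite eq_le defect_ge0 andbT.
  pose K := 3 * (kappa^-1 * (M * eta)) + 48 * r%:R.
  apply: (archi _ K) => [|n].
    have : 0 < kappa^-1 * (M * eta) by apply: mulr_gt0; [rewrite invr_gt0|exact: mulr_gt0].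
    by rewrite /K; lra.
  apply: (le_trans (defect_perturb sU (sw n))); rewrite dw /K [X in _ <= X]mulrDl; apply: lerD.
    rewrite -mulrA ler_wpM2l // -mulrA ler_pdivlMl // (le_trans (du n)) //.
    rewrite -mulrA ler_wpM2l ?(ltW M0) // ler_wpM2l ?(ltW eta0) //.
    by rewrite lef_pV2 ?posrE ?ltr0n ?expn_gt0 // ler_nat leq_exp2l.
  have -> : 48 * r%:R / (2 ^ n)%:R = 12 * r%:R * (4 / (2 ^ n)%:R) :> R by ring.
  rewrite ler_wpM2l ?mulr_ge0 // (le_trans _ (wU n)) // le_eqVlt; apply/predU1P; left.
  by apply: eq_Rintegral => x _; ring.
(* [sg n * v n] and [U] are orthogonal unit vectors, at squared distance 2, yet this is bounded by a
   multiple of [2^-n] for every [n]. *)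
have : 2 <= 0 :> R.
  pose K := 3 * (kappa^-1 * (2 * eta) + 4).
  apply: (archi _ K) => [|n].
    have : 0 < kappa^-1 * eta by apply: mulr_gt0; [rewrite invr_gt0|].
    by rewrite /K; lra.
  have vU : ip mu (v n) U = 0 by case: (vP n) => -[_ _ /(_ U hU)].
  have E : ip mu (fun x => sg n * v n x - U x) (fun x => sg n * v n x - U x) = 2.
    have A1 : ip mu (fun x => sg n * v n x) U = 0 by rewrite ipZl // vU mulr0.
    have A2 : ip mu (fun x => sg n * v n x) (fun x => sg n * v n x) = 1.
      rewrite -sqr_nrm2 nrm2Z // exprMn real_normK ?num_real // sg2 sqr_nrm2.
      by rewrite v1 mulr1.
    by rewrite ip_subb ?A1 ?A2 ?U1 //; [ring|exact: sqintZ].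
  have {1}<- := E.
  have sz : sqint mu (fun=> 0) := sqint_cst mu 0.
  have s1 : sqint mu (fun x => v n x - u n x) by exact: sqintB.
  have s2 : sqint mu (fun x => U x - w n x) by exact: sqintB.
  have s3 : sqint mu (fun x => sg n * v n x - U x) by apply: sqintB => //; exact: sqintZ.
  apply: le_trans (ip_le3 (proj1 s3) s1 s2 sz _) _ => [x|].
    have -> : sg n * v n x - U x = sg n * (v n x - u n x) - (U x - w n x).
      by rewrite /w; ring.
    have : (sg n * (v n x - u n x)) ^+ 2 = (v n x - u n x) ^+ 2.
      by rewrite exprMn sg2 mul1r.
    set p := v n x - u n x; set P := sg n * p; set Q := U x - w n x.
    rewrite expr0n /= addr0.
    by have := sqr_ge0 (P + Q); have := sqr_ge0 P; have := sqr_ge0 Q; lra.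
  have -> : ip mu (fun=> 0) (fun=> 0) = 0 :> R.
    by rewrite /ip mulr0 Rintegral_prob_cst.
  rewrite addr0 /K -mulrA ler_wpM2l // [X in _ <= X]mulrDl; apply: lerD; last by have := wU n.
  rewrite -mulrA ler_pdivlMl // (le_trans (sgn_fun_approx (sv n) (v1 n))) //.
  rewrite -mulrA ler_wpM2l // (le_trans (dv n)) // ler_wpM2l ?(ltW eta0) //.
  by rewrite lef_pV2 ?posrE ?ltr0n ?expn_gt0 // ler_nat leq_exp2l.
by rewrite leNgt ltr0n.
Qed.

End GapPositive.

(** * Real and imaginary parts *)

Section ComplexParts.
Variable R : realType.
Local Notation C := R[i].
Implicit Types (z w : C) (k : R).

Lemma ReD z w : complex.Re (z + w) = complex.Re z + complex.Re w.
Proof. by case: z w => [? ?] []. Qed.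

Lemma ImD z w : complex.Im (z + w) = complex.Im z + complex.Im w.
Proof. by case: z w => [? ?] []. Qed.

Lemma Re_sum (I : Type) (s : seq I) (P : pred I) (F : I -> C) :
  complex.Re (\sum_(i <- s | P i) F i) = \sum_(i <- s | P i) complex.Re (F i).
Proof. exact: (big_morph _ ReD). Qed.

Lemma Im_sum (I : Type) (s : seq I) (P : pred I) (F : I -> C) :
  complex.Im (\sum_(i <- s | P i) F i) = \sum_(i <- s | P i) complex.Im (F i).
Proof. exact: (big_morph _ ImD). Qed.

Lemma ReMC k z : complex.Re (k%:C%C * z) = k * complex.Re z.
Proof. by case: z => a b /=; rewrite mul0r subr0. Qed.

Lemma ImMC k z : complex.Im (k%:C%C * z) = k * complex.Im z.
Proof. by case: z => a b /=; rewrite mul0r addr0. Qed.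

Lemma natrCV n : n%:R^-1 = (n%:R^-1 : R)%:C%C :> C.
Proof. by rewrite fmorphV rmorph_nat. Qed.

Lemma signC n : (-1) ^+ n = ((-1) ^+ n : R)%:C%C :> C.
Proof. by rewrite rmorphXn rmorphN1. Qed.

Lemma cabs_ge0 z : 0 <= cabs z.
Proof. by case: z => a b; exact: sqrtr_ge0. Qed.

Lemma cabs_sqr z : cabs z ^+ 2 = complex.Re z ^+ 2 + complex.Im z ^+ 2.
Proof. by case: z => a b; rewrite /cabs /= sqr_sqrtr // addr_ge0 ?sqr_ge0. Qed.

Lemma Re_le_cabs z : `|complex.Re z| <= cabs z.
Proof.
rewrite -(@ler_pXn2r _ 2) ?nnegrE ?cabs_ge0 // cabs_sqr real_normK ?num_real //.
by rewrite lerDl sqr_ge0.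
Qed.

Lemma Im_le_cabs z : `|complex.Im z| <= cabs z.
Proof.
rewrite -(@ler_pXn2r _ 2) ?nnegrE ?cabs_ge0 // cabs_sqr real_normK ?num_real //.
by rewrite lerDr sqr_ge0.
Qed.

Lemma cabs_le z : cabs z <= `|complex.Re z| + `|complex.Im z|.
Proof.
rewrite -(@ler_pXn2r _ 2) ?nnegrE ?cabs_ge0 ?addr_ge0 // cabs_sqr.
rewrite -(real_normK (num_real (complex.Re z))).
rewrite -(real_normK (num_real (complex.Im z))).
have := normr_ge0 (complex.Re z); have := normr_ge0 (complex.Im z); nra.
Qed.

End ComplexParts.

(** If no constant works, then [1 / (n + 1)] fails for each [n], and the resulting unit vectors move
    little under every letter. The triangle inequality along products carries this over to every
    group element, so the sequence is almost invariant. *)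
Lemma uniform_gap_generators (R : realType) r (T I : Type)
    (act : freeGroup r -> T -> T) (space : I -> set (T -> R[i]))
    (nrm : I -> (T -> R[i]) -> R) :
  is_action act -> (forall i f, 0 <= nrm i f) -> (forall i, nrm i (fun=> 0) = 0) ->
  (forall i v a g, space i v ->
    nrm i (fun x => v (act (letter_elt a * g)^-1%g x) - v x) <=
    nrm i (fun x => v (act g^-1%g x) - v x) +
    nrm i (fun x => v (act (letter_elt a)^-1%g x) - v x)) ->
  uniform_spectral_gap act space nrm ->
  exists2 kappa : R, 0 < kappa & forall i v, space i v -> nrm i v = 1 ->
    exists a, kappa <= nrm i (fun x => v (act (letter_elt a)^-1%g x) - v x).
Proof.
move=> actP nrm_ge0 nrm0 nrmM; apply: contra_notP => nk.
have H n : exists iv : I * (T -> R[i]), [/\ space iv.1 iv.2, nrm iv.1 iv.2 = 1 &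
    forall a, nrm iv.1 (fun x => iv.2 (act (letter_elt a)^-1%g x) - iv.2 x)
      < n.+1%:R^-1].
  apply: contrapT => nH; apply: nk; exists n.+1%:R^-1; first by rewrite invr_gt0 ltr0n.
  move=> i v iv v1; apply: contrapT => na; apply: nH; exists (i, v); split=> // a.
  by rewrite ltNge; apply/negP => ka; apply: na; exists a.
have {H}[iv ivP] := choice H.
exists (fun n => (iv n).1), (fun n => (iv n).2); split.
  by move=> n; case: (ivP n).
apply: (@freeGroup_ind r (fun g => (fun n => nrm (iv n).1
    (fun x => (iv n).2 (act g^-1%g x) - (iv n).2 x)) @ \oo --> (0 : R))) => [|a g IH].
  have -> : (fun n => nrm (iv n).1
     (fun x => (iv n).2 (act 1^-1%g x) - (iv n).2 x)) = fun=> 0.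
    apply/funext => n; rewrite -[RHS](nrm0 (iv n).1); congr nrm.
    by apply/funext => x; rewrite invg1 (act1 actP) subrr.
  exact: cvg_cst.
pose b n := nrm (iv n).1 (fun x => (iv n).2 (act g^-1%g x) - (iv n).2 x) + n.+1%:R^-1.
apply: (@squeeze_cvgr _ _ _ _ (fun=> 0) b).
- apply: nearW => n; rewrite nrm_ge0 /=.
  have [sv _ va] := ivP n; rewrite (le_trans (nrmM _ _ a g sv)) // lerD2l.
  exact/ltW.
- exact: cvg_cst.
- rewrite -[X in _ --> X]addr0; apply: cvgD => //; exact: cvg_harmonic.
Qed.

(** * Complex L^2 functions and the size of the gap *)

Section ComplexL2.
Context (disp : measure_display) (T : measurableType disp) (R : realType).
Variables (mu : probability T R).
Local Notation C := R[i].
Implicit Types (f : T -> C).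

Local Notation re f := (fun x => complex.Re (f x)).
Local Notation im f := (fun x => complex.Im (f x)).

Lemma L2P f : L2 mu f <-> sqint mu (re f) /\ sqint mu (im f).
Proof.
split=> [[mre mim foo]|[[mre ire] [mim iim]]].
  have fi : mu.-integrable setT (EFin \o (fun x => cabs (f x) ^+ 2)).
    apply/integrableP; split.
      apply/measurable_EFinP; under eq_fun do rewrite cabs_sqr.
      by apply: measurable_funD; exact: measurable_funX.
    rewrite (eq_integral (fun x => (cabs (f x) ^+ 2)%:E)) // => x _.
    by rewrite /= ger0_norm // sqr_ge0.
  split; split=> //; apply: integrableR_le fi => [|x];
    by [exact: measurable_funX|rewrite ger0_norm ?sqr_ge0 // cabs_sqr ?lerDl ?lerDr sqr_ge0].
split=> //; have /integrableP[_] := integrableR_D ire iim.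
apply: le_lt_trans; rewrite le_eqVlt; apply/predU1P; left; apply: eq_integral => x _.
by rewrite /= cabs_sqr ger0_norm // addr_ge0 ?sqr_ge0.
Qed.

Lemma L2normE f : L2 mu f ->
  L2norm mu f = Num.sqrt (ip mu (re f) (re f) + ip mu (im f) (im f)).
Proof.
move=> /L2P[sre sim]; congr Num.sqrt; rewrite /ip -RintegralD ?sqintM //.
by apply: eq_Rintegral => x _; rewrite cabs_sqr !expr2.
Qed.

Lemma L2norm_real (v : T -> R) : sqint mu v ->
  L2norm mu (fun x => (v x)%:C%C) = nrm2 mu v.
Proof.
move=> sv; rewrite L2normE; last by apply/L2P; split=> //; exact: (sqint_cst mu 0).
rewrite /= (_ : ip mu (fun=> 0) _ = 0) ?addr0 //.
by rewrite /ip mul0r Rintegral_prob_cst.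
Qed.

Lemma L2dot_real f (w : T -> R) :
  L2dot mu f (fun x => (w x)%:C%C) = Complex (ip mu (re f) w) (ip mu (im f) w).
Proof.
by congr Complex; apply: eq_Rintegral => x _; case: (f x) => a b /=;
  rewrite ?(oppr0, mulr0, subr0, add0r).
Qed.

Lemma hypot_triangle (a b c d : R) :
  Num.sqrt ((a + c) ^+ 2 + (b + d) ^+ 2) <=
  Num.sqrt (a ^+ 2 + b ^+ 2) + Num.sqrt (c ^+ 2 + d ^+ 2).
Proof.
have := le_normcD (Complex a b) (Complex c d); exact.
Qed.

Lemma L2D f h : L2 mu f -> L2 mu h -> L2 mu (fun x => f x + h x).
Proof.
move=> /L2P[sf1 sf2] /L2P[sh1 sh2]; apply/L2P.
by split; [under eq_fun do rewrite ReD|under eq_fun do rewrite ImD]; exact: sqintD.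
Qed.

Lemma L2N f : L2 mu f -> L2 mu (fun x => - f x).
Proof.
move=> /L2P[/sqintN sf1 /sqintN sf2]; apply/L2P.
by split; [move: sf1|move: sf2]; congr sqint; apply/funext => x; case: (f x).
Qed.

Lemma L2norm_triangle f h : L2 mu f -> L2 mu h ->
  L2norm mu (fun x => f x + h x) <= L2norm mu f + L2norm mu h.
Proof.
move=> Lf Lh; have [/L2P[sf1 sf2] /L2P[sh1 sh2]] := (Lf, Lh).
rewrite !L2normE //; last exact: L2D.
have -> : re (fun x => f x + h x) = fun x => re f x + re h x.
  by apply/funext => x; exact: ReD.
have -> : im (fun x => f x + h x) = fun x => im f x + im h x.
  by apply/funext => x; exact: ImD.
rewrite -!sqr_nrm2; apply: le_trans (hypot_triangle _ _ _ _).
rewrite ler_wsqrtr // lerD // lerXn2r ?nnegrE ?addr_ge0 ?nrm2_ge0 //;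
  exact: ler_nrm2D.
Qed.

Variables (r : nat) (act : freeGroup r -> T -> T).

Lemma sum_letter (V : nmodType) (F : letter r -> V) :
  \sum_a F a = \sum_(i < r) (F (i, true) + F (i, false)).
Proof.
rewrite (eq_bigr (fun a => F (a.1, a.2))) => [|[] //].
by rewrite -(pair_bigA _ (fun i b => F (i, b))); apply: eq_bigr => i _; rewrite big_bool.
Qed.

Lemma Re_gen_average f x : complex.Re (gen_average act f x) = gen_avg act (re f) x.
Proof.
rewrite /gen_average natrCV ReMC Re_sum /gen_avg sum_letter; congr (_ * _).
by apply: eq_bigr => i _; rewrite ReD !letter_elt_gen.
Qed.

Lemma Im_gen_average f x : complex.Im (gen_average act f x) = gen_avg act (im f) x.
Proof.
rewrite /gen_average natrCV ImMC Im_sum /gen_avg sum_letter; congr (_ * _).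
by apply: eq_bigr => i _; rewrite ImD !letter_elt_gen.
Qed.

Lemma HepsP f : Heps mu act f <-> hepsR mu act (re f) /\ hepsR mu act (im f).
Proof.
have E g x : koopman act g f x = (-1) ^+ wlen g * f x <->
    complex.Re (f (act g^-1%g x)) = eps R g * complex.Re (f x) /\
    complex.Im (f (act g^-1%g x)) = eps R g * complex.Im (f x).
  rewrite signC -/(eps R g) -ReMC -ImMC /koopman; split=> [->//|[]].
  by case: (f _) => a b; case: (_ * _) => ? ? /= -> ->.
split=> [[/L2P[sre sim] fe]|[[sre re_e] [sim im_e]]].
  by split; split=> // g; apply: filterS (fe g) => x /E[].
split; first exact/L2P.
by move=> g; apply: filterS2 (re_e g) (im_e g) => x ? ?; exact/E.
Qed.

Lemma Heps_real (w : T -> R) : hepsR mu act w -> Heps mu act (fun x => (w x)%:C%C).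
Proof.
move=> hw; apply/HepsP; split=> //; split; first exact: (sqint_cst mu 0).
by move=> g; apply: aeW => x /=; rewrite mulr0.
Qed.

Hypothesis r_gt1 : (1 < r)%N.
Hypothesis actP : is_action act.
Hypothesis act_meas : forall g, measurable_fun setT (act g).
Hypothesis act_mu : invariant_measure mu act.

Lemma ortho_complex f : L20 mu f -> (forall g, Heps mu act g -> L2dot mu f g = 0) ->
  ortho1eps mu act (re f) /\ ortho1eps mu act (im f).
Proof.
move=> [/L2P[sre sim] [f0 f1]] fg; split; split=> // w /Heps_real/fg.
  by rewrite L2dot_real => -[].
by rewrite L2dot_real => -[].
Qed.

Lemma L2norm_gen_average q f : 0 <= q -> contracts mu act q -> L20 mu f ->
  (forall g, Heps mu act g -> L2dot mu f g = 0) ->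
  L2norm mu (gen_average act f) <= q * L2norm mu f.
Proof.
move=> q0 cq f0 fe; have [fre fim] := ortho_complex f0 fe.
have [sre _ _] := fre; have [sim _ _] := fim; have [Lf _] := f0.
have E f1 : (fun x => complex.Re (gen_average act f1 x)) = gen_avg act (re f1).
  by apply/funext => x; exact: Re_gen_average.
have E' f1 : (fun x => complex.Im (gen_average act f1 x)) = gen_avg act (im f1).
  by apply/funext => x; exact: Im_gen_average.
rewrite !L2normE //; last first.
  by apply/L2P; rewrite E E'; split; exact: sqint_gen_avg.
rewrite E E' -{1}(ger0_norm q0) -sqrtr_sqr -sqrtrM ?sqr_ge0 // ler_wsqrtr //.
by rewrite mulrDr lerD // -!sqr_nrm2 -exprMn lerXn2r ?nnegrE ?mulr_ge0 ?nrm2_ge0 //;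
  exact: cq.
Qed.

Let gap_set := [set L2norm mu (gen_average act f) | f in
    [set f | [/\ L20 mu f, (forall g, Heps mu act g -> L2dot mu f g = 0) &
       L2norm mu f <= 1]]].

Let gap_ub q : 0 <= q -> contracts mu act q -> ubound gap_set q.
Proof.
move=> q0 cq _ [f [f0 fe f1] <-].
by rewrite (le_trans (L2norm_gen_average q0 cq f0 fe)) // ler_piMr.
Qed.

Let gap_set_neq0 : gap_set !=set0.
Proof.
exists (L2norm mu (gen_average act (fun=> 0))), (fun=> 0) => //.
have s0 : L2 mu (fun=> 0 : C) by apply/L2P; split; exact: (sqint_cst mu 0).
split; last 1 first.
- by rewrite L2normE // /ip mulr0 Rintegral_prob_cst addr0 sqrtr0.
- split=> //; rewrite /cint Rintegral_prob_cst //.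
- move=> g _; rewrite /L2dot (_ : (fun x => 0 * _) = fun=> 0).
    by rewrite /cint Rintegral_prob_cst.
  by apply/funext => x; rewrite mul0r.
Qed.

Let contracts1 : contracts mu act 1.
Proof. by move=> v [sv _ _]; rewrite mul1r nrm2_gen_avg. Qed.

Let gap_has_sup : has_sup gap_set.
Proof. by split; [exact: gap_set_neq0|exists 1; exact: gap_ub contracts1]. Qed.

Lemma gap_size_le1 : gap_size mu act <= 1.
Proof.
rewrite gerBl; have [y gy] := gap_set_neq0; apply: le_trans (sup_upper_bound gap_has_sup gy).
by case: gy => f _ <-; exact: sqrtr_ge0.
Qed.

(** A real function in [ortho1eps] is, after normalisation, a competitor in the complex supremum
    defining [gap_size]. Functions of norm zero cannot be normalised and are treated apart. *)
Lemma contracts_gap_size : contracts mu act (1 - gap_size mu act).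
Proof.
rewrite subKr => v Kv; have [sv v0 vu] := Kv.
have [n0|n0] := eqVneq (nrm2 mu v) 0.
  rewrite n0 mulr0 -n0; exact: nrm2_gen_avg.
have np : 0 < nrm2 mu v by rewrite lt_neqAle eq_sym n0 nrm2_ge0.
pose v' x := (nrm2 mu v)^-1 * v x.
have [sv' v0' vu'] : ortho1eps mu act v' by exact: ortho1epsZ.
have Lv' : L2 mu (fun x => (v' x)%:C%C).
  by apply/L2P; split=> //; exact: (sqint_cst mu 0).
rewrite mulrC -ler_pdivrMl //; apply: sup_upper_bound; first exact: gap_has_sup.
exists (fun x => (v' x)%:C%C).
  split.
  - split=> //; rewrite /cint /= v0'.
    by rewrite Rintegral_prob_cst.
  - move=> g /HepsP[hre him]; rewrite /L2dot /cint.
    transitivity (Complex (ip mu v' (re g)) (ip mu v' (fun x => - complex.Im (g x)))).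
      by congr Complex; apply: eq_Rintegral => x _; case: (g x) => a b /=;
        rewrite ?(oppr0, mul0r, subr0, addr0).
    rewrite vu' // ipC ipNl //; last by case: him.
    by rewrite ipC vu' // oppr0.
  - by rewrite L2norm_real // nrm2Z // gtr0_norm ?invr_gt0 // mulVf.
have -> : gen_average act (fun x => (v' x)%:C%C) = fun x => (gen_avg act v' x)%:C%C.
  apply/funext => x; rewrite [LHS]complexE Re_gen_average Im_gen_average.
  by rewrite gen_avg_cst // mulr0 addr0.
rewrite L2norm_real; last exact: sqint_gen_avg.
rewrite (_ : gen_avg act v' = fun x => (nrm2 mu v)^-1 * gen_avg act v x).
  by rewrite nrm2Z ?gtr0_norm ?invr_gt0 //; exact: sqint_gen_avg.
by apply/funext => x; rewrite gen_avgZ.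
Qed.

Lemma gap_size_gt0 kappa : 0 < kappa -> almost_inv_gap mu act kappa ->
  0 < gap_size mu act.
Proof.
move=> k0 kP.
have [q /andP[q0 q1] cq] := exists_contraction r_gt1 actP act_meas act_mu k0 kP.
by rewrite subr_gt0 (le_lt_trans _ q1) // ge_sup //; exact: gap_ub.
Qed.

Lemma L2_act f g : L2 mu f -> L2 mu (fun x => f (act g x)).
Proof.
move=> /L2P[s1 s2]; apply/L2P; split.
  exact: (sqint_act act_meas act_mu g s1).
exact: (sqint_act act_meas act_mu g s2).
Qed.

Lemma L2norm_act f g : L2 mu f -> L2norm mu (fun x => f (act g x)) = L2norm mu f.
Proof.
move=> Lf; rewrite !L2normE //; last exact: L2_act.
have /L2P[sre sim] := Lf.
by rewrite (ip_act act_meas act_mu g sre sre) (ip_act act_meas act_mu g sim sim).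
Qed.

(** A family of spaces, because it serves both [L20] and the finite levels of a profinite
    completion. Closure under real multiples allows normalising [v]; one letter that moves [v]
    already bounds [defect] from below. *)
Lemma real_uniform_gap (I : Type) (space : I -> set (T -> C)) :
  (forall i, space i `<=` L2 mu) ->
  uniform_spectral_gap act space (fun=> L2norm mu) ->
  exists2 kappa : R, 0 < kappa & forall i v, sqint mu v ->
    (forall k, space i (fun x => (k * v x)%:C%C)) ->
    kappa * ip mu v v <= defect mu act (-1) v.
Proof.
move=> spaceL2 gap.
have [|||||k k0 kP] := @uniform_gap_generators R r T I act space (fun=> L2norm mu).
- exact: actP.
- by move=> _ f; exact: sqrtr_ge0.
- move=> _; rewrite L2normE; last by apply/L2P; split; exact: (sqint_cst mu 0).
  by rewrite /ip mulr0 Rintegral_prob_cst addr0 sqrtr0.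
- move=> i v a g /spaceL2 Lv.
  have LB h : L2 mu (fun x => v (act h x) - v x) by exact: (L2D (L2_act h Lv) (L2N Lv)).
  have -> : (fun x => v (act (letter_elt a * g)^-1%g x) - v x) = (fun x =>
      (v (act g^-1%g (act (letter_elt a)^-1%g x)) - v (act (letter_elt a)^-1%g x)) +
      (v (act (letter_elt a)^-1%g x) - v x)).
    by apply/funext => x; rewrite invgM (actM actP) subrKA.
  apply: le_trans (L2norm_triangle _ _) _; [exact: (L2_act _ (LB _))|exact: LB|].
  by rewrite lerD2r (L2norm_act _ (LB g^-1%g)).
- exact: gap.
exists (k ^+ 2); first by rewrite exprn_gt0.
move=> i v sv iv.
have [n0|n0] := eqVneq (nrm2 mu v) 0.
  rewrite -sqr_nrm2 n0 expr0n mulr0; exact: defect_ge0.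
have np : 0 < nrm2 mu v by rewrite lt_neqAle eq_sym n0 nrm2_ge0.
pose v' x := (nrm2 mu v)^-1 * v x.
have sv' : sqint mu v' by exact: sqintZ.
have [||a ka] := kP i (fun x => (v' x)%:C%C).
- exact: iv.
- by rewrite L2norm_real // nrm2Z // gtr0_norm ?invr_gt0 // mulVf.
pose w x := v (act (letter_elt a)^-1%g x) + -1 * v x.
have sw : sqint mu w.
  by apply: sqintD; [exact: (sqint_act act_meas act_mu)|exact: sqintZ].
have {}ka : k <= (nrm2 mu v)^-1 * nrm2 mu w.
  apply: le_trans ka _; rewrite (_ : (fun x => _ - _) =
    fun x => ((nrm2 mu v)^-1 * w x)%:C%C).
    by rewrite L2norm_real ?nrm2Z ?gtr0_norm ?invr_gt0 //; exact: sqintZ.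
  by apply/funext => x; rewrite -rmorphB -mulrBr /w mulN1r.
apply: (@le_trans _ _ (ip mu w w)).
  rewrite -!sqr_nrm2 -exprMn lerXn2r ?nnegrE ?mulr_ge0 ?nrm2_ge0 ?(ltW k0) //.
  by rewrite mulrC -ler_pdivlMl.
rewrite /defect (bigD1 a) //= lerDl; apply: sumr_ge0 => b _; exact: ip_ge0.
Qed.

Lemma almost_inv_gap_L20 : spectral_gap_L20 mu act ->
  exists2 kappa, 0 < kappa & almost_inv_gap mu act kappa.
Proof.
move=> /real_uniform_gap[|kappa k0 kP]; first by move=> _ f [].
exists kappa => // v sv v0; apply: (kP tt) => // k; split.
  by apply/L2P; split; [exact: sqintZ|exact: (sqint_cst mu 0)].
rewrite /cint /= Rintegral_prob_cst RintegralZl ?v0 ?mulr0 //.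
exact: sqint_integrable.
Qed.

End ComplexL2.

(** * Isometric actions on metric spaces *)

Section BallWeights.
Variables (R : realType) (r : nat).
Hypothesis r_gt1 : (1 < r)%N.

(** The scalar by which the ball average acts on functions that transform by the sign character, see
    [ball_avg_eps]. *)
Definition eps_weight m : R := (\sum_(k < m.+1) sphere_size r k)%:R^-1 *
  \sum_(k < m.+1) (-1) ^+ k * (sphere_size r k)%:R.

Let M : R := 2 * r%:R - 1.

Let r2 : 2 <= r%:R :> R. Proof. by rewrite (ler_nat _ 2). Qed.

Let sphere_sizeS k : (sphere_size r k.+1)%:R = 2 * r%:R * M ^+ k :> R.
Proof.
rewrite /= !natrM natrX; congr (_ * _ ^+ _).
by rewrite -subn1 natrB ?natrM //; lia.
Qed.

Lemma sum_sphere_size m :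
  (r%:R - 1) * (\sum_(k < m.+1) sphere_size r k)%:R = r%:R * M ^+ m - 1 :> R.
Proof.
elim: m => [|m IH]; first by rewrite big_ord1 !expr0 !mulr1.
rewrite big_ord_recr natrD mulrDr IH sphere_sizeS exprS /M; ring.
Qed.

Lemma alt_sum_sphere_size m :
  \sum_(k < m.+1) (-1) ^+ k * (sphere_size r k)%:R = (-1) ^+ m * M ^+ m.
Proof.
elim: m => [|m IH]; first by rewrite big_ord1 !expr0.
transitivity (\sum_(k < m.+1) (-1) ^+ k * (sphere_size r k)%:R +
  (-1 : R) ^+ m.+1 * (sphere_size r m.+1)%:R); first exact: big_ord_recr.
by rewrite IH sphere_sizeS !exprS /M; ring.
Qed.

(** With [Q = M^(2n)], the two closed forms give the difference as [(r - 1) / (r (r Q - 1))], which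
    is at most [1 / Q]; and [M^-2 <= rho]. The even radius makes the alternating sum positive. *)
Lemma eps_weight_bound g n : 0 <= g <= 1 ->
  `|eps_weight (2 * n) - (r%:R - 1) / r%:R| <= rho_gap r g ^+ n.
Proof.
move=> g01; have r2' := r2; have M3 : 3 <= M by rewrite /M; lra.
have := sum_sphere_size (2 * n); rewrite /eps_weight alt_sum_sphere_size.
rewrite [(-1) ^+ _]exprM sqrrN !expr1n mul1r.
have q1 : 1 <= M ^+ (2 * n) by rewrite exprn_ege1 //; lra.
move: (\sum_(_ < _) _)%:R => N NE.
set Q := M ^+ (2 * n) in q1 NE *.
have N0 : 0 < N.
  by rewrite -(pmulr_rgt0 _ (_ : 0 < r%:R - 1)); [rewrite NE|]; nra.
have rQ : 0 < r%:R * Q - 1 by nra.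
have -> : N^-1 * Q - (r%:R - 1) / r%:R = (r%:R - 1) / r%:R / (r%:R * Q - 1).
  rewrite -NE; have -> : Q = ((r%:R - 1) * N + 1) / r%:R by rewrite NE; field; lra.
  by field; apply/and3P; split; apply/eqP; lra.
rewrite ger0_norm; last by rewrite !divr_ge0 //; lra.
apply: (@le_trans _ _ Q^-1).
  rewrite ler_pdivrMr // -[leLHS]mul1r.
  have -> : Q^-1 * (r%:R * Q - 1) = r%:R - Q^-1 by field; apply/eqP; lra.
  have : Q^-1 <= 1 by rewrite invf_le1 //; lra.
  have : (r%:R - 1) / r%:R <= 1 :> R by rewrite ler_pdivrMr; lra.
  by lra.
have rho0 := rho_gap_gt0 r_gt1 g01.
have := backtrack_le_rho r_gt1 g01; rewrite /backtrack -/M => bM.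
rewrite /Q exprM -exprVn lerXn2r ?nnegrE ?invr_ge0 ?sqr_ge0 //; first exact: ltW.
apply: le_trans bM; rewrite lef_pV2 ?posrE ?exprn_gt0; try lra.
by rewrite expr2; nra.
Qed.

Context (T : Type) (act : freeGroup r -> T -> T).
Implicit Types (f h u : T -> R).

Lemma ball_avgD m f h x : ball_avg act m (fun x => f x + h x) x =
  ball_avg act m f x + ball_avg act m h x.
Proof. by rewrite !ball_avgE big_split mulrDr. Qed.

Lemma ball_avgZ m k f x :
  ball_avg act m (fun x => k * f x) x = k * ball_avg act m f x.
Proof. by rewrite !ball_avgE -mulr_sumr mulrCA. Qed.

Lemma ball_avg_eps m u x : (forall g, u (act g^-1%g x) = eps R g * u x) ->
  ball_avg act m u x = eps_weight m * u x.
Proof.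
move=> ux; rewrite /ball_avg /eps_weight -mulrA mulr_suml; congr (_ * _).
apply: eq_bigr => k _; rewrite /sphere_sum.
transitivity (word_sum k (fun w : seq (letter r) => (-1) ^+ size w * u x)).
  rewrite !word_sumE; apply: eq_big_seq => w; rewrite mem_words => /andP[rw _].
  by rewrite ux /eps /wlen /= foldr_push_id.
rewrite (word_sum_wlen r k (fun n => (-1) ^+ n * u x)) mulrAC.
by rewrite mulr_natr.
Qed.

Lemma ball_avg_cst m (k : R) x : ball_avg act m (fun=> k) x = k.
Proof.
rewrite ball_avgE big_const_seq count_predT iter_addr_0 -[k *+ _]mulr_natl mulrA.
rewrite mulVf ?mul1r // pnatr_eq0 card_wball big_ord_recl addn_eq0.
by rewrite negb_and.
Qed.

Lemma ler_ball_avg m f x (K : R) :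
  (forall y, `|f y| <= K) -> `|ball_avg act m f x| <= K.
Proof.
move=> fK; rewrite -(ball_avg_cst m K x) !ball_avgE normrM.
rewrite ger0_norm ?invr_ge0 ?ler0n // ler_wpM2l ?invr_ge0 ?ler0n //.
by rewrite (le_trans (ler_norm_sum _ _ _)) // ler_sum.
Qed.

(** The action preserves [dd], so every term compares [f] at two points as far apart as [x] and [y].
    A modulus known only at that distance suffices, which covers both Lipschitz bounds and Hoelder
    bounds at small scales. *)
Lemma ball_avg_lip (dd : T -> T -> R) (mod : R -> R) m f x y :
  (forall g x y, dd (act g x) (act g y) = dd x y) ->
  (forall x' y', dd x' y' = dd x y -> `|f x' - f y'| <= mod (dd x y)) ->
  `|ball_avg act m f x - ball_avg act m f y| <= mod (dd x y).
Proof.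
move=> dd_act fm; rewrite -(ball_avg_cst m (mod (dd x y)) x) !ball_avgE -mulrBr.
rewrite -sumrB normrM ger0_norm ?invr_ge0 ?ler0n //.
rewrite ler_wpM2l ?invr_ge0 ?ler0n // (le_trans (ler_norm_sum _ _ _)) //.
by apply: ler_sum => g _; exact: fm.
Qed.

End BallWeights.

(** Solves [t^(2 + D / a) <= K * rho^(2n)] for a value [t] of the function: the left side is what
    [sup_bound] controls for an [a]-Hoelder function, the right side is the squared L^2 decay. *)
Definition rate (R : realType) (a : R) (r : nat) (g : R) (D : nat) : R :=
  - (2 * ln (rho_gap r g)) / (2 + D%:R / a).

Lemma rate_gt0 (R : realType) (a : R) r g D : 0 < a -> (1 < r)%N ->
  0 < g <= 1 -> 0 < rate a r g D.
Proof.
move=> a0 r1 /andP[g0 g1]; have g01 : 0 <= g <= 1 by rewrite ltW.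
have rho0 := rho_gap_gt0 r1 g01; have rho1 := rho_gap_lt1 r1 g0.
rewrite /rate divr_gt0 //; last by rewrite ltr_wpDr // divr_ge0 // ltW.
by rewrite oppr_gt0 pmulr_rlt0 // ln_lt0 // rho0.
Qed.

(** * From L^2 bounds to uniform bounds *)

Section MetricAction.
Context (R : realType) (r : nat) (X : ptopologicalType).
Variables (mu : probability (borelType X) R) (act : freeGroup r -> X -> X).
Variables (dd : X -> X -> R) (D : nat) (kappa : R).
Hypothesis r_gt1 : (1 < r)%N.
Hypothesis actP : is_action act.
Hypothesis dd0 : forall x, dd x x = 0.
Hypothesis dd_sym : forall x y, dd x y = dd y x.
Hypothesis dd_tri : forall x y z, dd x z <= dd x y + dd y z.
Hypothesis dd_nbhs : forall x (U : set X),
  nbhs x U <-> exists2 e : R, 0 < e & forall y, dd x y < e -> U y.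
Hypothesis dd_act : forall g x y, dd (act g x) (act g y) = dd x y.
Hypothesis act_mu : invariant_measure mu act.
Hypothesis mu_full : full_support mu.
Hypothesis kappa_gt0 : 0 < kappa.
Hypothesis kappaP : almost_inv_gap mu act kappa.

Lemma dd_ge0 x y : 0 <= dd x y.
Proof. by have := dd_tri x y x; rewrite dd0 [dd y x]dd_sym; lra. Qed.

Definition dball x e : set X := [set y | dd x y < e].

Lemma open_dball x e : open (dball x e).
Proof.
rewrite openE => y xy; apply/dd_nbhs; exists (e - dd x y); first by rewrite subr_gt0.
by move=> z yz; rewrite /dball /= (le_lt_trans (dd_tri x y z)) // addrC -ltrBrDr.
Qed.

Lemma measurable_open (U : set X) : open U -> measurable (U : set (borelType X)).
Proof. by move=> oU; exact: sub_sigma_algebra. Qed.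

Lemma measurable_dball x e : measurable (dball x e : set (borelType X)).
Proof. by apply: measurable_open; exact: open_dball. Qed.

Lemma dball_gt0 x e : 0 < e -> (0 < mu (dball x e))%E.
Proof. by move=> e0; apply: mu_full; [exact: open_dball|exists x; rewrite /dball /= dd0]. Qed.

Lemma lip_continuous (f : X -> R) (L : R) :
  (forall x y, `|f x - f y| <= L * dd x y) -> continuous f.
Proof.
move=> fL x; apply/cvgrPdist_lt => e e0.
have L1 : 0 < `|L| + 1 by rewrite ltr_wpDl.
apply/dd_nbhs; exists (e / (`|L| + 1)); first exact: divr_gt0.
move=> y; rewrite ltr_pdivlMr // => xy; rewrite /= (le_lt_trans (fL _ _)) //.
apply: le_lt_trans xy; rewrite mulrC ler_wpM2l ?dd_ge0 //.
by rewrite (le_trans (ler_norm L)) // lerDl.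
Qed.

Lemma continuous_act g : continuous (act g).
Proof.
move=> x U /dd_nbhs[e e0 eU]; apply/dd_nbhs; exists e => // y xy.
by apply: eU; rewrite dd_act.
Qed.

Lemma continuous_borel (f : X -> R) : continuous f ->
  measurable_fun setT (f : borelType X -> R).
Proof.
move=> /continuousP cf; apply: (measurability _ (RGenOInfty.measurableE R)).
move=> _ [_ [x ->] <-]; rewrite setTI; apply: measurable_open; apply: cf.
by apply: interval_open.
Qed.

Lemma measurable_act g : measurable_fun setT (act g : borelType X -> borelType X).
Proof.
apply: (@measurability _ _ (borelType X) (borelType X) setT (act g) (@open X)) => //.
move=> _ [U oU <-]; rewrite setTI; apply: measurable_open.
by move/continuousP: (@continuous_act g); apply.
Qed.

(** An invariant function has zero defect, hence zero variance by the gap. *)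
Lemma invariant_cst (f : borelType X -> R) : sqint mu f ->
  (forall g, {ae mu, forall x, f (act g^-1%g x) = f x}) ->
  {ae mu, forall x, f x = \int[mu]_x f x}.
Proof.
move=> sf fi; have := variance_le_defect kappaP sf.
have -> : defect mu act (-1) f = 0.
  apply: big1 => a _; rewrite -[RHS](Rintegral_prob_cst mu 0).
  have sfa : sqint mu (fun x => f (act (letter_elt a)^-1%g x) + -1 * f x).
    by apply: sqintD; [exact: (sqint_act measurable_act act_mu)|exact: sqintZ].
  apply: eq_ae_Rintegral => //; first by apply: measurable_funM; case: sfa.
  by apply: ae_imp (fi (letter_elt a)) => x ->; rewrite mulN1r subrr mul0r.
rewrite pmulr_rle0 // => v0; have [s0 _ E] := centered sf erefl.
have /(ip_eq0_ae s0) : ip mu (fun x => f x - \int[mu]_x f x)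
   (fun x => f x - \int[mu]_x f x) = 0.
  by apply/eqP; rewrite eq_le ip_ge0 andbT E.
by apply: ae_imp => x /eqP; rewrite subr_eq0 => /eqP.
Qed.

(** The union [U] of balls around the orbit is open and invariant, so its indicator is almost
    everywhere the nonzero constant [mu U]. Hence [U] has full measure and meets every ball. *)
Lemma orbit_dense x y e : 0 < e -> exists g, dd (act g x) y < e.
Proof.
move=> e0; pose U := \bigcup_g dball (act g x) (e / 2).
have oU : open U by apply: bigcup_open => g _; exact: open_dball.
have mU : measurable (U : set (borelType X)) by exact: measurable_open.
have e2 : 0 < e / 2 by exact: divr_gt0.
have U0 : (0 < mu U)%E.
  by apply: mu_full => //; exists x, 1%g => //; rewrite /dball /= (act1 actP) dd0.
have mI : measurable_fun setT (\1_U : borelType X -> R) by exact: measurable_indic.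
have sI : sqint mu (\1_U : borelType X -> R).
  apply: (@sqint_bounded _ _ _ _ _ 1) => // z.
  by rewrite indicE; case: (_ \in _); rewrite ?normr1 ?normr0.
have UI g z : U (act g z) -> U z.
  move=> [h _ hz]; exists (g^-1 * h)%g => //; move: hz.
  by rewrite /dball /= (actM actP) -(dd_act g^-1%g) (actK actP).
have /(invariant_cst sI) : forall g, {ae mu, forall z,
    \1_U (act g^-1%g z) = \1_U z :> R}.
  move=> g; apply: aeW => z; rewrite !indicE; congr (nat_of_bool _)%:R.
  apply/idP/idP => /set_mem Uz; apply/mem_set; first exact: UI Uz.
  by apply: (UI g); rewrite (actVK actP).
have -> : \int[mu]_z \1_U z = fine (mu U).
  by rewrite /Rintegral integral_indic // setIT.
have mU0 : fine (mu U) != 0.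
  by rewrite gt_eqF // fine_gt0 // U0 /= ltey_eq fin_num_measure.
case=> N [mN N0 NU].
have [z [yz Uz]] : exists z, dball y (e / 2) z /\ U z.
  apply: contrapT => nz; have : (mu (dball y (e / 2)%R) <= mu N)%E.
    apply: le_measure; try exact: mem_set; first by apply: mem_set; exact: measurable_dball.
    move=> z yz; apply: NU => /=; rewrite indicE; have [zU|_] := boolP (z \in U).
      by move: zU => /set_mem zU; exfalso; apply: nz; exists z.
    by move=> E; move: mU0; rewrite -E eqxx.
  by rewrite N0 leNgt dball_gt0.
case: Uz => g _ gz; exists g; rewrite (le_lt_trans (dd_tri _ z _)) //.
move: yz gz; rewrite /dball /= dd_sym; lra.
Qed.

Variables (x0 : X) (c0 e0 : R).
Hypothesis c0_gt0 : 0 < c0.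
Hypothesis e0_gt0 : 0 < e0.
Hypothesis dball_x0 : forall e, 0 < e <= e0 -> ((c0 * e ^+ D)%:E <= mu (dball x0 e))%E.

(** Some translate of [x0] lies within [e / 2] of [x], and the ball of radius [e / 2] around it has
    the measure of the one around [x0]. *)
Lemma dball_lower x e : 0 < e <= e0 -> ((c0 * (e / 2) ^+ D)%:E <= mu (dball x e))%E.
Proof.
move=> /andP[ep ee0]; have e2 : 0 < e / 2 by exact: divr_gt0.
have [g gx] := orbit_dense x0 x e2.
apply: le_trans (dball_x0 (e := e / 2) _) _; first by apply/andP; split; lra.
rewrite -(act_mu g^-1%g (measurable_dball x0 (e / 2))).
apply: le_measure.
- by apply: mem_set; rewrite -[X in measurable X]setTI; apply: measurable_act => //; exact: measurable_dball.
- by apply: mem_set; exact: measurable_dball.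
- move=> y; rewrite /dball /= -(dd_act g) (actVK actP) => gy.
  rewrite (le_lt_trans (dd_tri _ (act g x0) _)) //.
  by move: gx gy; rewrite [dd x _]dd_sym; lra.
Qed.

(* A Hoelder function that is large at [x] is large on a ball whose radius is a
   power of the value, and balls have measure at least a multiple of [e ^+ D]. *)
Lemma sup_bound (al delta L B : R) : 0 < al -> 0 < delta -> 0 <= L -> 0 <= B ->
  exists2 K : R, 0 <= K & forall F : borelType X -> R, measurable_fun setT F ->
    (forall x, `|F x| <= B) ->
    (forall x y, dd x y < delta -> `|F x - F y| <= L * dd x y `^ al) ->
    forall x, `|F x| `^ (2 + D%:R / al) <= K * ip mu F F.
Proof.
move=> al0 d0 L0 B0; set de := Num.min delta e0.
have de0 : 0 < de by rewrite lt_min d0.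
have ali : 0 <= al^-1 by rewrite invr_ge0 ltW.
have B1 : 0 < (B + 1) `^ al^-1 by rewrite powR_gt0 // ltr_wpDl.
have L2 : 0 < (2 * (L + 1))^-1 by rewrite invr_gt0; lra.
(* The radius will be [k * |F x|^(1 / al)]. The first entry keeps it below [de] because [|F| <= B];
   the second makes [F] vary by at most [|F x| / 2] on the ball. Adding 1 to [B] and [L] avoids
   dividing by zero. *)
set k := Num.min (de / (B + 1) `^ al^-1) ((2 * (L + 1))^-1 `^ al^-1).
have k0 : 0 < k by rewrite lt_min divr_gt0 //= powR_gt0.
have kB : k * (B + 1) `^ al^-1 <= de by rewrite -ler_pdivlMr // ge_min lexx.
have kL : L * k `^ al <= 2^-1.
  have : k `^ al <= (2 * (L + 1))^-1.
    have : k <= (2 * (L + 1))^-1 `^ al^-1 by rewrite ge_min lexx orbT.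
    move=> /(ge0_ler_powR (ltW al0)); rewrite !nnegrE powR_ge0 ltW // => /(_ isT isT).
    by rewrite -powRrM mulVf ?powRr1 ?gt_eqF // ltW.
  move=> /(ler_wpM2l L0) /le_trans; apply.
  rewrite ler_pdivrMr; last by lra.
  by lra.
exists (4 / (c0 * (k / 2) ^+ D)).
  by rewrite divr_ge0 // mulr_ge0 ?exprn_ge0 ?divr_ge0 // ltW.
move=> F mF FB FL x; have p0 : 2 + D%:R / al != 0.
  by rewrite gt_eqF // ltr_wpDr // divr_ge0 // ltW.
have [Fx0|Fx0] := eqVneq (F x) 0.
  rewrite Fx0 normr0 powR0 // mulr_ge0 ?ip_ge0 // divr_ge0 //.
  by rewrite mulr_ge0 ?exprn_ge0 ?divr_ge0 // ltW.
set m := `|F x|; have m0 : 0 < m by rewrite normr_gt0.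
set e := k * m `^ al^-1; have ep : 0 < e by rewrite mulr_gt0 // powR_gt0.
have ede : e <= de.
  apply: le_trans kB; rewrite ler_wpM2l ?(ltW k0) // ge0_ler_powR // ?nnegrE ?(ltW m0) //.
    by rewrite addr_ge0.
  by rewrite (le_trans (FB x)) // lerDl.
have half y : dball x e y -> m / 2 <= `|F y|.
  rewrite /dball /= => xy.
  have : `|F x - F y| <= m / 2.
    have xd : dd x y < delta.
      by rewrite (lt_le_trans xy) // (le_trans ede) // ge_min lexx.
    apply: le_trans (FL x y xd) _.
    apply: (@le_trans _ _ (L * e `^ al)).
      rewrite ler_wpM2l // ge0_ler_powR ?nnegrE ?dd_ge0 ?(ltW al0) ?(ltW ep) ?(ltW xy) //.
    rewrite /e powRM ?(ltW k0) ?powR_ge0 // -powRrM mulVf ?gt_eqF //.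
    rewrite powRr1 ?(ltW m0) // mulrA mulrC ler_wpM2l //.
    exact: ltW.
  by have := ler_normB (F x) (F x - F y); rewrite subKr -/m; have := lerB_dist (F x) (F y); rewrite -/m; lra.
have sF : sqint mu F by exact: sqint_bounded FB.
have mB := measurable_dball x e.
have : m ^+ 2 / 4 * fine (mu (dball x e)) <= ip mu F F.
  have -> : fine (mu (dball x e)) = \int[mu]_y \1_(dball x e) y.
    by rewrite /Rintegral integral_indic // setIT.
  have iI : mu.-integrable setT (EFin \o (\1_(dball x e) : borelType X -> R)).
    apply: integrableR_le (integrableR_cst mu 1) => [|y]; first exact: measurable_indic.
    by rewrite indicE; case: (_ \in _); rewrite ?normr1 ?normr0.
  rewrite -RintegralZl //; apply: le_Rintegral => //.
  - exact: integrableR_Z.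
  - exact: sqintM.
  - move=> y _; rewrite indicE -expr2; have [/set_mem/half ye|_] := boolP (y \in _).
      rewrite mulr1 -(real_normK (num_real (F y))).
      have -> : m ^+ 2 / 4 = (m / 2) ^+ 2 by rewrite expr_div_n; congr (_ / _); ring.
      by rewrite lerXn2r ?nnegrE // divr_ge0 // ltW.
    by rewrite mulr0 sqr_ge0.
have ce : c0 * (e / 2) ^+ D <= fine (mu (dball x e)).
  rewrite -lee_fin fineK ?fin_num_measure //; apply: dball_lower.
  by rewrite ep (le_trans ede) // ge_min lexx orbT.
move=> ipF; have {}ipF : m ^+ 2 / 4 * (c0 * (e / 2) ^+ D) <= ip mu F F.
  apply: le_trans ipF; rewrite ler_wpM2l //; apply: divr_ge0 => //; exact: sqr_ge0.
rewrite powRD; last by apply/implyP => /eqP p; move: p0; rewrite p eqxx.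
rewrite (powR_mulrn 2) ?(ltW m0) // [D%:R / al]mulrC powRrM powR_mulrn ?powR_ge0 //.
rewrite -ler_pdivrMl; last first.
  by rewrite divr_gt0 // mulr_gt0 // exprn_gt0 // divr_gt0.
apply: le_trans ipF; rewrite le_eqVlt; apply/predU1P; left.
have kD : (k / 2) ^+ D != 0 by rewrite expf_eq0 gt_eqF ?andbF // divr_gt0.
rewrite /e [k * _ / 2]mulrAC [(k / 2 * _) ^+ D]exprMn; move: kD; move: ((k / 2) ^+ D) => kD kD0; field.
by rewrite kD0 gt_eqF.
Qed.

(** Takes the root of exponent [2 + D / al] in [sup_bound]. The constant precedes [F] and [n], so
    the bound is uniform over the class of functions. *)
Lemma decay_sup (al delta L B K g : R) : 0 < al -> 0 < delta -> 0 <= L -> 0 <= B ->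
  0 <= K -> 0 <= g <= 1 ->
  exists2 K' : R, 0 <= K' & forall (F : borelType X -> R) n, measurable_fun setT F ->
    (forall x, `|F x| <= B) ->
    (forall x y, dd x y < delta -> `|F x - F y| <= L * dd x y `^ al) ->
    nrm2 mu F <= K * rho_gap r g ^+ n ->
    forall x, `|F x| <= K' * expR (- (rate al r g D * n%:R)).
Proof.
move=> al0 d0 L0 B0 K0 g01; have [K1 K10 K1P] := sup_bound al0 d0 L0 B0.
have rho0 := rho_gap_gt0 r_gt1 g01.
set p := 2 + D%:R / al; have p0 : 0 < p by rewrite ltr_wpDr // divr_ge0 // ltW.
exists ((K1 * K ^+ 2) `^ p^-1); first exact: powR_ge0.
move=> F n mF FB FL FK x; have := K1P F mF FB FL x; rewrite -/p -sqr_nrm2 => Fp.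
have {}Fp : `|F x| `^ p <= K1 * K ^+ 2 * expR (2 * n%:R * ln (rho_gap r g)).
  apply: le_trans Fp _; rewrite -mulrA ler_wpM2l //.
  have -> : expR (2 * n%:R * ln (rho_gap r g)) = (rho_gap r g ^+ n) ^+ 2.
    rewrite -exprM mulnC -[in RHS](lnK (x := rho_gap r g)) ?posrE //.
    by rewrite -expRM_natl natrM.
  rewrite -exprMn lerXn2r ?nnegrE ?nrm2_ge0 //.
  by apply: mulr_ge0 => //; rewrite exprn_ge0 // ltW.
have : (`|F x| `^ p) `^ p^-1 <=
    (K1 * K ^+ 2 * expR (2 * n%:R * ln (rho_gap r g))) `^ p^-1.
  apply: ge0_ler_powR; rewrite ?nnegrE ?invr_ge0 ?powR_ge0 ?(ltW p0) //.
  by rewrite !mulr_ge0 ?expR_ge0 ?sqr_ge0.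
rewrite -powRrM divff ?gt_eqF // powRr1 // => /le_trans; apply.
rewrite powRM ?mulr_ge0 ?expR_ge0 ?sqr_ge0 // ler_wpM2l ?powR_ge0 //.
rewrite -expRM ler_expR /rate -/p le_eqVlt; apply/predU1P; left.
by field; rewrite gt_eqF.
Qed.

End MetricAction.

Lemma le0_geometric (R : realType) (x K q : R) : 0 <= q < 1 ->
  (forall n : nat, x <= K * q ^+ n) -> x <= 0.
Proof.
move=> /andP[q0 q1] xK.
have cq : (fun n => K * q ^+ n) @ \oo --> K * 0.
  by apply: cvgM; [exact: cvg_cst|apply: cvg_expr; rewrite ger0_norm].
rewrite -(mulr0 K); apply: (@ler_cvg_to _ _ _ _ (fun=> x) _ _ _ (cvg_cst x) cq).
exact: nearW.
Qed.

(** The intervals of radius [b n] around [F n] meet pairwise; the supremum of their lower ends lies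
    in all of them. *)
Lemma cauchy_limit (R : realType) (F b : nat -> R) :
  (forall n k, (n <= k)%N -> `|F n - F k| <= b n) ->
  exists l, forall n, `|F n - l| <= b n.
Proof.
move=> Fb; pose S := [set F n - b n | n in [set: nat]].
have b0 n : 0 <= b n by rewrite (le_trans _ (Fb n n (leqnn n))).
have Sub n : ubound S (F n + b n).
  move=> _ [k _ <-]; case: (leqP n k) => nk.
    by have := Fb _ _ nk; rewrite ler_norml; have := b0 k; have := b0 n; lra.
  by have := Fb _ _ (ltnW nk); rewrite ler_norml; have := b0 k; have := b0 n; lra.
have Shas : has_sup S by split; [exists (F 0%N - b 0%N), 0%N|exists (F 0%N + b 0%N)].
exists (sup S) => n; rewrite ler_norml.
have : sup S <= F n + b n by apply: ge_sup; [case: Shas|exact: Sub].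
have : F n - b n <= sup S by apply: sup_upper_bound => //; exists n.
by lra.
Qed.

(** * The continuous function spanning the sign eigenspace *)

Section EpsFunction.
Context (R : realType) (r : nat) (X : ptopologicalType).
Variables (mu : probability (borelType X) R) (act : freeGroup r -> X -> X).
Variables (dd : X -> X -> R) (D : nat) (kappa : R).
Hypothesis r_gt1 : (1 < r)%N.
Hypothesis actP : is_action act.
Hypothesis dd0 : forall x, dd x x = 0.
Hypothesis dd_sym : forall x y, dd x y = dd y x.
Hypothesis dd_tri : forall x y z, dd x z <= dd x y + dd y z.
Hypothesis dd_nbhs : forall x (U : set X),
  nbhs x U <-> exists2 e : R, 0 < e & forall y, dd x y < e -> U y.
Hypothesis dd_act : forall g x y, dd (act g x) (act g y) = dd x y.
Hypothesis act_mu : invariant_measure mu act.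
Hypothesis mu_full : full_support mu.
Hypothesis kappa_gt0 : 0 < kappa.
Hypothesis kappaP : almost_inv_gap mu act kappa.
Variables (x0 : X) (c0 e0 : R).
Hypothesis c0_gt0 : 0 < c0.
Hypothesis e0_gt0 : 0 < e0.
Hypothesis dball_x0 : forall e, 0 < e <= e0 ->
  ((c0 * e ^+ D)%:E <= mu (dball dd x0 e))%E.

Local Notation T := (borelType X).
Let act_meas : forall g, measurable_fun setT (act g : T -> T) :=
  measurable_act dd_nbhs dd_act.
Let dd_pos := dd_ge0 dd0 dd_sym dd_tri.
Local Notation gap := (gap_size mu act).
Local Notation rho := (rho_gap r gap).

Lemma gap01 : 0 <= gap <= 1.
Proof.
rewrite (gap_size_le1 r_gt1 act_meas act_mu) andbT.
have := @gap_size_gt0 _ _ _ mu _ act r_gt1 actP act_meas act_mu _ kappa_gt0 kappaP; exact: ltW.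
Qed.

(** The set where the functions differ is open and null, hence empty by full support. *)
Lemma ae_continuous_eq (f g : X -> R) : continuous f -> continuous g ->
  {ae mu, forall x, f x = g x} -> f = g.
Proof.
move=> cf cg [N [mN N0 NP]]; apply/funext => x; apply: contrapT => fgx.
have ofg : open [set y | f y - g y != 0].
  have cfg : continuous (fun y => f y - g y : R).
    by move=> y; apply: cvgB; [exact: cf|exact: cg].
  by move/continuousP: cfg => /(_ [set z | z != 0]); apply; exact: open_neq.
have : (mu [set y | f y - g y != 0]%R <= mu N)%E.
  apply: le_measure; [|exact: mem_set|].
    by apply: mem_set; exact: measurable_open.
  move=> y /= fgy; apply: NP => /= E; by move: fgy; rewrite E subrr eqxx.
rewrite N0 leNgt mu_full //; exists x => /=.
by rewrite subr_eq0; apply/eqP.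
Qed.

Lemma heps_Rintegral u : hepsR mu act u -> \int[mu]_x u x = 0.
Proof.
case=> su ue; have i0 : 'I_r := Ordinal (ltnW r_gt1).
pose g := (letter_elt (i0, true))^-1%g.
have iu := sqint_integrable su.
have E : \int[mu]_x u x = - \int[mu]_x u x.
  rewrite -{1}(Rintegral_act act_meas act_mu g iu) -[RHS]mulN1r -RintegralZl //.
  apply: eq_ae_Rintegral.
  - by case: (sqint_act act_meas act_mu g su).
  - by case: (sqintZ (-1) su).
  - by apply: ae_imp (ue (letter_elt (i0, true))) => x ->; rewrite eps_letter.
lra.
Qed.

(** The absolute value of [w] is invariant, hence a nonzero constant almost everywhere, so passing
    to the sign only rescales [w]. *)
Lemma heps_sgn w : hepsR mu act w -> ip mu w w != 0 ->
  exists2 u, hepsR mu act u & forall x, u x ^+ 2 = 1.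
Proof.
move=> [sw we] w0; have sa := sqint_norm sw.
have /(invariant_cst dd_nbhs dd_act act_mu kappa_gt0 kappaP sa) :
    forall g, {ae mu, forall x, `|w (act g^-1%g x)| = `|w x|}.
  by move=> g; apply: ae_imp (we g) => x ->; rewrite epsE normrMsign.
set k := \int[mu]_x _ => wk.
have k0 : k != 0.
  apply: contra_neq w0 => k0; rewrite -[RHS](Rintegral_prob_cst mu 0).
  apply: eq_ae_Rintegral => //; first by apply: measurable_funM; case: sw.
  by apply: ae_imp wk => x /eqP; rewrite k0 normr_eq0 => /eqP ->; rewrite mulr0.
exists (sgn_fun w); last exact: sgn_fun_sqr.
have [ssw _] := sqint_pm1 mu (measurable_sgn_fun (proj1 sw)) (sgn_fun_sqr w).
split=> // g; apply: ae_imp2 (we g) wk => x wx wkx.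
have wx0 : w x != 0 by rewrite -normr_eq0 wkx.
rewrite /sgn_fun wx epsE; case: (odd _); last by rewrite expr0 !mul1r.
by rewrite expr1 !mulN1r oppr_ge0; case: ltrgtP wx0 => // _ _; rewrite ?opprK.
Qed.

(** The product of [w] and [u] is invariant, hence constant; multiply by [u] once more. This is the
    one-dimensionality of the sign eigenspace. *)
Lemma heps_span u w : hepsR mu act u -> (forall x, u x ^+ 2 = 1) ->
  hepsR mu act w -> exists c, {ae mu, forall x, w x = c * u x}.
Proof.
move=> [su ue] u2 [sw we].
have u1 x : `|u x| = 1.
  by apply/eqP; rewrite -(@eqrXn2 _ 2) // ?real_normK ?num_real // u2 expr1n.
have sp : sqint mu (fun x => w x * u x).
  apply: (sqint_le _ _ sw) => [|x]; last by rewrite normrM u1 mulr1.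
  by apply: measurable_funM; [case: sw|case: su].
exists (\int[mu]_x (w x * u x)).
have /(invariant_cst dd_nbhs dd_act act_mu kappa_gt0 kappaP sp) :
    forall g, {ae mu, forall x, w (act g^-1%g x) * u (act g^-1%g x) = w x * u x}.
  move=> g; apply: ae_imp2 (ue g) (we g) => x -> ->.
  by rewrite mulrACA -expr2 epsE sqrr_sign mul1r.
by apply: ae_imp => x <-; rewrite -mulrA -expr2 u2 mulr1.
Qed.

Lemma heps_complete u v : hepsR mu act u -> (forall x, u x ^+ 2 = 1) ->
  sqint mu v -> \int[mu]_x v x = 0 -> ip mu v u = 0 -> ortho1eps mu act v.
Proof.
move=> hu u2 sv v0 vu; split=> // w hw; have [c wc] := heps_span hu u2 hw.
have [su _] := hu; have [sw _] := hw.
have -> : ip mu v w = ip mu v (fun x => c * u x).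
  apply: eq_ae_Rintegral.
  - by apply: measurable_funM; [case: sv|case: sw].
  - by apply: measurable_funM; [case: sv|case: (sqintZ c su)].
  - by apply: ae_imp wc => x ->.
by rewrite ipC ipZl // ipC vu mulr0.
Qed.

Definition limit_real u f : X -> R := fun x =>
  \int[mu]_x f x + (r%:R - 1) / r%:R * ip mu f u * u x.

Let weight_le1 : `|(r%:R - 1) / r%:R| <= 1 :> R.
Proof.
have r2 : 2 <= r%:R :> R by rewrite (ler_nat _ 2).
rewrite ger0_norm; last by rewrite divr_ge0 //; lra.
by rewrite ler_pdivrMr; lra.
Qed.

(** Split [f] into its mean, its component along [u] and a rest [v] of norm at most 3. Ball averages
    fix the first, multiply the second by [eps_weight] and make the third decay, whence
    [55 = 18 * 3 + 1]. The case [u = 0] covers a trivial eigenspace. *)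
Lemma nrm2_ball_avg_limit (u : T -> R) (f : T -> R) n : hepsR mu act u ->
  nrm2 mu u <= 1 -> (ip mu u u = 1 \/ u = fun=> 0) ->
  (forall v, sqint mu v -> \int[mu]_x v x = 0 -> ip mu v u = 0 -> ortho1eps mu act v) ->
  sqint mu f -> nrm2 mu f <= 1 ->
  nrm2 mu (fun x => ball_avg act (2 * n) f x - limit_real u f x) <= 55 * rho ^+ n.
Proof.
move=> hu nu u1 uc sf nf; have [su ue] := hu; have u0 := heps_Rintegral hu.
set m := \int[mu]_x f x; set t := ip mu f u.
pose v x := f x - (m + t * u x).
have s1 := sqint_cst mu (1 : R); have sm := sqint_cst mu m.
have stu : sqint mu (fun x => t * u x) by exact: sqintZ.
have smu : sqint mu (fun x => m + t * u x) by exact: sqintD.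
have sv : sqint mu v by exact: sqintB.
have v0 : \int[mu]_x v x = 0.
  rewrite RintegralB //; [|exact: sqint_integrable|exact: sqint_integrable].
  rewrite RintegralD //; [|exact: sqint_integrable|exact: sqint_integrable].
  rewrite Rintegral_prob_cst RintegralZl //; last exact: sqint_integrable.
  by rewrite u0 -/m; ring.
have vu : ip mu v u = 0.
  have mu0 : ip mu (fun=> m) u = 0.
    rewrite ipC -(mulr0 m) -u0 -RintegralZl //; last exact: sqint_integrable.
    by apply: eq_Rintegral => x _; rewrite mulrC.
  rewrite ipBl // ipDl // ipZl // mu0 add0r -/t; case: u1 => [->|u00].
    by rewrite mulr1 subrr.
  rewrite (_ : t = 0) ?mul0r ?subrr // /t u00 -[RHS](Rintegral_prob_cst mu 0).
  by apply: eq_Rintegral => x _; rewrite mulr0.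
have Kv := uc v sv v0 vu.
have fE : f = fun x => (m + t * u x) + v x by apply/funext => x; rewrite /v; ring.
have cG := @contracts_gap_size _ _ _ mu _ act r_gt1 act_meas act_mu.
have g01 : 0 <= 1 - gap <= 1 by have := gap01; lra.
have bv := @nrm2_ball_avg _ _ _ mu _ act r_gt1 actP act_meas act_mu _ g01 cG n _ Kv.
rewrite subKr in bv.
have t1 : `|t| <= 1.
  by rewrite (le_trans (ler_ip sf su)) // mulr_ile1 ?nrm2_ge0.
have m1 : `|m| <= 1.
  rewrite /m -ip1 (le_trans (ler_ip sf s1)) // {2}/nrm2 ip11 sqrtr1 mulr1 //.
have nv : nrm2 mu v <= 3.
  apply: le_trans (ler_nrm2B sf smu) _; have := ler_nrm2D sm stu.
  rewrite nrm2_cst nrm2Z //.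
  have : `|t| * nrm2 mu u <= 1 by rewrite mulr_ile1 ?nrm2_ge0.
  by lra.
pose de := eps_weight R r (2 * n) - (r%:R - 1) / r%:R.
have de_le : `|de| <= rho ^+ n := eps_weight_bound r_gt1 n gap01.
have sb h : sqint mu h -> sqint mu (ball_avg act (2 * n) h).
  exact: sqint_ball_avg.
have sl : sqint mu (limit_real u f) by apply: sqintD => //; exact: sqintZ.
have sde : sqint mu (fun x => t * de * u x) by exact: sqintZ.
have -> : nrm2 mu (fun x => ball_avg act (2 * n) f x - limit_real u f x) =
   nrm2 mu (fun x => ball_avg act (2 * n) v x + t * de * u x).
  congr Num.sqrt; apply: eq_ae_Rintegral.
  - by apply: measurable_funM; case: (sqintB (sb _ sf) sl).
  - by apply: measurable_funM; case: (sqintD (sb _ sv) sde).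
  - apply: ae_imp (ae_foral_freeGroup ue) => x ux.
    suff -> : ball_avg act (2 * n) f x - limit_real u f x =
      ball_avg act (2 * n) v x + t * de * u x by [].
    rewrite {1}fE ball_avgD ball_avgD ball_avg_cst ball_avgZ.
    by rewrite (ball_avg_eps (2 * n) ux) /limit_real -/m -/t /de; ring.
apply: le_trans (ler_nrm2D (sb _ sv) sde) _; rewrite nrm2Z // normrM.
have rho0 : 0 <= rho ^+ n by rewrite exprn_ge0 // ltW // rho_gap_gt0 // gap01.
have : 18 * rho ^+ n * nrm2 mu v <= 18 * rho ^+ n * 3.
  by rewrite ler_wpM2l // mulr_ge0.
have : `|t| * `|de| * nrm2 mu u <= rho ^+ n.
  rewrite -[leRHS]mulr1 ler_pM ?mulr_ge0 ?nrm2_ge0 //.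
  by rewrite -[leRHS]mul1r ler_pM.
by lra.
Qed.

(** Suppose [u] is orthogonal to all bounded Lipschitz functions. Indicators of open sets are limits
    of such functions, so the restrictions of [mu] to the set [u = 1] and to its complement agree on
    open sets, hence on Borel sets. Evaluated on these two sets, both are null. *)
Lemma exists_lipschitz_test (u : T -> R) : measurable_fun setT u ->
  (forall x, u x ^+ 2 = 1) ->
  exists phi : X -> R, [/\ exists2 L : R, 0 <= L &
    (forall x y, `|phi x - phi y| <= L * dd x y),
    (forall x, `|phi x| <= 1) & ip mu phi u != 0].
Proof.
move=> mu_ u2; apply: contrapT => nphi.
have {}nphi phi L : 0 <= L -> (forall x y, `|phi x - phi y| <= L * dd x y) ->
    (forall x, `|phi x| <= 1) -> ip mu phi u = 0.
  move=> L0 Lphi phi1; apply/eqP; apply: contrapT => /negP phiu.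
  by apply: nphi; exists phi; split=> //; exists L.
have u1 x : `|u x| = 1.
  by apply/eqP; rewrite -(@eqrXn2 _ 2) // ?real_normK ?num_real // u2 expr1n.
have openU (U : set X) : open U -> ip mu (\1_U : T -> R) u = 0.
  (* When [U] is everything there is no complement to measure the distance to; the constant 1 is
     tested instead. *)
  move=> oU; have [[z zU]|U0] := pselect (exists z, ~ U z); last first.
    rewrite -(nphi (fun=> 1) 0) //.
    - apply: eq_Rintegral => x _; rewrite indicE mem_set //.
      by apply: contrapT => nUx; apply: U0; exists x.
    - by move=> x y; rewrite subrr normr0 mul0r.
    - by move=> x; rewrite normr1.
  pose S x := [set dd x y | y in ~` U].
  have S0 x : has_inf (S x).
    by split; [exists (dd x z), z|exists 0 => _ [y _ <-]; exact: dd_pos].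
  pose e x := inf (S x).
  have e_ge0 x : 0 <= e x by apply: lb_le_inf => [|_ [y _ <-]]; [case: (S0 x)|].
  have e_le x y : ~ U y -> e x <= dd x y.
    by move=> Uy; apply: inf_lbound; [case: (S0 x)|exists y].
  have e_lip1 x y : e x <= dd x y + e y.
    rewrite -lerBlDl; apply: lb_le_inf => [|_ [w Uw <-]]; first by case: (S0 y).
    by rewrite lerBlDl (le_trans (e_le x w Uw)).
  have e_lip x y : `|e x - e y| <= dd x y.
    by rewrite ler_norml; have := e_lip1 x y; have := e_lip1 y x; rewrite [dd y x]dd_sym; lra.
  (* The distance [e x] to the complement is positive exactly on the open set [U], so these
     truncations tend to its indicator. *)
  pose phi n x := Num.min 1 (n%:R * e x).
  have phi_ge0 n x : 0 <= phi n x by rewrite le_min ler01 mulr_ge0.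
  have phi1 n x : `|phi n x| <= 1 by rewrite ger0_norm // ge_min lexx.
  have phi_lip n x y : `|phi n x - phi n y| <= n%:R * dd x y.
    have : `|n%:R * e x - n%:R * e y| <= n%:R * dd x y.
      by rewrite -mulrBr normrM ger0_norm ?ler0n // ler_wpM2l.
    apply: le_trans; rewrite /phi !minEle.
    by case: ifPn; case: ifPn; rewrite -?ltNge ?subrr ?normr0 // => h1 h2;
      rewrite ler_norml; have := ler_norm (n%:R * e x - n%:R * e y);
      have := ler_norm (n%:R * e y - n%:R * e x); rewrite (distrC (n%:R * e y)); lra.
  have cphi n : continuous (phi n) := lip_continuous dd0 dd_sym dd_tri dd_nbhs (phi_lip n).
  have mphi n : measurable_fun setT (phi n : T -> R) := continuous_borel (cphi n).
  have mU : measurable (U : set T) by exact: measurable_open.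
  have cvg_phi x : (fun n => phi n x) @ \oo --> (\1_U x : R).
    rewrite indicE; have [xU|xU] := boolP (x \in U).
      have ex : 0 < e x.
        have /dd_nbhs[d d0 dU] : nbhs x U by move: oU; rewrite openE; apply; exact: set_mem.
        apply: lt_le_trans d0 _; apply: lb_le_inf => [|_ [y Uy <-]]; first by case: (S0 x).
        by rewrite leNgt; apply/negP => /dU.
      apply: cvg_near_cst; exists (Num.truncn (e x)^-1).+1 => // n /= ne.
      rewrite /phi minEle ifT // -ler_pdivrMr // mul1r.
      by rewrite (le_trans (ltW (truncnS_gt _))) // ler_nat.
    have -> : (fun n => phi n x) = fun=> 0; last exact: cvg_cst.
    have ex0 : e x = 0.
      apply/eqP; rewrite eq_le e_ge0 andbT -(dd0 x) e_le // => Ux.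
      by move/mem_set: Ux; rewrite (negbTE xU).
    apply/funext => n; rewrite /phi ex0 mulr0.
    by rewrite minEle ler10.
  have mI : measurable_fun setT (\1_U : T -> R) by exact: measurable_indic.
  have [|||||_ _ +] := @dominated_convergence _ T R mu setT measurableT
    (fun n x => (phi n x * u x)%:E) (fun x => (\1_U x * u x)%:E) (EFin \o (fun=> 1)).
  - by move=> n; apply/measurable_EFinP; exact: measurable_funM.
  - by apply/measurable_EFinP; exact: measurable_funM.
  - apply: aeW => x _; apply: cvg_EFin; first exact: nearW.
    by apply: cvgM; [exact: cvg_phi|exact: cvg_cst].
  - exact: integrableR_cst.
  - by apply: aeW => x n _; rewrite /= lee_fin normrM u1 mulr1.
  have sI : sqint mu (\1_U : T -> R).
    apply: (@sqint_bounded _ _ _ _ _ 1) => // y.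
    by rewrite indicE; case: (_ \in _); rewrite ?normr1 ?normr0.
  have [su _] := sqint_pm1 mu mu_ u2.
  have E (f : T -> R) : sqint mu f -> (\int[mu]_x (f x * u x)%:E = (ip mu f u)%:E)%E.
    by move=> sf; rewrite /ip /Rintegral fineK //; apply: integrable_fin_num => //; exact: sqintM.
  rewrite E //; under eq_fun => n.
    rewrite E; last by apply: (@sqint_bounded _ _ _ _ _ 1).
    rewrite (nphi (phi n) n%:R) //; over.
  by move=> /(cvg_unique _ (cvg_cst _)) => /(_ (@ereal_hausdorff R)) [] <-.
pose P := [set x : T | u x = 1].
have mP : measurable P.
  by rewrite -[X in measurable X]setTI; exact: (mu_ measurableT [set 1]).
have mPc : measurable (~` P) by exact: measurableC.
have PE (A : set T) : measurable A -> ip mu (\1_A : T -> R) u =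
    fine (mu (A `&` P)) - fine (mu (A `&` ~` P)).
  move=> mA; rewrite /ip.
  have I (B : set T) : measurable B -> mu.-integrable setT (EFin \o (\1_B : T -> R)).
    move=> mB; apply: integrableR_le (integrableR_cst mu 1) => [|y].
      exact: measurable_indic.
    by rewrite indicE; case: (_ \in _); rewrite ?normr1 ?normr0.
  have J (B : set T) : measurable B -> fine (mu B) = \int[mu]_x \1_B x.
    by move=> mB; rewrite /Rintegral integral_indic // setIT.
  rewrite !J; try exact: measurableI.
  rewrite -RintegralB //; try (apply: I; exact: measurableI).
  apply: eq_Rintegral => x _; rewrite !indicE !in_setI in_setC.
  have [xA|xA] := boolP (x \in A); last by rewrite mul0r subr0.
  have [/set_mem ->|xP] := boolP (x \in P); first by rewrite mul1r subr0.
  have /eqP : u x ^+ 2 = 1 by []; rewrite sqrf_eq1 => /orP[/eqP ux|/eqP ->].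
    by move/negP: xP; case; exact: mem_set.
  by rewrite mul1r sub0r.
have eqPN (A : set T) : measurable A -> mrestr mu mP A = mrestr mu mPc A.
  move=> mA; apply: (@measure_unique _ R T (@open X) (fun=> setT) _ _ _ _
    (mrestr mu mP) (mrestr mu mPc) _ _ A mA) => //.
  - by move=> B B'; exact: openI.
  - by move=> _; exact: openT.
  - by rewrite bigcup_const //; exists 0%N.
  - move=> B oB; have mB : measurable (B : set T) by exact: measurable_open.
    have := openU B oB; rewrite PE // => /eqP; rewrite subr_eq0 => /eqP E.
    have f1 : mu (B `&` P) \is a fin_num.
      by apply: fin_num_measure; exact: (measurableI _ _ mB mP).
    have f2 : mu (B `&` ~` P) \is a fin_num.
      by apply: fin_num_measure; exact: (measurableI _ _ mB mPc).
    have Q : mu (B `&` P) = mu (B `&` ~` P) by rewrite -(fineK f1) -(fineK f2) E.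
    exact: Q.
  - move=> _; have f : mu (setT `&` P) \is a fin_num.
      by rewrite setTI; exact: fin_num_measure.
    have Q : (mu (setT `&` P) < +oo)%E by rewrite ltey_eq f.
    exact: Q.
have muP : mu P = 0%E.
  by have := eqPN P mP; rewrite /mrestr setIid setICr measure0.
have muPc : mu (~` P) = 0%E.
  by have := eqPN (~` P) mPc; rewrite /mrestr setIid setICl measure0 => <-.
have mu1 : mu (P `|` ~` P) = 1%E by rewrite setUv; exact: probability_setT.
have := measureU mu mP mPc (setICr P).
rewrite [X in _ = X -> _](_ : _ = (mu P + mu (~` P))%E) // muP muPc adde0.
by move=> /(eq_trans (esym mu1)) /eqP; rewrite eqe oner_eq0.
Qed.

(* Ball averages of a Lipschitz function that is not orthogonal to the sign of [w]
   are equi-Lipschitz and converge uniformly; the limit is an affine function of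
   the continuous representative sought. *)
Lemma exists_eps_function w : hepsR mu act w -> ip mu w w != 0 ->
  exists (u : X -> R) (delta : R), [/\ 0 < delta, continuous u, forall x, u x ^+ 2 = 1,
    forall g x, u (act g^-1%g x) = eps R g * u x &
    forall x y, dd x y < delta -> u x = u y].
Proof.
move=> hw w0; have [u1 hu1 u12] := heps_sgn hw w0.
have [su1 _] := hu1; have [mu1 _] := su1.
have u11 : ip mu u1 u1 = 1 by case: (sqint_pm1 mu mu1 u12).
have [phi [[L L0 phiL] phi1 phiu]] := exists_lipschitz_test mu1 u12.
have cphi := lip_continuous dd0 dd_sym dd_tri dd_nbhs phiL.
have sphi : sqint mu (phi : T -> R).
  by apply: (@sqint_bounded _ _ _ _ _ 1) => //; exact: continuous_borel.
have r2 : 2 <= r%:R :> R by rewrite (ler_nat _ 2).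
set m := \int[mu]_x phi x; set s := (r%:R - 1) / r%:R * ip mu phi u1.
have s0 : s != 0.
  by rewrite mulf_neq0 // gt_eqF // divr_gt0 //; lra.
pose F n := ball_avg act (2 * n) phi.
have F1 n x : `|F n x| <= 1 by exact: ler_ball_avg.
have FL n x y : `|F n x - F n y| <= L * dd x y.
  apply: (@ball_avg_lip _ _ _ _ dd (fun t => L * t)) => // x' y' <-; exact: phiL.
have cF n := lip_continuous dd0 dd_sym dd_tri dd_nbhs (FL n).
have mF n : measurable_fun setT (F n : T -> R) := continuous_borel (cF n).
have sF n : sqint mu (F n : T -> R) by apply: (@sqint_bounded _ _ _ _ _ 1).
have slim : sqint mu (limit_real u1 phi).
  by apply: sqintD; [exact: sqint_cst|exact: sqintZ].
have rho0 : 0 < rho by exact: rho_gap_gt0 gap01.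
have gap0 : 0 < gap := @gap_size_gt0 _ _ _ mu _ act r_gt1 actP act_meas act_mu _ kappa_gt0 kappaP.
have rho1 : rho < 1 := rho_gap_lt1 r_gt1 gap0.
have nF n : nrm2 mu (fun x => F n x - limit_real u1 phi x) <= 55 * rho ^+ n.
  apply: nrm2_ball_avg_limit => //.
  - by rewrite /nrm2 u11 sqrtr1.
  - by left.
  - by move=> v sv v0 vu; exact: (heps_complete hu1 u12).
  - rewrite -[leRHS]normr1 -(nrm2_cst mu); apply: ler_nrm2 => // [|x|].
    + by case: sphi.
    + by rewrite normr1.
    + exact: sqint_cst.
(* Parameters for a difference of two averages: exponent 1, Lipschitz constant [2 L], bound 2, and
   norm at most [110 = 2 * 55] times [rho^n]. *)
have [K K0 KP] := @decay_sup _ _ _ mu act dd D kappa r_gt1 actP dd0 dd_sym dd_tri dd_nbhs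
  dd_act act_mu mu_full kappa_gt0 kappaP x0 c0 e0 c0_gt0 e0_gt0 dball_x0
  1 1 (2 * L) 2 110 gap ltr01 ltr01 (mulr_ge0 (ler0n _ 2) L0) (ler0n _ 2) (ler0n _ 110) gap01.
set th := rate 1 r gap D in KP.
have th0 : 0 < th by apply: rate_gt0 => //; rewrite gap0; case/andP: gap01.
have qE n : expR (- (th * n%:R)) = expR (- th) ^+ n.
  by rewrite -expRM_natl mulrN mulrC.
have Fcauchy x n k : (n <= k)%N -> `|F n x - F k x| <= K * expR (- th) ^+ n.
  move=> nk; rewrite -qE; apply: (KP (fun x => F n x - F k x)).
  - exact: measurable_funB.
  - by move=> y; rewrite (le_trans (ler_normB _ _)) //; have := F1 n y; have := F1 k y; lra.
  - move=> y z _; rewrite powRr1 //.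
    have -> : F n y - F k y - (F n z - F k z) = (F n y - F n z) - (F k y - F k z) by ring.
    by rewrite (le_trans (ler_normB _ _)) //; have := FL n y z; have := FL k y z; lra.
  - have -> : (fun x => F n x - F k x) = fun x => (F n x - limit_real u1 phi x) -
        (F k x - limit_real u1 phi x) by apply/funext => y; ring.
    apply: le_trans (ler_nrm2B _ _) _; [exact: sqintB|exact: sqintB|].
    have := nF n; have := nF k.
    have : rho ^+ k <= rho ^+ n by rewrite ler_wiXn2l // ltW.
    by lra.
have /choice[G GP] x := cauchy_limit (Fcauchy x).
have GL x y : `|G x - G y| <= L * dd x y.
  rewrite -subr_le0; apply: (@le0_geometric _ _ (2 * K) (expR (- th))).
    by rewrite expR_ge0 expR_lt1 oppr_lt0.
  move=> n; have := GP x n; have := GP y n; have := FL n x y.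
  rewrite lerBlDr; rewrite !ler_norml => /andP[a1 a2] /andP[b1 b2] /andP[d1 d2].
  by apply/andP; split; lra.
have cG := lip_continuous dd0 dd_sym dd_tri dd_nbhs GL.
have mG : measurable_fun setT (G : T -> R) := continuous_borel cG.
have sG : sqint mu (G : T -> R).
  apply: (@sqint_bounded _ _ _ _ _ (1 + K)) => // x.
  have := GP x 0; have := F1 0 x; rewrite expr0 mulr1 => h1 h2.
  have -> : G x = F 0 x - (F 0 x - G x) by ring.
  by rewrite (le_trans (ler_normB _ _)) // lerD.
have Glim : {ae mu, forall x, G x = limit_real u1 phi x}.
  have sd := sqintB sG slim.
  have : nrm2 mu (fun x => G x - limit_real u1 phi x) <= 0.
    set q := Num.max (expR (- th)) rho.
    apply: (@le0_geometric _ _ (K + 55) q).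
      by rewrite le_max expR_ge0 /= gt_max expR_lt1 oppr_lt0 th0.
    move=> n; have -> : (fun x => G x - limit_real u1 phi x) = fun x =>
        (F n x - limit_real u1 phi x) - (F n x - G x) by apply/funext => y; ring.
    apply: le_trans (ler_nrm2B _ _) _; [exact: sqintB|exact: sqintB|].
    have q1 : rho ^+ n <= q ^+ n.
      by rewrite lerXn2r ?nnegrE ?le_max ?lexx ?orbT ?(ltW rho0) ?expR_ge0.
    have q2 : expR (- th) ^+ n <= q ^+ n.
      by rewrite lerXn2r ?nnegrE ?le_max ?lexx ?orbT ?(ltW rho0) ?expR_ge0.
    have : nrm2 mu (fun x => F n x - G x) <= K * expR (- th) ^+ n.
      rewrite -[leRHS]ger0_norm ?mulr_ge0 ?exprn_ge0 ?expR_ge0 // -(nrm2_cst mu).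
      apply: ler_nrm2 => [|x|]; first exact: measurable_funB.
        by rewrite [leRHS]ger0_norm ?mulr_ge0 ?exprn_ge0 ?expR_ge0.
      exact: sqint_cst.
    have := nF n; have := ler_wpM2l K0 q2.
    by lra.
  move=> n0; have /(ip_eq0_ae sd) : ip mu (fun x => G x - limit_real u1 phi x)
      (fun x => G x - limit_real u1 phi x) = 0.
    by apply/eqP; rewrite -sqr_nrm2 sqrf_eq0 eq_le n0 nrm2_ge0.
  by apply: ae_imp => x /eqP; rewrite subr_eq0 => /eqP.
(* The limit [G] is [m + s * u1] almost everywhere; solving for [u1] gives a continuous version of
   it. *)
pose u x := s^-1 * (G x - m).
have uL x y : `|u x - u y| <= `|s|^-1 * L * dd x y.
  rewrite /u -mulrBr normrM normfV -mulrA ler_wpM2l ?invr_ge0 //.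
  by rewrite (_ : G x - m - _ = G x - G y); [exact: GL|ring].
have cu := lip_continuous dd0 dd_sym dd_tri dd_nbhs uL.
have uu1 : {ae mu, forall x, u x = u1 x}.
  apply: ae_imp Glim => x Gx; rewrite /u Gx /limit_real -/m -/s.
  by rewrite addrAC subrr add0r mulrA mulVf // mul1r.
have cu2 : continuous (fun x => u x ^+ 2).
  by move=> x; apply: cvgM; exact: cu.
have u2 x : u x ^+ 2 = 1.
  suff /(congr1 (fun f => f x)) : (fun x => u x ^+ 2) = fun=> 1 by [].
  apply: ae_continuous_eq => //; first by move=> ?; exact: cvg_cst.
  by apply: ae_imp uu1 => y ->.
(* Within this distance [u] varies by less than 1, while its only values are 1 and -1. *)
exists u, (`|s| / (L + 1)); split=> //.
- by rewrite divr_gt0 ?normr_gt0 // ltr_wpDl.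
- move=> g x; suff /(congr1 (fun f => f x)) : (fun x => u (act g^-1%g x)) =
    fun x => eps R g * u x by [].
  have cact := continuous_act dd_nbhs dd_act (g := g^-1%g).
  apply: ae_continuous_eq.
  + by move=> y; apply: continuous_comp; [exact: cact|exact: cu].
  + by move=> y; apply: cvgM; [exact: cvg_cst|exact: cu].
  + have h1 := ae_act act_meas act_mu g^-1%g uu1.
    have [_ u1e] := hu1.
    have h2 : {ae mu, forall y : T, u (act g^-1%g y) = eps R g * u1 y}.
      by apply: ae_imp2 h1 (u1e g) => y -> ->.
    by apply: ae_imp2 h2 uu1 => y -> ->.
- move=> x y; rewrite ltr_pdivlMr ?ltr_wpDl // => xy.
  have {}xy : `|u x - u y| < 1.
    apply: le_lt_trans (uL x y) _; rewrite -mulrA ltr_pdivrMl ?normr_gt0 // mulr1.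
    by apply: le_lt_trans xy; rewrite mulrC ler_wpM2l // lerDl.
  have /eqP := u2 x; have /eqP := u2 y; rewrite !sqrf_eq1.
  by move=> /orP[]/eqP uy /orP[]/eqP ux; move: xy; rewrite ux uy // ltr_norml; lra.
Qed.

End EpsFunction.

(** * The estimate for an invariant metric *)

Section MetricTheorem.
Context (R : realType) (r : nat) (X : ptopologicalType).
Variables (mu : probability (borelType X) R) (act : freeGroup r -> X -> X).
Variables (dd : X -> X -> R) (D : nat) (kappa : R).
Hypothesis r_gt1 : (1 < r)%N.
Hypothesis actP : is_action act.
Hypothesis dd0 : forall x, dd x x = 0.
Hypothesis dd_sym : forall x y, dd x y = dd y x.
Hypothesis dd_tri : forall x y z, dd x z <= dd x y + dd y z.
Hypothesis dd_nbhs : forall x (U : set X),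
  nbhs x U <-> exists2 e : R, 0 < e & forall y, dd x y < e -> U y.
Hypothesis dd_act : forall g x y, dd (act g x) (act g y) = dd x y.
Hypothesis act_mu : invariant_measure mu act.
Hypothesis mu_full : full_support mu.
Hypothesis kappa_gt0 : 0 < kappa.
Hypothesis kappaP : almost_inv_gap mu act kappa.
Variables (x0 : X) (c0 e0 : R).
Hypothesis c0_gt0 : 0 < c0.
Hypothesis e0_gt0 : 0 < e0.
Hypothesis dball_x0 : forall e, 0 < e <= e0 ->
  ((c0 * e ^+ D)%:E <= mu (dball dd x0 e))%E.
Variables (d : X -> X -> \bar R) (a : R).
Hypothesis a_gt0 : 0 < a.
Hypothesis dd_d : forall x y, 0 < dd x y < 1 ->
  ((d x y < +oo)%E /\ 0 < fine (d x y) <= dd x y) \/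
  ((d y x < +oo)%E /\ 0 < fine (d y x) <= dd x y).

Local Notation C := R[i].
Local Notation T := (borelType X).
Local Notation gap := (gap_size mu act).
Local Notation re f := (fun x => complex.Re (f x)).
Local Notation im f := (fun x => complex.Im (f x)).
Let act_meas : forall g, measurable_fun setT (act g : T -> T) :=
  measurable_act dd_nbhs dd_act.
Let dd_pos := dd_ge0 dd0 dd_sym dd_tri.

Let gap_gt0 : 0 < gap :=
  @gap_size_gt0 _ _ _ mu _ act r_gt1 actP act_meas act_mu _ kappa_gt0 kappaP.

Let gap01' : 0 <= gap <= 1.
Proof. by rewrite (ltW gap_gt0) (@gap_size_le1 _ _ _ mu _ act r_gt1 act_meas act_mu). Qed.

(** Passes from suprema in terms of [d] to pointwise bounds in terms of [dd]. Since [dd_d] compares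
    the two in only one of the two orders, a pair may have to be swapped. *)
Lemma holder_ball_bounds f : holder_ball d a f ->
  (forall x, cabs (f x) <= 1) /\
  (forall x y, dd x y < 1 -> cabs (f x - f y) <= dd x y `^ a).
Proof.
move=> [[cre cim]]; set s1 := ereal_sup _; set s2 := ereal_sup _ => s12.
have s1f x : ((cabs (f x))%:E <= s1)%E by apply: ereal_sup_ubound; exists x.
have s10 : (0 <= s1)%E by apply: le_trans (s1f point); rewrite lee_fin cabs_ge0.
have max0 : (0 <= maxe 0 s2)%E by rewrite /Order.max; case: ifPn => // /ltW.
have s2m : (s2 <= maxe 0 s2)%E by rewrite /Order.max; case: ifPn => //; rewrite -leNgt.
have s1_le1 : (s1 <= 1)%E by apply: le_trans s12; rewrite leeDl.
have s2_le1 : (s2 <= 1)%E.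
  by apply: le_trans s12; apply: le_trans s2m _; exact: leeDr.
split=> [x|]; first by rewrite -lee_fin (le_trans (s1f x)).
have key x y t : (d x y < +oo)%E -> 0 < fine (d x y) <= t -> x <> y ->
    cabs (f x - f y) <= t `^ a.
  move=> dxy /andP[d0 dt] xy; apply: (@le_trans _ _ (fine (d x y) `^ a)).
    rewrite -[leRHS]mul1r -ler_pdivrMr ?powR_gt0 // -lee_fin.
    by apply: le_trans s2_le1; apply: ereal_sup_ubound; exists x, y.
  by rewrite ge0_ler_powR ?nnegrE ?(ltW a_gt0) ?(ltW d0) // (le_trans (ltW d0)).
have cabsB x y : cabs (f x - f y) = cabs (f y - f x).
  by rewrite /cabs -opprB; case: (f y - f x) => p q /=; rewrite !sqrrN.
(* Points at [dd] zero are topologically indistinguishable, so [f] agrees on them by continuity. *)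
move=> x y xy1; have [dxy0|dxy0] := eqVneq (dd x y) 0.
  have H (h : X -> R) : continuous h -> h x = h y.
    move=> ch; apply/eqP; rewrite -subr_eq0 -normr_le0; apply/ler_addgt0Pr => e ep.
    have /cvgrPdist_lt/(_ e ep)/dd_nbhs[t t0 tP] := ch x.
    by rewrite add0r ltW // tP // dxy0.
  suff -> : f x = f y by rewrite subrr /cabs ComplexField.Normc.normc0 powR_ge0.
  by apply/eqP; rewrite eq_complex (H _ cre) (H _ cim) !eqxx.
have xy01 : 0 < dd x y < 1 by rewrite xy1 lt_neqAle eq_sym dxy0 dd_pos.
have xy : x <> y by move=> xy; move: dxy0; rewrite xy dd0 eqxx.
have [[]|[]] := dd_d xy01; first by move=> d1 d2; exact: key.
by move=> d1 d2; rewrite cabsB; apply: key => // yx; apply: xy.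
Qed.

Let weight_le1 : `|(r%:R - 1) / r%:R| <= 1 :> R.
Proof.
have r2 : 2 <= r%:R :> R by rewrite (ler_nat _ 2).
rewrite ger0_norm; last by rewrite divr_ge0 //; lra.
by rewrite ler_pdivrMr; lra.
Qed.

(** Covers both forms of [f0] over the reals: zero when the eigenspace is trivial, and otherwise a
    function with values 1 and -1. The last clause expresses that orthogonality to [u] amounts to
    orthogonality to all of [hepsR]. *)
Definition eps_function (u : X -> R) : Prop :=
  [/\ continuous u, forall g x, u (act g^-1%g x) = eps R g * u x,
   exists2 delta : R, 0 < delta & forall x y, dd x y < delta -> u x = u y,
   (forall x, u x ^+ 2 = 1) \/ (u = fun=> 0) &
   forall v : T -> R, sqint mu v -> \int[mu]_x v x = 0 -> ip mu v u = 0 ->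
     ortho1eps mu act v].

Lemma real_estimate u : eps_function u ->
  exists2 K : R, 0 <= K & forall f : X -> R, continuous f ->
    (forall x, `|f x| <= 1) ->
    (forall x y, dd x y < 1 -> `|f x - f y| <= dd x y `^ a) ->
    forall x n, `|ball_avg act (2 * n) f x - limit_real r mu u f x| <=
      K * expR (- (rate a r gap D * n%:R)).
Proof.
move=> [cu ue [delta d0 ud] u2 uc].
have u1 x : `|u x| <= 1.
  case: u2 => [u2|->]; last by rewrite normr0.
  by rewrite -(@ler_pXn2r _ 2) ?nnegrE // real_normK ?num_real // u2 expr1n.
(* Below [delta] the function [u] is constant, so the limit term drops out of differences; below 1
   the Hoelder bound is available. The sup bound used next is [3 = 1 + 2], for the average and the
   limit. *)
have d1 : 0 < Num.min delta 1 by rewrite lt_min d0 ltr01.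
have [K K0 KP] := @decay_sup _ _ _ mu act dd D kappa r_gt1 actP dd0 dd_sym dd_tri dd_nbhs
  dd_act act_mu mu_full kappa_gt0 kappaP x0 c0 e0 c0_gt0 e0_gt0 dball_x0
  a _ 1 3 55 gap a_gt0 d1 ler01 (ler0n _ 3) (ler0n _ 55) gap01'.
exists K => // f cf f1 fH x n.
have mf : measurable_fun setT (f : T -> R) by exact: continuous_borel.
have mu_ : measurable_fun setT (u : T -> R) by exact: continuous_borel.
have sf : sqint mu (f : T -> R) by apply: (@sqint_bounded _ _ _ _ _ 1).
have su : sqint mu (u : T -> R) by apply: (@sqint_bounded _ _ _ _ _ 1).
have nrm1 (h : T -> R) : measurable_fun setT h -> (forall x, `|h x| <= 1) -> nrm2 mu h <= 1.
  move=> mh h1; rewrite -[leRHS]normr1 -(nrm2_cst mu); apply: ler_nrm2 => // [y|].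
    by rewrite normr1.
  exact: sqint_cst.
have nf := nrm1 f mf f1; have nu := nrm1 u mu_ u1.
have iu : `|\int[mu]_x f x| <= 1.
  rewrite -ip1 (le_trans (ler_ip sf (sqint_cst mu 1))) //.
  by rewrite [X in _ * X]/nrm2 ip11 sqrtr1 mulr1.
have it : `|ip mu f u| <= 1.
  by rewrite (le_trans (ler_ip sf su)) // mulr_ile1 ?nrm2_ge0.
have L1 y : `|limit_real r mu u f y| <= 2.
  rewrite (le_trans (ler_normD _ _)) // (_ : 2 = 1 + 1 :> R) // lerD //.
  by rewrite !normrM mulr_ile1 ?mulr_ge0 // mulr_ile1 // -?normrM.
have hu : hepsR mu act u by split=> // g; apply: aeW => y; exact: ue.
have lH y z : dd y z < Num.min delta 1 -> limit_real r mu u f y = limit_real r mu u f z.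
  by rewrite lt_min => /andP[yz _]; rewrite /limit_real (ud _ _ yz).
have sF : sqint mu ((fun x => ball_avg act (2 * n) f x - limit_real r mu u f x) : T -> R).
  apply: sqintB; first exact: sqint_ball_avg.
  by apply: sqintD; [exact: sqint_cst|exact: sqintZ].
have [mF _] := sF.
apply: (KP (fun x => ball_avg act (2 * n) f x - limit_real r mu u f x)) => //.
- move=> y; have := ler_ball_avg act (2 * n) y f1; have := L1 y.
  by move=> h1 h2; rewrite (le_trans (ler_normB _ _)) //; lra.
- move=> y z yz; rewrite (lH _ _ yz) mul1r.
  rewrite (_ : _ - _ = ball_avg act (2 * n) f y - ball_avg act (2 * n) f z); last by ring.
  apply: (@ball_avg_lip _ _ _ _ dd (fun t => t `^ a)) => // y' z' yz'; rewrite -yz'.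
  by apply: fH; rewrite yz'; move: yz; rewrite lt_min => /andP[].
- apply: (@nrm2_ball_avg_limit _ _ _ mu act dd kappa) => //.
  case: u2 => [u2|->]; [left|by right].
  by case: (sqint_pm1 mu mu_ u2).
Qed.

Lemma Re_ball_average m (f : X -> C) x :
  complex.Re (ball_average act m f x) = ball_avg act m (re f) x.
Proof. by rewrite ball_avgE /ball_average natrCV ReMC Re_sum. Qed.

Lemma Im_ball_average m (f : X -> C) x :
  complex.Im (ball_average act m f x) = ball_avg act m (im f) x.
Proof. by rewrite ball_avgE /ball_average natrCV ImMC Im_sum. Qed.

(** The unit complex factor [c1 + i c2] cancels, since it enters once conjugated through the
    coefficient and once through the value; with [u] real, real and imaginary parts of [f] then
    separate. *)
Lemma limit_op_parts (c1 c2 : R) (u : T -> R) (f : T -> C) (x : T) : c1 ^+ 2 + c2 ^+ 2 = 1 ->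
  sqint mu u -> sqint mu (re f) -> sqint mu (im f) ->
  complex.Re (limit_op r mu (fun x => Complex (c1 * u x) (c2 * u x)) f x) =
    limit_real r mu u (re f) x /\
  complex.Im (limit_op r mu (fun x => Complex (c1 * u x) (c2 * u x)) f x) =
    limit_real r mu u (im f) x.
Proof.
move=> c12 su s1 s2; set f0 := fun x => _.
rewrite /limit_op (_ : L2dot _ _ _ = Complex (c1 * ip mu (re f) u + c2 * ip mu (im f) u)
    (c1 * ip mu (im f) u - c2 * ip mu (re f) u)); last first.
  have i1 := sqintM s1 su; have i2 := sqintM s2 su.
  congr Complex.
    rewrite -!RintegralZl // -RintegralD //; try exact: integrableR_Z.
    by apply: eq_Rintegral => y _; rewrite /f0; case: (f y) => p q /=; ring.
  rewrite -!RintegralZl // -RintegralB //; try exact: integrableR_Z.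
  by apply: eq_Rintegral => y _; rewrite /f0; case: (f y) => p q /=; ring.
have -> : (r%:R - 1) / r%:R = ((r%:R - 1) / r%:R : R)%:C%C :> C.
  by rewrite fmorph_div rmorphB rmorph1 rmorph_nat.
rewrite ReD ImD -!mulrA ReMC ImMC /f0 /limit_real /=.
set A := ip mu _ u; set B := ip mu _ u; set w := _ / _.
have -> : (c1 * A + c2 * B) * (c1 * u x) - (c1 * B - c2 * A) * (c2 * u x) =
  (c1 ^+ 2 + c2 ^+ 2) * (A * u x) by ring.
have -> : (c1 * A + c2 * B) * (c2 * u x) + (c1 * B - c2 * A) * (c1 * u x) =
  (c1 ^+ 2 + c2 ^+ 2) * (B * u x) by ring.
by rewrite c12 !mul1r; split; rewrite /limit_real -!mulrA.
Qed.

Lemma complex_estimate u : eps_function u ->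
  exists K : R, forall (c1 c2 : R), c1 ^+ 2 + c2 ^+ 2 = 1 ->
    forall f, holder_ball d a f -> forall x n,
    cabs (ball_average act (2 * n) f x -
      limit_op r mu (fun x => Complex (c1 * u x) (c2 * u x)) f x) <=
    K * expR (- (rate a r gap D * n%:R)).
Proof.
move=> hu; have [K K0 KP] := real_estimate hu.
exists (K + K) => c1 c2 c12 f hf x n.
have [f1 fH] := holder_ball_bounds hf; have [[cre cim] _] := hf.
have [cu _ _ u2 _] := hu.
have re1 y : `|complex.Re (f y)| <= 1 by rewrite (le_trans (Re_le_cabs _)).
have im1 y : `|complex.Im (f y)| <= 1 by rewrite (le_trans (Im_le_cabs _)).
have ReB z w : complex.Re (z - w) = complex.Re z - complex.Re w :> R.
  by case: z w => ? ? [].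
have ImB z w : complex.Im (z - w) = complex.Im z - complex.Im w :> R.
  by case: z w => ? ? [].
have reH y z : dd y z < 1 -> `|complex.Re (f y) - complex.Re (f z)| <= dd y z `^ a.
  by move=> yz; rewrite -ReB (le_trans (Re_le_cabs _)) // fH.
have imH y z : dd y z < 1 -> `|complex.Im (f y) - complex.Im (f z)| <= dd y z `^ a.
  by move=> yz; rewrite -ImB (le_trans (Im_le_cabs _)) // fH.
have sq (h : X -> R) : continuous h -> (forall x, `|h x| <= 1) -> sqint mu (h : T -> R).
  by move=> ch h1; apply: (@sqint_bounded _ _ _ _ _ 1) => //; exact: continuous_borel.
have su : sqint mu (u : T -> R).
  case: u2 => [u2|->]; last exact: sqint_cst.
  by apply: sq => // y; rewrite -(@ler_pXn2r _ 2) ?nnegrE // real_normK ?num_real // u2 expr1n.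
have [E1 E2] := limit_op_parts x c12 su (sq _ cre re1) (sq _ cim im1).
rewrite (le_trans (cabs_le _)) // ReB ImB E1 E2 Re_ball_average Im_ball_average mulrDl.
by rewrite lerD // KP.
Qed.

(** [u] takes opposite values at a point and at its translate by a letter, so on a connected space
    it would vanish somewhere. *)
Lemma eps_function_connected (u : X -> R) : continuous u -> (forall x, u x ^+ 2 = 1) ->
  (forall g x, u (act g^-1%g x) = eps R g * u x) -> ~ connected [set: X].
Proof.
move=> cu u2 ue cX; have i0 : 'I_r := Ordinal (ltnW r_gt1).
have cI : connected [set u x | x in [set: X]].
  by apply: connected_continuous_connected => //; exact: continuous_subspaceT.
have /connected_intervalP itvI := cI.
have uN : u (act (letter_elt (i0, true))^-1%g point) = - u point.
  by rewrite ue eps_letter mulN1r.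
have : [set u x | x in [set: X]] 0.
  case: (lerP 0 (u point)) => u0.
    apply: (itvI (- u point) (u point)); [by rewrite -uN; exists (act (letter_elt (i0, true))^-1%g point)|by exists point|].
    by rewrite oppr_le0 u0.
  apply: (itvI (u point) (- u point)); [by exists point|by rewrite -uN; exists (act (letter_elt (i0, true))^-1%g point)|].
  by rewrite oppr_ge0 (ltW u0).
case=> x _ ux; have := u2 x; rewrite ux expr0n /= => /eqP.
by rewrite eq_sym oner_eq0.
Qed.

Theorem metric_ball_average :
  [/\ 0 < gap, ball_average_estimate mu act d a (rate a r gap D) &
      connected [set: X] -> Heps_trivial mu act].
Proof.
have czero : ccontinuous (fun=> 0 : C) by split=> x /=; exact: cvg_cst.
have [triv|ntriv] := pselect (Heps_trivial mu act).
  split=> //.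
  have hu : eps_function (fun=> 0).
    split.
    - by move=> x; exact: cvg_cst.
    - by move=> g x /=; rewrite mulr0.
    - by exists 1.
    - by right.
    - move=> v sv v0 _; split=> // w hw; rewrite -[RHS](Rintegral_prob_cst mu 0).
      apply: eq_ae_Rintegral => //.
        by apply: measurable_funM; [case: sv|case: hw => -[]].
      by apply: ae_imp (triv _ (Heps_real hw)) => x [->]; rewrite mulr0.
  have [K KP] := complex_estimate hu.
  split; first by exists (fun=> 0); split=> //; left.
  exists K => f0 [_ [[_ ->]|[hf0 n1 _]]] f hf x n.
    have := KP 1 0 _ f hf x n; rewrite expr1n expr0n addr0 => /(_ erefl).
    rewrite (_ : (fun x => Complex (1 * 0) (0 * 0)) = fun=> 0) //.
    by apply/funext => y; rewrite !mulr0.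
  (* A unit generator is impossible here, as every element of [Heps] vanishes almost everywhere. *)
  exfalso; have [[s1 _] [s2 _]] := (HepsP mu act f0).1 hf0.
  have z (h : T -> R) : sqint mu h -> {ae mu, forall x, h x = 0} -> ip mu h h = 0.
    move=> sh h0; rewrite -[RHS](Rintegral_prob_cst mu 0).
    apply: eq_ae_Rintegral => //; first by apply: measurable_funM; case: sh.
    by apply: ae_imp h0 => y ->; rewrite mulr0.
  have f00 := triv _ hf0; move: n1; rewrite L2normE; last exact/L2P.
  rewrite !z ?addr0 ?sqrtr0 // => [/eqP||].
  - by rewrite eq_sym oner_eq0.
  - by apply: ae_imp f00 => y ->.
  - by apply: ae_imp f00 => y ->.
have /existsNP[f /not_implyP[hf nf]] := ntriv.
have [h1 h2] := (HepsP mu act f).1 hf.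
have [w hw w0] : exists2 w, hepsR mu act w & ip mu w w != 0.
  have [re0|re0] := eqVneq (ip mu (re f) (re f)) 0; last by exists (re f).
  have [im0|im0] := eqVneq (ip mu (im f) (im f)) 0; last by exists (im f).
  exfalso; apply: nf.
  have a1 := ip_eq0_ae h1.1 re0; have a2 := ip_eq0_ae h2.1 im0.
  by apply: ae_imp2 a1 a2 => x; case: (f x) => p q /= -> ->.
have [u [delta [del0 cu u2 ue ud]]] := @exists_eps_function _ _ _ mu act dd D kappa r_gt1
  actP dd0 dd_sym dd_tri dd_nbhs dd_act act_mu mu_full kappa_gt0 kappaP x0 c0 e0
  c0_gt0 e0_gt0 dball_x0 w hw w0.
have mu_ : measurable_fun setT (u : T -> R) by exact: continuous_borel.
have [su iu] := sqint_pm1 mu mu_ u2.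
have hu : hepsR mu act u by split=> // g; apply: aeW => x; exact: ue.
have Hu : eps_function u.
  split=> //; [by exists delta|by left|].
  by move=> v; exact: (heps_complete dd_nbhs dd_act act_mu kappa_gt0 kappaP hu u2).
have span := heps_span dd_nbhs dd_act act_mu kappa_gt0 kappaP hu u2.
split=> //; last by move=> cX; exfalso; exact: (eps_function_connected cu u2 ue cX).
have [K KP] := complex_estimate Hu.
split.
  exists (fun x => (u x)%:C%C); split; first by split=> // x; exact: cvg_cst.
  right; split; first exact: Heps_real.
    by rewrite L2norm_real // /nrm2 iu sqrtr1.
  move=> k hk; have [k1 k2] := (HepsP mu act k).1 hk.
  have [c1 c1P] := span _ k1; have [c2 c2P] := span _ k2.
  exists (Complex c1 c2); apply: ae_imp2 c1P c2P => x e1 e2.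
  by apply/eqP; rewrite eq_complex e1 e2 /= !mulr0 subr0 add0r !eqxx.
(* Every admissible [f0] is a unit complex multiple of [u]: almost everywhere by the span, then
   everywhere by continuity. *)
exists K => f0 [[cre cim] [[//]|[hf0 n1 _]]] g hg x n.
have [k1 k2] := (HepsP mu act f0).1 hf0.
have [c1 c1P] := span _ k1; have [c2 c2P] := span _ k2.
have cc c : continuous (fun x => c * u x : R).
  by move=> y; apply: cvgM; [exact: cvg_cst|exact: cu].
have E1 := ae_continuous_eq mu_full cre (cc c1) c1P.
have E2 := ae_continuous_eq mu_full cim (cc c2) c2P.
have f0E : f0 = fun x => Complex (c1 * u x) (c2 * u x).
  apply/funext => y; have := congr1 (fun h => h y) E1; have := congr1 (fun h => h y) E2.
  by case: (f0 y) => p q /= -> ->.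
rewrite f0E; apply: KP => //.
move: n1; rewrite L2normE; last by apply/L2P; case: k1; case: k2.
have ic (c : R) : ip mu (fun x => c * u x) (fun x => c * u x) = c ^+ 2.
  rewrite -sqr_nrm2 nrm2Z // exprMn real_normK ?num_real // sqr_nrm2.
  by rewrite iu mulr1.
rewrite E1 E2 !ic => n1; rewrite -[LHS]sqr_sqrtr ?n1 ?expr1n //.
by rewrite addr_ge0 ?sqr_ge0.
Qed.

End MetricTheorem.

(** * Profinite completions *)

Section Density.
Import HBSimple HBNNSimple.
Context (disp : measure_display) (T : measurableType disp) (R : realType).
Variables (mu : probability T R) (V : set (T -> R)).
Implicit Types (f h : T -> R) (A : set T).

Hypothesis V_sqint : forall h, V h -> sqint mu h.
Hypothesis V1 : V (fun=> 1).
Hypothesis VD : forall h k, V h -> V k -> V (fun x => h x + k x).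
Hypothesis VZ : forall c h, V h -> V (fun x => c * h x).

Definition L2_approx f : Prop := forall e : R, 0 < e -> exists2 h, V h &
  ip mu (fun x => f x - h x) (fun x => f x - h x) <= e.

Lemma ip_le2 f h k : measurable_fun setT f -> sqint mu h -> sqint mu k ->
  (forall x, f x = h x + k x) -> ip mu f f <= 3 * (ip mu h h + ip mu k k).
Proof.
move=> mf sh sk fE.
have := @ip_le3 _ _ _ mu f h k (fun=> 0) mf sh sk (sqint_cst mu 0).
rewrite [X in _ + _ + X](_ : _ = 0); last by rewrite /ip mulr0 Rintegral_prob_cst.
rewrite addr0; apply=> x; rewrite fE expr0n addr0.
by have := sqr_ge0 (h x - k x); nra.
Qed.

Lemma V_approx h : V h -> L2_approx h.
Proof.
move=> Vh e e0; exists h => //; rewrite (_ : ip _ _ _ = 0) ?(ltW e0) //.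
rewrite -[RHS](Rintegral_prob_cst mu 0); apply: eq_Rintegral => x _.
by rewrite subrr mulr0.
Qed.

Lemma approxD f h : sqint mu f -> sqint mu h -> L2_approx f -> L2_approx h ->
  L2_approx (fun x => f x + h x).
Proof.
move=> sf sh af ah e e0; have e6 : 0 < e / 6 by exact: divr_gt0.
have [f' Vf' f'e] := af _ e6; have [h' Vh' h'e] := ah _ e6.
have [sf' sh'] := (V_sqint Vf', V_sqint Vh').
exists (fun x => f' x + h' x); first exact: VD.
apply: (@le_trans _ _ (3 * (ip mu (fun x => f x - f' x) (fun x => f x - f' x) +
  ip mu (fun x => h x - h' x) (fun x => h x - h' x)))); last by lra.
apply: ip_le2 => [|||x]; try exact: sqintB; last by ring.
by apply: measurable_funB; [case: (sqintD sf sh)|case: (sqintD sf' sh')].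
Qed.

Lemma approxZ c f : sqint mu f -> L2_approx f -> L2_approx (fun x => c * f x).
Proof.
move=> sf af e e0; have c0 : 0 < c ^+ 2 + 1 by rewrite ltr_wpDl // sqr_ge0.
have [h Vh he] := af _ (divr_gt0 e0 c0); have sh := V_sqint Vh.
exists (fun x => c * h x); first exact: VZ.
have -> : (fun x => c * f x - c * h x) = fun x => c * (f x - h x).
  by apply/funext => x; rewrite mulrBr.
have sd : sqint mu (fun x => f x - h x) by exact: sqintB.
rewrite -sqr_nrm2 nrm2Z // exprMn real_normK ?num_real // sqr_nrm2.
move: he; rewrite ler_pdivlMr // => /(le_trans _); apply.
by rewrite mulrC ler_wpM2l ?ip_ge0 // lerDl.
Qed.

Lemma approx_sum (I : Type) (s : seq I) (F : I -> T -> R) :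
  (forall i, sqint mu (F i)) -> (forall i, L2_approx (F i)) ->
  L2_approx (fun x => \sum_(i <- s) F i x).
Proof.
move=> sF aF; elim: s => [|i s IH].
  have := V_approx (VZ 0 V1); congr L2_approx; apply/funext => x.
  by rewrite big_nil mul0r.
under eq_fun do rewrite big_cons.
by apply: approxD => //; exact: sqint_sum.
Qed.

(** Dominated convergence with majorant [4 g^2] makes some [F n] close to [f], and that [F n] is
    approximated in turn. *)
Lemma approx_lim (F : nat -> T -> R) f g : sqint mu g -> sqint mu f ->
  (forall n, measurable_fun setT (F n)) -> (forall n, L2_approx (F n)) ->
  (forall n x, `|F n x| <= `|g x|) ->
  (forall x, (fun n => F n x) @ \oo --> f x) -> L2_approx f.
Proof.
move=> sg sf mF aF Fg Ff e e0.
have sF n : sqint mu (F n) by exact: sqint_le (mF n) (Fg n) sg.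
have fg x : `|f x| <= `|g x|.
  rewrite ler_norml; apply/andP; split; [apply: (ler_cvg_to (cvg_cst _) (Ff x))|
    apply: (ler_cvg_to (Ff x) (cvg_cst _))]; apply: nearW => n;
  by have := Fg n x; rewrite ler_norml => /andP[].
pose h n x := (f x - F n x) * (f x - F n x).
have sd n : sqint mu (fun x => f x - F n x) by exact: sqintB.
have [||||| _ _ +] := @dominated_convergence _ T R mu setT measurableT
  (fun n x => (h n x)%:E) (fun=> 0%E) (EFin \o (fun x => 4 * (g x * g x))).
- move=> n; apply/measurable_EFinP.
  by apply: measurable_funM; case: (sd n).
- exact: measurable_cst.
- apply: aeW => x _; apply: cvg_EFin; first exact: nearW.
  have c0 : (fun n => f x - F n x) @ \oo --> (0 : R).
    by rewrite -(subrr (f x)); apply: cvgB (Ff x); exact: cvg_cst.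
  rewrite -[X in _ --> X](mulr0 0); exact: (cvgM c0 c0).
- by apply: integrableR_Z; exact: sqintM.
- apply: aeW => x n _; rewrite /h /= lee_fin ger0_norm -?expr2 ?sqr_ge0 //.
  have -> : 4 * g x ^+ 2 = (2 * `|g x|) ^+ 2.
    by rewrite exprMn real_normK ?num_real //; ring.
  rewrite -[leLHS]real_normK ?num_real // lerXn2r ?nnegrE ?mulr_ge0 //.
  by rewrite (le_trans (ler_normB _ _)) //; have := Fg n x; have := fg x; lra.
have hE n : (\int[mu]_x (h n x)%:E)%E =
    (ip mu (fun x => f x - F n x) (fun x => f x - F n x))%:E.
  rewrite /ip /Rintegral fineK //; apply: integrable_fin_num => //.
  exact: (sqintM (sd n) (sd n)).
under eq_fun do rewrite hE.
rewrite integral0 => /fine_cvg /= /cvgrPdist_lt/(_ (e / 6)).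
rewrite divr_gt0 // => /(_ isT) [n _ /(_ n (leqnn n))] /=.
rewrite sub0r normrN ger0_norm ?ip_ge0 // => ne.
have e6 : 0 < e / 6 by exact: divr_gt0.
have [h' Vh' h'e] := aF n _ e6; have sh' := V_sqint Vh'.
exists h' => //.
apply: (@le_trans _ _ (3 * (ip mu (fun x => f x - F n x) (fun x => f x - F n x) +
  ip mu (fun x => F n x - h' x) (fun x => F n x - h' x)))); last by lra.
apply: ip_le2 => [|||x]; try exact: sqintB; last by ring.
by case: (sqintB sf sh').
Qed.

Lemma sqint_indic A : measurable A -> sqint mu (\1_A : T -> R).
Proof.
move=> mA; apply: (@sqint_bounded _ _ _ _ _ 1) => [|x]; first exact: measurable_indic.
by rewrite indicE; case: (_ \in _); rewrite ?normr1 ?normr0.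
Qed.

(** Dynkin's theorem: approximability passes to complements, and to disjoint unions because partial
    sums of the indicators stay bounded by 1. *)
Lemma approx_indic (G : set (set T)) : measurable = <<s G >> -> setI_closed G ->
  (forall A, G A -> L2_approx (\1_A : T -> R)) ->
  forall A, measurable A -> L2_approx (\1_A : T -> R).
Proof.
move=> mG GI aG A mA.
apply: (@dynkin_induction _ T G (fun A => L2_approx (\1_A : T -> R))) => //.
- have := V_approx V1; congr L2_approx; apply/funext => x.
  by rewrite indicE mem_set.
- move=> B mB aB; have := approxD (sqint_cst mu 1) (sqintZ (-1) (sqint_indic mB))
    (V_approx V1) (approxZ (-1) (sqint_indic mB) aB).
  congr L2_approx; apply/funext => x; rewrite !indicE in_setC.
  by case: (x \in B); rewrite ?mulr1 ?mulr0 ?subrr ?addr0.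
- move=> F mF tF aF.
  have mU : measurable (\bigcup_k F k) by exact: bigcup_measurable.
  apply: (@approx_lim (fun n x => \sum_(0 <= k < n) \1_(F k) x) _ (fun=> 1)).
  + exact: sqint_cst.
  + exact: sqint_indic.
  + by move=> n; apply: measurable_sum => k; exact: measurable_indic.
  + by move=> n; apply: approx_sum => k //; exact: sqint_indic.
  + move=> n x; rewrite normr1 ger0_norm; last by apply: sumr_ge0 => k _; rewrite indicE.
    have [[k /= kn Fkx]|nF] := pselect (exists2 k, (k < n)%N & F k x); last first.
      rewrite big_mkord big1 // => k _; rewrite indicE memNset // => Fkx.
      by apply: nF; exists k.
    rewrite big_mkord (bigD1 (Ordinal kn)) //= big1 ?addr0.
      by rewrite indicE; case: (_ \in _).
    move=> j jk; rewrite indicE memNset // => Fjx.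
    move/eqP: jk; apply; apply: val_inj => /=.
    by apply: (tF j k) => //; exists x.
  + move=> x; rewrite [X in _ --> X]indicE.
    have [/set_mem[k _ Fkx]|xF] := boolP (x \in _).
      apply: cvg_near_cst; exists k.+1 => // n /= kn.
      rewrite big_mkord (bigD1 (Ordinal kn)) //= big1 ?addr0.
        by rewrite indicE mem_set.
      move=> j jk; rewrite indicE memNset // => Fjx.
      move/eqP: jk; apply; apply: val_inj => /=.
      by apply: (tF j k) => //; exists x.
    apply: cvg_near_cst; exists 0%N => // n _.
    rewrite big1 // => j _; rewrite indicE memNset // => Fjx.
    by move/negP: xF; apply; apply: mem_set; exists j.
- by rewrite -mG.
Qed.

(** A nonnegative function is a monotone limit of simple functions; the general case uses positive
    and negative parts. *)
Lemma approx_sqint : (forall A, measurable A -> L2_approx (\1_A : T -> R)) ->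
  forall f, sqint mu f -> L2_approx f.
Proof.
move=> aI.
have pos f : sqint mu f -> (forall x, 0 <= f x) -> L2_approx f.
  move=> sf f0; have mf : measurable_fun setT (EFin \o f).
    by apply/measurable_EFinP; case: sf.
  have [g [gnd gcvg]] := approximation measurableT mf (fun x _ => f0 x).
  have gc x : (fun n => g n x) @ \oo --> f x.
    exact: (fine_cvg (gcvg x Logic.I)).
  have gle n x : g n x <= f x.
    have nd : nondecreasing_seq (fun n => g n x).
      by move=> i j ij; have /lefP := gnd i j ij; exact.
    have := nondecreasing_cvgn_le nd (cvgP _ (gc x)) n.
    by rewrite (cvg_lim _ (gc x)).
  apply: (@approx_lim (fun n => g n) f f) => // n.
    have -> : (g n : T -> R) = fun x =>
        \sum_(y <- fset_set (range (g n))) y * \1_(g n @^-1` [set y]) x.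
      by apply/funext => x; rewrite fimfunE fsbig_finite.
    have mgy y : measurable (g n @^-1` [set y]).
      by rewrite -[X in measurable X]setTI; exact: measurable_funP.
    apply: approx_sum => y; first by apply: sqintZ; exact: sqint_indic.
    by apply: approxZ; [exact: sqint_indic|exact: aI].
  by move=> x; rewrite !ger0_norm.
move=> f sf; pose fp x := Num.max (f x) 0; pose fm x := Num.max (- f x) 0.
have sfp : sqint mu fp.
  apply: (sqint_le _ _ sf) => [|x].
    by apply: measurable_maxr => //; case: sf.
  by rewrite /fp; case: (leP (f x) 0) => h; rewrite ?normr0 ?normr_ge0 ?lexx.
have sfm : sqint mu fm.
  apply: (sqint_le _ _ sf) => [|x].
    by apply: measurable_maxr => //; case: (sqintN sf).
  by rewrite /fm; case: (leP (- f x) 0) => h; rewrite ?normr0 ?normr_ge0 ?normrN ?lexx.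
have fE : f = fun x => fp x + (-1) * fm x.
  by apply/funext => x; rewrite /fp /fm; case: (leP (f x) 0); case: (leP (- f x) 0); lra.
rewrite fE; apply: approxD => //; first exact: sqintZ.
- by apply: pos => // x; rewrite le_max lexx orbT.
- apply: approxZ => //; apply: pos => // x.
  by rewrite le_max lexx orbT.
Qed.

End Density.

(** * The metric of a profinite completion *)

Section ProfiniteMetric.
Variables (R : realType) (r : nat) (Gam : subgroupChain r).
Local Notation X := (profinite Gam).
Local Notation act := (@profinite_act r Gam).
Local Notation N i := (index_in setT (Gam i)).
Local Notation cosets i := (fset_set (lcosets_in setT (Gam i))).
Implicit Types (x y z : X) (i j : nat).

Lemma profinite_eq x y : (forall i, x i = y i) -> x = y.
Proof.
case: x y => [x cx] [y cy] /= /funext xy; case: _ / xy cy => cy.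
by congr Profinite; exact: Prop_irrelevance.
Qed.

Lemma profinite_actP : is_action act.
Proof.
split=> [x|g h x]; apply: profinite_eq => i /=.
  by rewrite /ltrans eqEsubset; split=> g; [case=> h xh <-|exists g]; rewrite ?mul1g.
by rewrite ltransA.
Qed.

Lemma mem_cosets i c : (c \in cosets i) <-> lcosets_in setT (Gam i) c.
Proof.
rewrite in_fset_set; last exact: chain_finite_index.
by split=> [/set_mem|/mem_set].
Qed.

Lemma proj_cosets x i : x i \in cosets i.
Proof. by apply/mem_cosets; case: (proj_compatible x i). Qed.

Lemma exists_proj i c : c \in cosets i -> exists x : X, x i = c.
Proof.
move=> /mem_cosets[h _ <-]; exists (act h point); rewrite /= ltransA mulg1 //.
Qed.

Lemma index_gt0 i : (0 < N i)%N.
Proof. by rewrite cardfs_gt0; apply/fset0Pn; exists ((point : X) i); exact: proj_cosets. Qed.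

Lemma proj_transitive x y i : exists g, act g x i = y i.
Proof.
have [[h _ xh] _] := proj_compatible x i; have [[k _ yk] _] := proj_compatible y i.
by exists (k * h^-1)%g; rewrite /= -xh -yk ltransA -mulgA mulVg mulg1.
Qed.

(** The projection of cosets from level [j] to level [i], obtained by lifting a coset to a point of
    the completion; for [i <= j], [proj_eq_le] makes it independent of the lift. *)
Definition coset_proj i j (c : set (freeGroup r)) : set (freeGroup r) :=
  (xget point [set x : X | x j = c]) i.

Lemma coset_projE i j x : (i <= j)%N -> coset_proj i j (x j) = x i.
Proof.
move=> ij; rewrite /coset_proj; case: xgetP => [y _ yx|/(_ x)/(_ erefl)//].
exact: proj_eq_le ij yx.
Qed.

Lemma cosets_image i j : (i <= j)%N -> cosets i = (coset_proj i j @` cosets j)%fset.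
Proof.
move=> ij; apply/fsetP => c; apply/idP/imfsetP => [/exists_proj[x <-]|[k kj ->]].
  by exists (x j); [exact: proj_cosets|rewrite coset_projE].
by have [x <-] := exists_proj kj; rewrite coset_projE // proj_cosets.
Qed.

Lemma index_mono i j : (i <= j)%N -> (N i <= N j)%N.
Proof. by move=> ij; rewrite {1}/index_in (cosets_image ij) leq_imfset_card. Qed.

(** Subgroups may repeat in the chain. Equal indices make the surjection between the finite coset
    sets injective. *)
Lemma index_eq_proj i j x y : (i <= j)%N -> N i = N j -> x i = y i -> x j = y j.
Proof.
move=> ij Nij xy; have /card_in_imfsetP inj :
    #|` (coset_proj i j @` cosets j)%fset| == #|` cosets j|.
  by rewrite -cosets_image //; exact/eqP.
by apply: inj; rewrite ?proj_cosets // !coset_projE.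
Qed.

Definition pdist x y : R := sup [set (N i)%:R^-1 | i in [set i | x i <> y i]].

Lemma invN_gt0 i : 0 < (N i)%:R^-1 :> R.
Proof. by rewrite invr_gt0 ltr0n index_gt0. Qed.

Lemma invN_le1 i : (N i)%:R^-1 <= 1 :> R.
Proof. by rewrite invf_le1 ?ltr0n ?index_gt0 // ler1n index_gt0. Qed.

Lemma invN_anti i j : (i <= j)%N -> (N j)%:R^-1 <= (N i)%:R^-1 :> R.
Proof. by move=> ij; rewrite lef_pV2 ?posrE ?ltr0n ?index_gt0 // ler_nat index_mono. Qed.

(** Indices do not decrease along the chain, so the supremum is attained at the first level where
    the points differ. *)
Lemma pdist_spec x y : (x = y /\ pdist x y = 0) \/
  exists j, x j <> y j /\ pdist x y = (N j)%:R^-1.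
Proof.
have [[i0 xy0]|nxy] := pselect (exists i, x i <> y i); last first.
  left; have xy : x = y.
    by apply: profinite_eq => i; apply: contrapT => xy; apply: nxy; exists i.
  split=> //; rewrite /pdist (_ : [set i | _] = set0) ?image_set0 ?sup0 //.
  by rewrite -subset0 xy => i.
right; have ex : exists i, `[< x i <> y i >] by exists i0; exact/asboolP.
exists (ex_minn ex); case: ex_minnP => j /asboolP xyj jmin; split=> //.
apply/eqP; rewrite eq_le; apply/andP; split.
  apply: ge_sup => [|_ [i xyi <-]]; first by exists (N j)%:R^-1, j.
  by apply: invN_anti; apply: jmin; exact/asboolP.
apply: sup_upper_bound; last by exists j.
split; first by exists (N j)%:R^-1, j.
by exists 1 => _ [i _ <-]; exact: invN_le1.
Qed.

Lemma invN_le_pdist x y i : x i <> y i -> (N i)%:R^-1 <= pdist x y.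
Proof.
move=> xy; apply: sup_upper_bound; last by exists i.
split; first by exists (N i)%:R^-1, i.
by exists 1 => _ [j _ <-]; exact: invN_le1.
Qed.

Lemma pdist_lt x y (e : R) : 0 < e ->
  (pdist x y < e) <-> (forall j, x j <> y j -> (N j)%:R^-1 < e).
Proof.
move=> e0; split=> [xye j /invN_le_pdist xyj|H]; first exact: le_lt_trans xye.
by have [[_ ->]|[j [/H ? ->]]] := pdist_spec x y.
Qed.

Lemma pdist_refl x : pdist x x = 0.
Proof. by have [[]|[j [/(_ erefl)]]] := pdist_spec x x. Qed.

Lemma pdist_sym x y : pdist x y = pdist y x.
Proof.
by congr sup; congr image; apply/seteqP; split=> i /= xy yx; apply: xy.
Qed.

Lemma pdist_ge0 x y : 0 <= pdist x y.
Proof.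
by have [[_ ->]|[j [_ ->]]] := pdist_spec x y; rewrite ?lexx // ltW // invN_gt0.
Qed.

Lemma pdist_triangle x y z : pdist x z <= pdist x y + pdist y z.
Proof.
have [[_ ->]|[j [xz ->]]] := pdist_spec x z; first by rewrite addr_ge0 ?pdist_ge0.
have [xy|/invN_le_pdist xy] := pselect (x j = y j).
  have /invN_le_pdist yz : y j <> z j by rewrite -xy.
  by rewrite (le_trans yz) // lerDr pdist_ge0.
by rewrite (le_trans xy) // lerDl pdist_ge0.
Qed.

Lemma pdist_act g x y : pdist (act g x) (act g y) = pdist x y.
Proof.
congr sup; congr image; apply/seteqP; split=> i /= xy E; apply: xy.
  by rewrite E.
have := congr1 (ltrans g^-1%g) E; rewrite !ltransA mulVg.
have [+ _] := profinite_actP; move=> a1.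
have := congr1 (fun z : X => z i) (a1 x); have := congr1 (fun z : X => z i) (a1 y).
by move=> /= -> ->.
Qed.

(** The levels with [e <= 1 / N] have index at most [1 / e], but there may be infinitely many of
    them when the chain is stationary. One of largest index determines all the others, by
    [index_eq_proj]. *)
Lemma exists_level (e : R) : 0 < e -> (forall i, (N i)%:R^-1 < e) \/
  exists i, e <= (N i)%:R^-1 /\
    forall x y, x i = y i -> forall j, e <= (N j)%:R^-1 -> x j = y j.
Proof.
move=> e0; have [[i0 ei0]|ne] := pselect (exists i, e <= (N i)%:R^-1); last first.
  by left=> i; rewrite ltNge; apply/negP => ei; apply: ne; exists i.
right; have eN i : e <= (N i)%:R^-1 <-> (N i <= Num.truncn (e^-1))%N.
  rewrite truncn_ge_nat ?invr_ge0 ?(ltW e0) //.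
  by rewrite -[e in e <= _]invrK lef_pV2 ?posrE ?invr_gt0 // ltr0n index_gt0.
have ex : exists m, `[< exists i, N i = m /\ e <= (N i)%:R^-1 >].
  by exists (N i0); apply/asboolP; exists i0.
have ub m : `[< exists i, N i = m /\ e <= (N i)%:R^-1 >] -> (m <= Num.truncn (e^-1))%N.
  by move=> /asboolP[i [<- /eN]].
case: (ex_maxnP ex ub) => m /asboolP[i [Ni ei]] mmax.
exists i; split=> // x y xyi j ej.
have [ij|/ltnW ji] := leqP i j; last exact: proj_eq_le ji xyi.
apply: (index_eq_proj ij) xyi; apply/eqP; rewrite eqn_leq index_mono //= Ni.
by apply: mmax; apply/asboolP; exists j.
Qed.

Lemma nbhs_pdist x (U : set X) :
  nbhs x U <-> exists2 e : R, 0 < e & forall y, pdist x y < e -> U y.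
Proof.
split=> [|[e e0 eU]].
  rewrite nbhsE => -[A [oA Ax] AU]; have [i iA] := oA x Ax.
  exists (N i)%:R^-1; first exact: invN_gt0.
  move=> y xy; apply: AU; apply: iA; apply: contrapT => yx.
  have /invN_le_pdist : x i <> y i by move=> E; apply: yx.
  by rewrite leNgt xy.
rewrite nbhsE; exists [set y | pdist x y < e]; last by move=> y; exact: eU.
split; last by rewrite /= pdist_refl.
move=> y xy; have [H|[i [ei H]]] := exists_level e0.
  by exists 0%N => z _; apply/pdist_lt.
exists i => z zy; apply/(pdist_lt _ _ e0) => j xz.
have [xyj|xyj] := pselect (x j = y j); last exact: (pdist_lt _ _ e0).1 xy _ xyj.
rewrite ltNge; apply/negP => ej; apply: xz; rewrite xyj.
by rewrite -(H z y zy j ej).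
Qed.

End ProfiniteMetric.

(** * Invariant measure and spectral gap on a profinite completion *)

Section ProfiniteMeasure.
Variables (R : realType) (r : nat) (Gam : subgroupChain r).
Local Notation X := (profinite Gam).
Local Notation T := (borelType X).
Local Notation act := (@profinite_act r Gam).
Local Notation N i := (index_in setT (Gam i)).
Local Notation cosets i := (fset_set (lcosets_in setT (Gam i))).
Local Notation pd := (@pdist R r Gam).
Variable mu : probability T R.
Hypothesis act_mu : invariant_measure mu act.
Implicit Types (x y z : X) (i j : nat).

Definition fibre i c : set X := [set y | y i = c].

Lemma open_fibre i c : open (fibre i c).
Proof. by move=> x xi; exists i => y yx; rewrite /fibre /= yx. Qed.

Lemma measurable_fibre i c : measurable (fibre i c : set T).
Proof. by apply: measurable_open; exact: open_fibre. Qed.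

(** The free group acts transitively on each finite quotient, so invariance under it already
    equidistributes the fibres of a level. *)
Lemma mu_fibre_eq i x y : mu (fibre i (x i)) = mu (fibre i (y i)).
Proof.
have [g gx] := proj_transitive x y i.
rewrite -(act_mu g (measurable_fibre i (y i))); congr (mu _).
rewrite -gx; apply/seteqP; split=> z; rewrite /fibre /= => E; first by rewrite E.
have [a1 _] := profinite_actP Gam; have := congr1 (ltrans g^-1%g) E.
rewrite !ltransA mulVg; have := congr1 (fun z : X => z i) (a1 x).
by have := congr1 (fun z : X => z i) (a1 z) => /= -> ->.
Qed.

Lemma proj_indic (w : set (freeGroup r) -> R) i x :
  w (x i) = \sum_(c <- cosets i) w c * \1_(fibre i c) x.
Proof.
rewrite (big_fsetD1 (x i)) ?proj_cosets //= indicE mem_set // mulr1.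
rewrite big1_seq ?addr0 // => c; rewrite !inE => /andP[_ /andP[cx _]].
by rewrite indicE memNset ?mulr0 // => E; move: cx; rewrite -E eqxx.
Qed.

Lemma fine_mu_fibre i x : fine (mu (fibre i (x i))) = (N i)%:R^-1.
Proof.
have E : \int[mu]_y (1 : R) = \sum_(c <- cosets i) fine (mu (fibre i (x i))).
  transitivity (ip mu (fun y : T => \sum_(c <- cosets i) \1_(fibre i c) y) (fun=> 1)).
    rewrite ip1; apply: eq_Rintegral => y _.
    rewrite (proj_indic (fun=> 1) i y); apply: eq_bigr => c _; exact: mul1r.
  rewrite ip_suml; [|by move=> c; apply: sqint_indic; exact: measurable_fibre|exact: sqint_cst].
  apply: eq_big_seq => c /exists_proj[y <-].
  rewrite ip1 /Rintegral integral_indic //; last exact: measurable_fibre.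
  by rewrite setIT; congr fine; exact: mu_fibre_eq.
move: E; rewrite Rintegral_prob_cst big_const_seq count_predT iter_addr_0.
rewrite -[_ *+ _]mulr_natr => /esym/(canRL (mulfK _)) ->.
  by rewrite div1r.
by rewrite pnatr_eq0 -lt0n index_gt0.
Qed.

Lemma mu_fibre i x : mu (fibre i (x i)) = ((N i)%:R^-1)%:E.
Proof. by rewrite -(fine_mu_fibre i x) fineK // fin_num_measure //; exact: measurable_fibre. Qed.

Lemma sqint_proj (w : set (freeGroup r) -> R) i : sqint mu (fun x : T => w ((x : X) i)).
Proof.
rewrite (_ : (fun x => _) = fun x => \sum_(c <- cosets i) w c * \1_(fibre i c) x).
  by apply: sqint_sum => c; apply: sqintZ; apply: sqint_indic; exact: measurable_fibre.
by apply/funext => x; exact: proj_indic.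
Qed.

Lemma Rintegral_proj (w : set (freeGroup r) -> R) i :
  \int[mu]_x w ((x : X) i) = (N i)%:R^-1 * \sum_(c <- cosets i) w c.
Proof.
transitivity (ip mu (fun x : T => \sum_(c <- cosets i) w c * \1_(fibre i c) x) (fun=> 1)).
  by rewrite ip1; apply: eq_Rintegral => x _; exact: proj_indic.
have sI c : sqint mu (\1_(fibre i c) : T -> R).
  by apply: sqint_indic; exact: measurable_fibre.
rewrite ip_suml; [|by move=> c; exact: sqintZ|exact: sqint_cst].
rewrite mulr_sumr; apply: eq_big_seq => c /exists_proj[y <-].
rewrite ipZl //; last exact: sqint_cst.
rewrite ip1 /Rintegral integral_indic //; last exact: measurable_fibre.
by rewrite setIT [RHS]mulrC; congr (_ * _); exact: fine_mu_fibre.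
Qed.

Lemma profinite_full_support : full_support mu.
Proof.
move=> U oU [x Ux]; have [i iU] := oU x Ux.
apply: (@lt_le_trans _ _ (mu (fibre i (x i)))).
  by rewrite mu_fibre lte_fin invN_gt0.
apply: le_measure; [|by apply: mem_set; exact: measurable_open|].
  by apply: mem_set; exact: measurable_fibre.
by move=> y; exact: iU.
Qed.

(** Unless the ball is everything, it contains a fibre of a level given by [exists_level], whose
    measure [1 / N] is at least [e]; hence dimension 1 and constant 1. *)
Lemma profinite_dball x (e : R) : 0 < e <= 1 ->
  ((1 * e ^+ 1)%:E <= mu (dball pd x e))%E.
Proof.
move=> /andP[e0 e1]; rewrite mul1r expr1.
have mB : measurable (dball pd x e : set T).
  apply: measurable_dball; [exact: pdist_triangle|exact: nbhs_pdist].
have [H|[i [ei H]]] := @exists_level R r Gam e e0.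
  rewrite (_ : dball pd x e = setT); last first.
    by apply/seteqP; split=> y // _; apply/(pdist_lt _ _ e0) => j _; exact: H.
  by rewrite (@probability_setT _ _ _ mu) lee_fin.
apply: (@le_trans _ _ (mu (fibre i (x i)))); first by rewrite mu_fibre lee_fin.
apply: le_measure; [|exact: mem_set|].
  by apply: mem_set; exact: measurable_fibre.
move=> y yx; apply/(pdist_lt _ _ e0) => j xy; rewrite ltNge; apply/negP => ej.
by apply: xy; rewrite (H y x yx j ej).
Qed.

Definition cylinder_functions : set (T -> R) :=
  [set f | exists i (w : set (freeGroup r) -> R), f = fun x : T => w ((x : X) i)].

(** It is enough to treat indicators of open sets [U]. At level [n] keep the fibres contained in
    [U]; since fibres form a basis, these indicators converge to that of [U]. *)
Lemma cylinder_dense (f : T -> R) : sqint mu f -> L2_approx mu cylinder_functions f.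
Proof.
have V_sq h : cylinder_functions h -> sqint mu h by case=> i [w ->]; exact: sqint_proj.
have V1 : cylinder_functions (fun=> 1) by exists 0%N, (fun=> 1).
have VD h k : cylinder_functions h -> cylinder_functions k ->
    cylinder_functions (fun x => h x + k x).
  move=> [i [w ->]] [j [v ->]].
  exists (maxn i j), (fun c => w (coset_proj Gam i (maxn i j) c) + v (coset_proj Gam j (maxn i j) c)).
  by apply/funext => x; rewrite !coset_projE ?leq_maxl ?leq_maxr.
have VZ c h : cylinder_functions h -> cylinder_functions (fun x => c * h x).
  by move=> [i [w ->]]; exists i, (fun k => c * w k).
apply: approx_sqint => //; apply: (@approx_indic _ T R mu cylinder_functions V_sq V1 VD VZ (@open X)) => //.
  by move=> A B; exact: openI.
move=> U oU; have mU : measurable (U : set T) by exact: measurable_open.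
pose w n c : R := if `[< fibre n c `<=` U >] then 1 else 0.
apply: (@approx_lim _ T R mu cylinder_functions V_sq (fun n (x : T) => w n ((x : X) n)) _ (fun=> 1)) => //.
- exact: sqint_cst.
- exact: sqint_indic.
- by move=> n; case: (sqint_proj (w n) n).
- by move=> n; apply: V_approx; exists n, (w n).
- by move=> n x; rewrite /w; case: ifP; rewrite ?normr1 ?normr0.
- move=> x; rewrite indicE; have [/set_mem Ux|Ux] := boolP (x \in U).
    have [i iU] := oU x Ux; apply: cvg_near_cst; exists i => // n /= ni.
    rewrite /w ifT //; apply/asboolP => y yx; apply: iU; exact: proj_eq_le ni yx.
  apply: cvg_near_cst; exists 0%N => // n _; rewrite /w ifF //.
  by apply/asboolP => H; move/negP: Ux; apply; apply: mem_set; exact: H.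
Qed.

Local Notation C := R[i].

Lemma cabsMC (k : R) (z : C) : cabs (k%:C%C * z) = `|k| * cabs z.
Proof.
rewrite /cabs ComplexField.Normc.normcM; congr (_ * _).
by rewrite /= expr0n addr0 sqrtr_sqr.
Qed.

(** [property_tau] uses the counting measure on cosets, while fibres have measure [1 / N i]; hence
    the factor, which [level_uniform_gap] compensates. *)
Lemma level_norm (w : set (freeGroup r) -> C) i :
  Num.sqrt (\sum_(c <- cosets i) cabs (w c) ^+ 2) =
  Num.sqrt (N i)%:R * L2norm mu (fun x : T => w ((x : X) i)).
Proof.
rewrite /L2norm (Rintegral_proj (fun c => cabs (w c) ^+ 2)) -sqrtrM ?ler0n //.
by rewrite mulrA divff ?mul1r // pnatr_eq0 -lt0n index_gt0.
Qed.

Hypothesis r_gt1 : (1 < r)%N.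
Hypothesis tau : property_tau Gam R.

Let actP := profinite_actP Gam.
Let act_meas : forall g, measurable_fun setT (act g : T -> T) :=
  measurable_act (@nbhs_pdist R r Gam) (@pdist_act R r Gam).

Definition level_space i : set (T -> C) :=
  [set f | exists2 w : set (freeGroup r) -> C,
     f = (fun x : T => w ((x : X) i)) & \sum_(c <- cosets i) w c = 0].

Lemma level_uniform_gap :
  @uniform_spectral_gap R r T nat act level_space (fun=> L2norm mu).
Proof.
move=> [i [v [vP vlim]]]; apply: tau.
have /choice[w wP] n : exists w : set (freeGroup r) -> C,
    v n = (fun x : T => w ((x : X) (i n))) /\ \sum_(c <- cosets (i n)) w c = 0.
  by have [[w vw w0] _] := vP n; exists w.
have N0 n : 0 < Num.sqrt (N (i n))%:R :> R by rewrite sqrtr_gt0 ltr0n index_gt0.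
pose w' n c := ((Num.sqrt (N (i n))%:R)^-1 : R)%:C%C * w n c.
have nE n (h : set (freeGroup r) -> C) :
    Num.sqrt (\sum_(c <- cosets (i n)) cabs (((Num.sqrt (N (i n))%:R)^-1)%:C%C * h c) ^+ 2) =
    L2norm mu (fun x : T => h ((x : X) (i n))).
  rewrite (eq_bigr (fun c => ((Num.sqrt (N (i n))%:R)^-1) ^+ 2 * cabs (h c) ^+ 2)); last first.
    by move=> c _; rewrite cabsMC exprMn real_normK ?num_real.
  rewrite -mulr_sumr sqrtrM ?sqr_ge0 // sqrtr_sqr ger0_norm ?invr_ge0 ?(ltW (N0 n)) //.
  by rewrite level_norm mulKf // gt_eqF.
exists i, w'; split=> [n|g].
  have [vw w0] := wP n; split; first by rewrite /= /w' -mulr_sumr w0 mulr0.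
  by rewrite /w' nE -vw; case: (vP n).
rewrite (_ : (fun n => _) = fun n => L2norm mu (fun x => v n (act g^-1%g x) - v n x)).
  exact: vlim.
apply/funext => n; have [-> _] := wP n.
rewrite -(nE n (fun c => w n (ltrans g^-1%g c) - w n c)); congr Num.sqrt.
by apply: eq_bigr => c _; rewrite /w' -mulrBr.
Qed.

(** A mean-zero [v] is close to a centred cylinder function [v'], to which the uniform gap of the
    levels applies. Returning to [v] costs a factor 3 in the norm and another in the defect, whence
    [k / 9], up to an arbitrarily small [e]. *)
Lemma profinite_gap : exists2 kappa : R, 0 < kappa & almost_inv_gap mu act kappa.
Proof.
have levelL2 i : level_space i `<=` L2 mu.
  move=> _ [w -> _]; apply/L2P; split.
    exact: (sqint_proj (fun c => complex.Re (w c)) i).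
  exact: (sqint_proj (fun c => complex.Im (w c)) i).
have [k k0 kP] := @real_uniform_gap _ _ _ mu _ act actP act_meas act_mu _ _
  levelL2 level_uniform_gap.
exists (k / 9); first exact: divr_gt0.
move=> v sv v0; apply/ler_addgt0Pr => e e0.
have r0 : 0 <= r%:R :> R by rewrite ler0n.
have M0 : 0 < 36 * r%:R + 3 * k + 1 by rewrite ltr_wpDl // addr_ge0 ?mulr_ge0 // ltW.
have [_ [i [w ->]] we] := cylinder_dense sv (divr_gt0 e0 M0).
have sw := sqint_proj w i.
set m := \int[mu]_x w ((x : X) i).
have [sv' v'0 _] := centered sw (erefl m).
(* Centring does not worsen the approximation, because [v] has mean zero. *)
set v' := fun x : T => w ((x : X) i) - m in sv' v'0.
have kv' : k * ip mu v' v' <= defect mu act (-1) v'.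
  apply: (kP i) => // t; exists (fun c => (t * (w c - m))%:C%C) => //.
  have wm : \sum_(c <- cosets i) (w c - m) = 0.
    have := v'0; rewrite /v' (Rintegral_proj (fun c => w c - m)) => /eqP.
    by rewrite mulf_eq0 gt_eqF ?invN_gt0 //= => /eqP.
  by rewrite -rmorph_sum -mulr_sumr wm mulr0.
pose z x := v x - v' x; have sz : sqint mu z by exact: sqintB.
have zz : ip mu z z <= e / (36 * r%:R + 3 * k + 1).
  have svw : sqint mu (fun x : T => v x - w ((x : X) i)) by exact: sqintB.
  have im : \int[mu]_x (v x - w ((x : X) i)) = - m.
    by rewrite RintegralB ?v0 ?sub0r //; exact: sqint_integrable.
  have [_ _ E] := centered svw im.
  apply: le_trans we; rewrite -[leRHS](subrK ((- m) ^+ 2)) -E.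
  have -> : (fun x : T => v x - w ((x : X) i) - - m) = z.
    by apply/funext => x; rewrite /z /v'; ring.
  by rewrite lerDl sqr_ge0.
have dz : defect mu act (-1) z <= 12 * r%:R * ip mu z z.
  have -> : 12 * r%:R * ip mu z z = \sum_(a : letter r) 6 * ip mu z z.
    by rewrite sumr_const card_letter -[RHS]mulr_natl natrM; ring.
  apply: ler_sum => a _.
  have sa : sqint mu (fun x => z (act (letter_elt a)^-1%g x)).
    exact: (sqint_act act_meas act_mu).
  have sN := sqintZ (-1) sz.
  apply: le_trans (ip_le2 (proj1 (sqintD sa sN)) sa sN (fun=> erefl)) _.
  rewrite (@ip_act _ _ _ mu _ act act_meas act_mu _ _ _ sz sz).
  rewrite -(sqr_nrm2 mu (fun x => -1 * z x)) nrm2Z // normrN1 mul1r sqr_nrm2.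
  by lra.
have dv' : defect mu act (-1) v' <= 3 * (defect mu act (-1) v + defect mu act (-1) z).
  rewrite /defect -big_split mulr_sumr; apply: ler_sum => a _ /=.
  have sD f : sqint mu f -> sqint mu (fun x => f (act (letter_elt a)^-1%g x) + -1 * f x).
    by move=> sf; apply: sqintD; [exact: (sqint_act act_meas act_mu)|exact: sqintZ].
  have sNz : sqint mu (fun x => (-1) * (z (act (letter_elt a)^-1%g x) + -1 * z x)).
    exact: (sqintZ _ (sD _ sz)).
  have -> : ip mu (fun x => z (act (letter_elt a)^-1%g x) + -1 * z x)
      (fun x => z (act (letter_elt a)^-1%g x) + -1 * z x) =
    ip mu (fun x => (-1) * (z (act (letter_elt a)^-1%g x) + -1 * z x))
      (fun x => (-1) * (z (act (letter_elt a)^-1%g x) + -1 * z x)).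
    by apply: eq_Rintegral => x _; ring.
  apply: ip_le2 (proj1 (sD _ sv')) (sD _ sv) sNz _ => x.
  by rewrite /z; ring.
have vv : ip mu v v <= 3 * (ip mu v' v' + ip mu z z).
  by apply: (ip_le2 (proj1 sv) sv' sz) => x; rewrite /z; ring.
have z0 := ip_ge0 mu z.
move: zz; rewrite ler_pdivlMr // => zz.
have kvv := ler_wpM2l (ltW k0) vv.
have kz : 0 <= k * ip mu z z by rewrite mulr_ge0 // ltW.
have rz : 0 <= r%:R * ip mu z z by rewrite mulr_ge0.
by lra.
Qed.

Lemma profinite_ball_average (a : R) : 0 < a ->
  exists2 theta : R, 0 < theta &
    ball_average_estimate mu act (@profinite_dist r Gam R) a theta.
Proof.
move=> a0; have [k k0 kP] := profinite_gap.
have [g0 est _] := @metric_ball_average R r X mu act pd 1 k r_gt1 actP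
  (@pdist_refl R r Gam) (@pdist_sym R r Gam) (@pdist_triangle R r Gam)
  (@nbhs_pdist R r Gam) (@pdist_act R r Gam) act_mu profinite_full_support k0 kP
  point 1 1 ltr01 ltr01 (@profinite_dball point) (@profinite_dist r Gam R) a a0
  (fun x y xy => or_introl (conj (ltry _) (introT andP (conj (proj1 (andP xy)) (lexx _))))).
exists (rate a r (gap_size mu act) 1) => //; apply: rate_gt0 => //.
by rewrite g0 (@gap_size_le1 _ _ _ mu _ act r_gt1 act_meas act_mu).
Qed.

End ProfiniteMeasure.

(** * Riemannian distances *)

Section RowVectors.
Variables (R : realType) (n : nat).
Implicit Types (v w x y z p : 'rV[R]_n) (f : 'rV[R]_n -> R).

Lemma ler_norm_entry v i : `|v 0 i| <= `|v|.
Proof.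
have -> : `|v| = mx_norm v by [].
by rewrite mx_normrE (le_bigmax _ (fun ij => `|v ij.1 ij.2|) (0, i)).
Qed.

Lemma rV_norm_le v e : 0 <= e -> (forall i, `|v 0 i| <= e) -> `|v| <= e.
Proof.
move=> e0 ve; have -> : `|v| = mx_norm v by [].
by rewrite mx_normrE; apply/bigmax_leP; split=> // -[i j] _ /=; rewrite (ord1 i).
Qed.

Lemma is_derive_line (W : normedModType R) (f : 'rV[R]_n -> W) z v s :
  derivable f (s *: v + z) v ->
  is_derive s 1 (fun t : R => f (t *: v + z)) ('D_v f (s *: v + z)).
Proof.
move=> df.
have E : (fun h : R => h^-1 *:
     (((fun t : R => f (t *: v + z)) \o shift s) (h *: 1) - f (s *: v + z)))
   = (fun h : R => h^-1 *: ((f \o shift (s *: v + z)) (h *: v) - f (s *: v + z))).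
  by apply/funext => h /=; rewrite scalerDl -addrA [h *: 1]mulr1.
by split; rewrite /derivable /derive E.
Qed.

Lemma lip_line f z v t M : 0 <= t ->
  (forall s, 0 <= s <= t -> derivable f (s *: v + z) v /\ `|'D_v f (s *: v + z)| <= M) ->
  `|f (t *: v + z) - f z| <= M * t.
Proof.
move=> t0 H.
have D s : 0 <= s <= t -> is_derive s 1 (fun t : R => f (t *: v + z)) ('D_v f (s *: v + z)).
  by case/H => d _; exact: is_derive_line.
have [||s] := @MVT_segment R (fun t => f (t *: v + z)) (fun s => 'D_v f (s *: v + z)) 0 t t0.
- by move=> s; rewrite in_itv /= => /andP[s0 st]; apply: D; rewrite !ltW.
- apply: derivable_within_continuous => s; rewrite in_itv /= => st.
  by have [] := D s st.
rewrite in_itv /= scale0r add0r subr0 => st ->.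
by rewrite normrM (ger0_norm t0) ler_wpM2r // (proj2 (H s st)).
Qed.

Lemma lip_line_abs f z v t M :
  (forall s, `|s| <= `|t| -> 0 <= s * t ->
    derivable f (s *: v + z) v /\ `|'D_v f (s *: v + z)| <= M) ->
  `|f (t *: v + z) - f z| <= M * `|t|.
Proof.
case: (leP 0 t) => t0 H.
  rewrite (ger0_norm t0); apply: lip_line => // s /andP[s0 st].
  by apply: H; rewrite ?mulr_ge0 // !ger0_norm.
have nt : 0 <= - t by rewrite oppr_ge0 ltW.
have := @lip_line f (t *: v + z) v (- t) M nt.
rewrite addrA -scalerDl addNr scale0r add0r distrC (ltr0_norm t0); apply.
move=> s /andP[s0 st]; rewrite addrA -scalerDl.
have tle : t <= s + t <= 0 by lra.
apply: H; last by rewrite mulr_le0 //; [lra|exact: ltW].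
by rewrite (ltr0_norm t0) ler0_norm; lra.
Qed.

(** Moves from [y] to [x] one coordinate at a time. The intermediate points stay in the ball, which
    is a box for the supremum norm, and each of the [n] steps uses a single partial derivative. *)
Lemma lip_of_partials f p e M : 0 <= M ->
  (forall v, `|v - p| <= e -> forall j : 'I_n,
     derivable f v (delta_mx 0 j) /\ `|'D_(delta_mx 0 j) f v| <= M) ->
  forall x y, `|x - p| <= e -> `|y - p| <= e ->
  `|f x - f y| <= n%:R * M * `|x - y|.
Proof.
move=> M0 H x y xe ye; have e0 : 0 <= e := le_trans (normr_ge0 _) xe.
pose z (k : nat) : 'rV[R]_n := \row_j (if (j < k)%N then x 0 j else y 0 j).
have z0 : z 0%N = y by apply/rowP => j; rewrite mxE.
have zn : z n = x by apply/rowP => j; rewrite mxE ltn_ord.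
have step (k : 'I_n) : `|f (z k.+1) - f (z k)| <= M * `|x - y|.
  have zS : z k.+1 = (x 0 k - y 0 k) *: delta_mx 0 k + z k.
    apply/rowP => j; rewrite !mxE eqxx /=; case: (eqVneq j k) => [->|jk] /=.
      by rewrite ltnS leqnn ltnn mulr1 subrK.
    by rewrite mulr0 add0r ltnS leq_eqVlt val_eqE (negbTE jk).
  rewrite zS; apply: le_trans (_ : M * `|x 0 k - y 0 k| <= _); last first.
    by rewrite ler_wpM2l //; have := ler_norm_entry (x - y) k; rewrite !mxE.
  apply: lip_line_abs => s st st0; apply: H; apply: rV_norm_le => // j.
  rewrite !mxE eqxx /=.
  have xj := le_trans (ler_norm_entry _ j) xe; have yj := le_trans (ler_norm_entry _ j) ye.
  rewrite !mxE in xj yj; case: (eqVneq j k) => [jk|_] /=; last first.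
    by rewrite mulr0 add0r; case: ifP.
  rewrite mulr1 jk ltnn; rewrite jk in xj yj.
  move: xj yj; rewrite !ler_norml => /andP[x1 x2] /andP[y1 y2].
  case: (leP 0 (x 0 k - y 0 k)) => c.
    rewrite (ger0_norm c) in st.
    have s0 : 0 <= s.
      case: (leP 0 s) => // sn; rewrite (ltr0_norm sn) in st.
      by move: st0; nra.
    by rewrite (ger0_norm s0) in st; lra.
  rewrite (ltr0_norm c) in st.
  have s0 : s <= 0.
    case: (leP s 0) => // sn; by move: st0; nra.
  by rewrite (ler0_norm s0) in st; lra.
have -> : f x - f y = \sum_(k < n) (f (z k.+1) - f (z k)).
  by rewrite -(big_mkord xpredT (fun k => f (z k.+1) - f (z k))) telescope_sumr // zn z0.
apply: le_trans (ler_norm_sum _ _ _) _; apply: le_trans (ler_sum _ (fun k _ => step k)) _.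
by rewrite sumr_const card_ord -mulrA mulr_natl.
Qed.

(* Smoothness is expressed by directional derivatives only, so no Frechet
   derivative is available for the chain rule: local Lipschitz continuity allows
   to replace the curve by its tangent. *)
Lemma is_derive_comp_lip f (c : R -> 'rV[R]_n) t e K : 0 < e ->
  (forall x y, `|x - c t| <= e -> `|y - c t| <= e -> `|f x - f y| <= K * `|x - y|) ->
  derivable c t 1 -> derivable f (c t) ('D_1 c t) ->
  is_derive t 1 (fun s => f (c s)) ('D_('D_1 c t) f (c t)).
Proof.
move=> e0 lip dc df; set w := 'D_1 c t.
have cw : (fun h : R => h^-1 *: (c (h + t) - c t)) @ 0^' --> w.
  move: dc; rewrite /derivable => /cvgP; rewrite /w /derive.
  by under eq_fun do rewrite /= [_ *: 1]mulr1.
have cf : (fun h : R => h^-1 *: (f (h *: w + c t) - f (c t))) @ 0^' --> 'D_w f (c t) by exact: df.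
have cc : (fun h : R => c (h + t)) @ 0^' --> c t.
  have ct : {for t, continuous c} by apply/differentiable_continuous/derivable1_diffP.
  by apply/(continuous_withinNshiftx c t).
have lw : (fun h : R => h *: w + c t) @ 0^' --> c t.
  have : (fun h : R => h *: w + c t) @ (0 : R) --> (0 : R) *: w + c t.
    by apply: cvgD; [apply: cvgZr_tmp; exact: cvg_id|exact: cvg_cst].
  by rewrite scale0r add0r; move=> H; apply: cvg_trans H; apply: cvg_app; exact: nbhs_dnbhs.

have cr : (fun h : R => h^-1 *: (f (c (h + t)) - f (h *: w + c t))) @ 0^' --> (0 : R).
  apply/norm_cvg0P.
  apply: (@squeeze_cvgr _ _ _ _ (cst 0) (fun h : R => K * `|h^-1 *: (c (h + t) - c t) - w|)).
  - have near_e (g : R -> 'rV[R]_n) : g @ 0^' --> c t -> \forall h \near 0^', `|g h - c t| <= e.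
      by move=> gc; move/cvgrPdistC_le: gc => /(_ _ e0).
    near=> h; rewrite normr_ge0 /=.
    have h0 : h != 0 by near: h; exact: nbhs_dnbhs_neq.
    have -> : h^-1 *: (c (h + t) - c t) - w = h^-1 *: (c (h + t) - (h *: w + c t)).
      by rewrite -[X in _ - X = _](scalerK h0) -scalerBr opprD addrA addrAC.
    rewrite !normrZ mulrCA ler_wpM2l //; apply: lip.
      by near: h; exact: near_e.
    by near: h; exact: near_e.
  - exact: cvg_cst.
  have := cvgMl_tmp (a := K) (cvg_norm (cvgB cw (cvg_cst w))).
  by rewrite subrr normr0 mulr0; apply.
have E : (fun h : R => h^-1 *:
    (((fun s => f (c s)) \o shift t) (h *: 1) - f (c t))) @ 0^' --> 'D_w f (c t).
  have -> : (fun h : R => h^-1 *: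
      (((fun s => f (c s)) \o shift t) (h *: 1) - f (c t))) =
     (fun h : R => h^-1 *: (f (h *: w + c t) - f (c t)) +
       h^-1 *: (f (c (h + t)) - f (h *: w + c t))).
    by apply/funext => h /=; rewrite -scalerDr [h *: 1]mulr1; congr (_ *: _); ring.
  by rewrite -[X in _ --> X]addr0; apply: cvgD.
split; last exact: cvg_lim.
by apply/cvg_ex; exists ('D_w f (c t)).
Unshelve. all: by end_near. Qed.

End RowVectors.

(** * Increments bounded by the integral of a speed *)

Section Comparison.
Variables (R : realType) (s : R -> R).
Local Notation lam := (@lebesgue_measure R).
Hypothesis s_cont : forall t : R, 0 <= t <= 1 -> {for t, continuous s}.

Lemma continuous01_integrable : lam.-integrable `[0, 1] (EFin \o s).
Proof.
apply: continuous_compact_integrable; first exact: segment_compact.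
apply: continuous_in_subspaceT => t /set_mem; rewrite /= in_itv /=; exact: s_cont.
Qed.

Hypothesis s_ge0 : forall t : R, 0 <= s t.

Local Notation S t := (\int[lam]_(u in `[0, t]) s u).

Lemma is_derive_primitive (t : R) : 0 < t < 1 -> is_derive t 1 (fun t => S t) (s t).
Proof.
move=> /andP[t0 t1].
have [|dS eS] := continuous_FTC1_closed t1 continuous01_integrable t0.
  by apply: s_cont; rewrite !ltW.
by split=> //; rewrite -derive1E eS.
Qed.

Lemma primitive_continuous (T : R) : T <= 1 -> {within `[0, T], continuous (fun t => S t)}.
Proof.
move=> T1.
apply: continuous_subspaceW
  (parameterized_integral_continuous ler01 continuous01_integrable).
by move=> u; rewrite /= !in_itv /= => /andP[-> uT]; exact: le_trans uT T1.
Qed.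

(** The sum of [g] and the primitive of [s] has nonnegative derivative. *)
Lemma opp_increment_le_primitive (g dg : R -> R) (T : R) : 0 < T <= 1 ->
  (forall t : R, 0 <= t <= T -> is_derive t 1 g (dg t)) ->
  (forall t : R, 0 <= t <= T -> - dg t <= s t) ->
  - (g T - g 0) <= S T.
Proof.
move=> /andP[T0 T1] gd gs; pose F t := S t + g t.
have dF (t : R) : 0 < t < T -> is_derive t 1 F (s t + dg t).
  move=> /andP[t0 tT]; apply: is_deriveD; last by apply: gd; rewrite !ltW.
  by apply: is_derive_primitive; rewrite t0 (lt_le_trans tT).
have FT : F 0 <= F T.
  apply: (@ger0_derive1_le_cc R F 0 T) => [t|t||||]; rewrite ?in_itv /= ?lexx ?(ltW T0) //.
  - by move/dF => [].
  - move=> tT; have [_ E] := dF _ tT; rewrite derive1E E -lerBlDr sub0r.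
    by apply: gs; case/andP: tT => t0 tT; rewrite !ltW.
  apply: (@within_continuousD); first exact: primitive_continuous.
  apply: derivable_within_continuous => t; rewrite in_itv /= => tT.
  by have [] := gd t tT.
move: FT; rewrite /F set_itv1 Rintegral_set1; lra.
Qed.

Lemma primitive_le1 (T : R) : 0 <= T <= 1 -> 0 <= S T <= S 1.
Proof.
move=> /andP[T0 T1]; rewrite Rintegral_ge0 //=.
apply: (@ger0_derive1_le_cc R (fun t => S t) 0 1) => [t|t||||]; rewrite ?in_itv /= ?lexx ?ler01 ?T0 ?T1 //.
- by move/is_derive_primitive => [].
- by move=> tT; have [_ E] := is_derive_primitive tT; rewrite derive1E E.
exact: primitive_continuous.
Qed.

Lemma increment_le_integral (g dg : R -> R) (T M : R) : 0 <= T <= 1 -> 0 < M ->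
  (forall t : R, 0 <= t <= T -> is_derive t 1 g (dg t)) ->
  (forall t : R, 0 <= t <= T -> `|dg t| <= M * s t) ->
  `|g T - g 0| <= M * S 1.
Proof.
move=> T01 M0 gd gs; have /andP[ST0 ST1] := primitive_le1 T01.
case/andP: T01 => T0 T1.
have [<-|Tn0] := eqVneq 0 T.
  by rewrite subrr normr0 mulr_ge0 ?(le_trans ST0 ST1) ?ltW.
have T01 : 0 < T <= 1 by rewrite lt_neqAle Tn0 T0.
rewrite mulrC -ler_pdivrMr //; apply: le_trans ST1.
rewrite -[M in _ / M](ger0_norm (ltW M0)) -normf_div ler_norml.
(* Taken with [k = 1 / M] and [k = -1 / M], this bounds the increment on both sides. *)
have key k : `|k| = M^-1 -> - (k * g T - k * g 0) <= S T.
  move=> kM; apply: (@opp_increment_le_primitive (fun t => k * g t) (fun t => k * dg t)) => // t tT.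
    by have := gd _ tT => d; apply: is_deriveZ.
  apply: le_trans (ler_norm _) _; rewrite normrN normrM kM mulrC ler_pdivrMr // mulrC.
  exact: gs.
have i0 : 0 <= M^-1 by rewrite invr_ge0 ltW.
have := key M^-1 (ger0_norm i0); have := key (- M^-1) _; rewrite normrN ger0_norm // => /(_ erefl).
by rewrite mulrBl; lra.
Qed.

End Comparison.

(** * Positive definite quadratic forms *)

Section QuadraticForms.
Variables (R : realType) (D : nat).
Implicit Types (G H : 'M[R]_D) (v w p : 'rV[R]_D).

Lemma quadE G w : quad G w = \sum_j (\sum_i w 0 i * G i j) * w 0 j.
Proof. by rewrite /quad mxE; apply: eq_bigr => j _; rewrite !mxE. Qed.

Lemma quadZ G (a : R) w : quad G (a *: w) = a ^+ 2 * quad G w.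
Proof.
rewrite !quadE mulr_sumr; apply: eq_bigr => j _.
rewrite !mulr_suml mulr_sumr; apply: eq_bigr => i _; rewrite !mxE; ring.
Qed.

Lemma quadB G H w : quad (G - H) w = quad G w - quad H w.
Proof. by rewrite /quad mulmxBr mulmxBl !mxE. Qed.

Lemma ler_norm_quad G w (M : R) : (forall i j, `|G i j| <= M) ->
  `|quad G w| <= D%:R ^+ 2 * M * `|w| ^+ 2.
Proof.
move=> GM; rewrite quadE.
have -> : D%:R ^+ 2 * M * `|w| ^+ 2 = \sum_(j < D) \sum_(i < D) M * `|w| ^+ 2.
  by rewrite !sumr_const card_ord -[RHS]mulr_natl -[_ *+ D]mulr_natl; ring.
apply: le_trans (ler_norm_sum _ _ _) _; apply: ler_sum => j _.
rewrite mulr_suml; apply: le_trans (ler_norm_sum _ _ _) _; apply: ler_sum => i _.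
rewrite !normrM mulrAC mulrC ler_pM ?mulr_ge0 //.
by rewrite expr2 ler_pM // ler_norm_entry.
Qed.

Lemma cvg_quad (T : Type) (F : set_system T) (FF : Filter F) (G : T -> 'M[R]_D)
    (w : T -> 'rV[R]_D) G0 w0 :
  (forall i j, G t i j @[t --> F] --> G0 i j) -> w @ F --> w0 ->
  quad (G t) (w t) @[t --> F] --> quad G0 w0.
Proof.
move=> cG cw; rewrite quadE.
have cwi i : w t 0 i @[t --> F] --> w0 0 i.
  by apply: (cvg_comp w (fun v : 'rV[R]_D => v 0 i) cw); exact: coord_continuous.
under eq_cvg do rewrite quadE.
apply: cvg_big => [|j _]; first exact: add_continuous.
apply: cvgM => //; apply: cvg_big => [|i _]; first exact: add_continuous.
exact: cvgM.
Qed.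

(** The constant is the minimum over the compact unit sphere, extended by homogeneity. In dimension
    0 the sphere is empty and any constant works. *)
Lemma quad_coercive G : (forall w, w != 0 -> 0 < quad G w) ->
  exists2 m : R, 0 < m & forall w, m * `|w| ^+ 2 <= quad G w.
Proof.
move=> Gpos; pose A := [set w : 'rV[R]_D | `|w| = 1].
have scale w : w != 0 -> A (`|w|^-1 *: w).
  by move=> w0; rewrite /A /= normrZ normfV normr_id mulVf ?normr_eq0.
have q0 : quad G 0 = 0 by rewrite /quad mul0mx mul0mx mxE.
have [A0|/set0P A0] := eqVneq A set0.
  exists 1 => // w; have [->|/scale] := eqVneq w 0; last by rewrite A0.
  by rewrite normr0 expr0n /= mulr0 q0.
have cA : compact A.
  apply: bounded_closed_compact.
    exists 1; split=> // M M1 w Aw; rewrite /= Aw; exact: ltW.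
  rewrite (_ : A = (fun w => `|w|) @^-1` [set 1]) //.
  by apply: closed_comp => [w _|]; [exact: norm_continuous|exact: closed_eq].
have [u /set_mem uA uP] : exists2 u, u \in A & forall w, w \in A -> quad G u <= quad G w.
  apply: EVT_min_rV => //; apply: continuous_subspaceT => w.
  by apply: (cvg_quad (nbhs_filter w)) => [i j|]; [exact: cvg_cst|exact: cvg_id].
exists (quad G u) => [|w].
  by apply: Gpos; rewrite -normr_eq0 uA oner_eq0.
have [->|w0] := eqVneq w 0; first by rewrite normr0 expr0n /= mulr0 q0.
have := uP _ (mem_set (scale _ w0)); rewrite quadZ exprVn mulrC.
by rewrite ler_pdivlMr // exprn_gt0 // normr_gt0.
Qed.

Lemma near_entries (G : 'rV[R]_D -> 'M[R]_D) p (e : R) :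
  (forall i j, {for p, continuous (fun v => G v i j)}) -> 0 < e ->
  \forall v \near p, forall i j, `|(G v - G p) i j| <= e.
Proof.
move=> cG e0.
apply: (@filter_forall _ _ (fun i v => forall j, `|(G v - G p) i j| <= e) _
  (nbhs_filter p)) => i.
apply: (@filter_forall _ _ (fun j v => `|(G v - G p) i j| <= e) _ (nbhs_filter p)) => j.
have /cvgrPdistC_le/(_ e e0) := cG i j.
by apply: filterS => v; rewrite !mxE.
Qed.

Lemma near_quad_bounds (G : 'rV[R]_D -> 'M[R]_D) p :
  (forall i j, {for p, continuous (fun v => G v i j)}) ->
  (forall w, w != 0 -> 0 < quad (G p) w) ->
  exists m M : R, [/\ 0 < m, 0 < M & \forall v \near p, forall w,
    (m * `|w|) ^+ 2 <= quad (G v) w <= (M * `|w|) ^+ 2].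
Proof.
move=> cG Gpos; have [m m0 mP] := quad_coercive Gpos.
(* If the entries of [G v - G p] are at most [e], the form changes by at most [m / 2] times the
   squared norm, so half of the coercivity survives. *)
pose e := m / 2 / (D%:R ^+ 2 + 1).
have D0 : 0 < D%:R ^+ 2 + 1 :> R by rewrite ltr_wpDl // sqr_ge0.
have e0 : 0 < e by rewrite !divr_gt0.
have De : D%:R ^+ 2 * e <= m / 2.
  by rewrite /e mulrA ler_pdivrMr // mulrDr mulr1 mulrC lerDl divr_ge0 // ltW.
pose N : R := \big[Num.max/0]_(ij : 'I_D * 'I_D) `|G p ij.1 ij.2|.
have GN i j : `|G p i j| <= N.
  exact: (le_bigmax _ (fun ij : 'I_D * 'I_D => `|G p ij.1 ij.2|) (i, j)).
have N0 : 0 <= N by rewrite /N; elim/big_ind: _ => // x y x0 y0; rewrite le_max x0.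
pose M2 := D%:R ^+ 2 * N + m.
have M20 : 0 < M2 by rewrite ltr_wpDl // mulr_ge0 // sqr_ge0.
exists (Num.sqrt (m / 2)), (Num.sqrt M2); split; rewrite ?sqrtr_gt0 ?divr_gt0 //.
apply: filterS (near_entries cG e0) => v vP w.
rewrite !exprMn !sqr_sqrtr ?(ltW M20) ?divr_ge0 // ?(ltW m0) //.
have := ler_norm_quad w vP; have := ler_norm_quad w GN; have := mP w.
have w2 : 0 <= `|w| ^+ 2 by rewrite sqr_ge0.
have := ler_wpM2r w2 De.
rewrite quadB ler_norml /M2 => h1 h2 h3; rewrite ler_norml => /andP[h4 h5].
move: h3 => /andP[_ h3]; apply/andP; split; lra.
Qed.

End QuadraticForms.

Lemma nbhs_norm_le (R : realType) (V : normedModType R) (v : V) (P : set V) :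
  nbhs v P <-> exists2 e : R, 0 < e & forall u, `|u - v| <= e -> P u.
Proof.
split=> [/nbhs_normP[e /= e0 H]|[e e0 H]].
  exists (e / 2); first exact: divr_gt0.
  by move=> u uv; apply: H; rewrite /= distrC; apply: le_lt_trans uv _; lra.
by apply/nbhs_normP; exists e => //= u /ltW; rewrite distrC => /H.
Qed.

(** * Charts, transition maps and speeds of curves *)

Section Charts.
Variables (R : realType) (D : nat) (X : compactRiemannianManifold R D).
Implicit Types (k l : chart R X D) (v w : 'rV[R]_D) (c : R -> 'rV[R]_D).

Lemma cimgP k v : cimg k v -> cdom k (cinv k v) /\ cmap k (cinv k v) = v.
Proof. by case=> x kx <-; rewrite cmapK. Qed.

Lemma near_overlap k l v : cimg l v -> cdom k (cinv l v) ->
  \forall u \near v, cimg l u /\ cdom k (cinv l u).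
Proof.
move=> lv kv; apply: filterI; first by apply: open_nbhs_nbhs; split => //; exact: cimg_open.
by apply: (cinv_continuous lv); apply: open_nbhs_nbhs; split => //; exact: cdom_open.
Qed.

Lemma overlapP k l v : cimg l v -> cdom k (cinv l v) ->
  (cmap l @` (cdom l `&` cdom k)) v.
Proof. by move=> /cimgP[lv E] kv; exists (cinv l v). Qed.

Lemma metric_continuous k v i j : atlas k -> cimg k v ->
  {for v, continuous (fun u => metric k u i j)}.
Proof. by move=> ak kv; have [] := metric_smooth ak i j [::] kv. Qed.

(** The partial derivatives of the transition map are continuous, hence bounded near the point. The
    map is therefore locally Lipschitz, and [is_derive_comp_lip] supplies the chain rule along
    [c]. *)
Lemma is_derive_transition k l c t i : atlas k -> atlas l ->
  derivable c t 1 -> cimg l (c t) -> cdom k (cinv l (c t)) ->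
  is_derive t 1 (fun s : R => cmap k (cinv l (c s)) 0 i)
    ('D_('D_1 c t) (fun v => cmap k (cinv l v)) (c t) 0 i).
Proof.
move=> ak al dc lc kc; set phi := fun v => cmap k (cinv l v).
have smooth := atlas_smooth al ak.
pose f v := phi v 0 i.
have fD v w : cimg l v -> cdom k (cinv l v) ->
    derivable f v w /\ 'D_w f v = 'D_w phi v 0 i.
  move=> lv kv; have [_ /(_ w) dphi] := smooth [::] v (overlapP lv kv).
  by split; [exact: (derivable_mxP _ _ _).1|rewrite (derive_mx dphi) mxE].
have near_bound : \forall v \near c t, (cimg l v /\ cdom k (cinv l v)) /\
    forall j : 'I_D, `|'D_(delta_mx 0 j) phi v 0 i| <= `|'D_(delta_mx 0 j) phi (c t) 0 i| + 1.
  apply: filterI; first exact: near_overlap.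
  apply: (@filter_forall _ _ (fun j v => _) _ (nbhs_filter (c t))) => j.
  have [+ _] := smooth [:: delta_mx 0 j] (c t) (overlapP lc kc).
  rewrite /iter_derive => cj.
  have ci : 'D_(delta_mx 0 j) phi v 0 i @[v --> c t] --> 'D_(delta_mx 0 j) phi (c t) 0 i.
    by apply: (cvg_comp _ (fun v : 'rV[R]_D => v 0 i) cj); exact: coord_continuous.
  move/cvgrPdistC_le : ci => /(_ 1 ltr01); apply: filterS => v.
  rewrite distrC => h.
  have := ler_normD
    ('D_(delta_mx 0 j) phi v 0 i - 'D_(delta_mx 0 j) phi (c t) 0 i)
    ('D_(delta_mx 0 j) phi (c t) 0 i).
  by rewrite subrK distrC => /le_trans; apply; rewrite addrC lerD2l.
pose M := \sum_(j < D) (`|'D_(delta_mx 0 j) phi (c t) 0 i| + 1).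
have MP j : `|'D_(delta_mx 0 j) phi (c t) 0 i| + 1 <= M.
  by rewrite /M (bigD1 j) //= lerDl sumr_ge0 // => j' _; rewrite addr_ge0.
have M0 : 0 <= M by rewrite sumr_ge0 // => j _; rewrite addr_ge0.
case/nbhs_norm_le : near_bound => e e0 eP.
have lip := @lip_of_partials R D f (c t) e M M0 _.
have [df fE] := fD (c t) ('D_1 c t) lc kc.
rewrite -fE; apply: (is_derive_comp_lip (f := f) e0 _ dc df); apply: lip.
move=> v /eP[[lv kv] vM] j; have [? ->] := fD v (delta_mx 0 j) lv kv.
by split=> //; exact: le_trans (vM j) (MP j).
Qed.

Definition speed k c t : R := Num.sqrt (quad (metric k (c t)) (derive1 c t)).

Lemma speed_continuous k c t : atlas k -> C1_curve_in (cimg k) c ->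
  0 <= t <= 1 -> {for t, continuous (speed k c)}.
Proof.
move=> ak [dc cdc ck] t01; apply: (cvg_comp _ Num.sqrt); last exact: sqrt_continuous.
apply: (cvg_quad (nbhs_filter t)) => [i j|]; last exact: cdc.
have ct : {for t, continuous c} by apply/differentiable_continuous/derivable1_diffP.
exact: (cvg_comp c (fun u => metric k u i j) ct (metric_continuous ak (ck t t01))).
Qed.

Lemma chart_length_ge0 k c : 0 <= chart_length k c.
Proof. by apply: Rintegral_ge0 => t _; exact: sqrtr_ge0. Qed.

(** By [metric_compat] the transported velocity has in chart [k] the Riemannian length that it has
    in chart [l]; the lower bound on the metric converts it into a coordinate bound. *)
Lemma transition_speed k l c t i m : atlas k -> atlas l ->
  cimg l (c t) -> cdom k (cinv l (c t)) -> derivable c t 1 -> 0 < m ->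
  (forall w, (m * `|w|) ^+ 2 <= quad (metric k (cmap k (cinv l (c t)))) w) ->
  `|'D_('D_1 c t) (fun v => cmap k (cinv l v)) (c t) 0 i| <= m^-1 * speed l c t.
Proof.
move=> ak al lc kc dc m0 H; set z := cinv l (c t).
have [lz cz] := cimgP lc.
have := metric_compat ('D_1 c t) al ak lz kc; rewrite cz.
set w := 'D_('D_1 c t) _ _ => E; have := H w; rewrite -E => mw.
apply: le_trans (ler_norm_entry _ _) _.
rewrite mulrC ler_pdivlMr // mulrC /speed derive1E.
have mw0 : 0 <= m * `|w| by rewrite mulr_ge0 // ltW.
by rewrite -[leLHS](ger0_norm mw0) -sqrtr_sqr ler_wsqrtr.
Qed.

End Charts.

Section Curves.
Variables (R : realType) (D : nat) (X : compactRiemannianManifold R D).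
Implicit Types (x y z : X).

Lemma curve_length_ge0 x y L : curve_length x y L -> 0 <= L.
Proof. by elim=> // k c z M _ _ _ M0; rewrite addr_ge0 ?chart_length_ge0. Qed.

Lemma curve_length_trans x y z L M :
  curve_length x y L -> curve_length y z M -> curve_length x z (L + M).
Proof.
move=> xy yz; elim: xy yz => [u|k c u N ak Cc _ IH] yz; first by rewrite add0r.
by rewrite -addrA; apply: CurveCons => //; exact: IH.
Qed.

End Curves.

(** * Short curves do not leave a chart *)

Section Pieces.
Variables (R : realType) (D : nat) (X : compactRiemannianManifold R D).
Variables (k : chart R X D) (p : 'rV[R]_D) (eta m : R).
Hypotheses (ak : atlas k) (m_gt0 : 0 < m).
Hypothesis eta_img : forall v, `|v - p| <= eta -> cimg k v.
Hypothesis eta_quad : forall v, `|v - p| <= eta ->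
  forall w, (m * `|w|) ^+ 2 <= quad (metric k v) w.

(** While the curve stays in the ball of radius [eta], its coordinates in [k] move by at most
    [1 / m] times its length, although it is given in another chart [l]. A continuity argument in
    time shows that it never leaves the ball. *)
Lemma curve_piece (l : chart R X D) (c : R -> 'rV[R]_D) :
  atlas l -> C1_curve_in (cimg l) c -> cdom k (cinv l (c 0)) ->
  `|cmap k (cinv l (c 0)) - p| + m^-1 * chart_length l c < eta ->
  cdom k (cinv l (c 1)) /\
  `|cmap k (cinv l (c 1)) - p| <= `|cmap k (cinv l (c 0)) - p| + m^-1 * chart_length l c.
Proof.
move=> al Cc k0; set r := _ + _ => r_lt; have [dc cdc cl] := Cc.
pose Z t := cinv l (c t).
pose Good t := cdom k (Z t) /\ `|cmap k (Z t) - p| < eta.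
have im0 : 0 <= m^-1 by rewrite invr_ge0 ltW.
have L0 : 0 <= m^-1 * chart_length l c by rewrite mulr_ge0 // chart_length_ge0.
have cZ t : 0 <= t <= 1 -> {for t, continuous Z}.
  move=> t01; have ct : {for t, continuous c}.
    exact/differentiable_continuous/derivable1_diffP.
  exact: (cvg_comp c (cinv l) ct (cinv_continuous (cl t t01))).
have near_good t : 0 <= t <= 1 -> Good t -> \forall s \near t, Good s.
  move=> t01 [kt pt]; apply: (cZ t t01 (cdom k `&` [set z | `|cmap k z - p| < eta])).
  apply: filterI.
    by apply: open_nbhs_nbhs; split => //; exact: cdom_open.
  have /cvgrPdistC_lt := cmap_continuous kt.
  have e0 : 0 < eta - `|cmap k (Z t) - p| by rewrite subr_gt0.
  move/(_ _ e0); apply: filterS => z /= zt.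
  have := ler_normD (cmap k z - cmap k (Z t)) (cmap k (Z t) - p).
  by rewrite addrA subrK => zp; apply: le_lt_trans zp _; rewrite -ltrBrDr.
have est T : 0 <= T <= 1 -> (forall s, 0 <= s <= T -> Good s) ->
    `|cmap k (Z T) - p| <= r.
  move=> T01 TG; have /andP[T0 T1] := T01.
  have -> : cmap k (Z T) - p = (cmap k (Z 0) - p) + (cmap k (Z T) - cmap k (Z 0)).
    by rewrite [RHS]addrC addrA subrK.
  apply: le_trans (ler_normD _ _) _; rewrite lerD2l; apply: rV_norm_le => // i.
  rewrite !mxE.
  apply: (@increment_le_integral _ (speed l c) _ _ (fun s => cmap k (Z s) 0 i)
    (fun s => 'D_('D_1 c s) (fun v => cmap k (cinv l v)) (c s) 0 i)) => //.
  - by move=> t; exact: speed_continuous.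
  - by move=> t; exact: sqrtr_ge0.
  - by rewrite invr_gt0.
  - move=> t tT; have [kt _] := TG t tT; apply: is_derive_transition => //.
    by apply: cl; case/andP: tT => -> /le_trans ->.
  - move=> t tT; have [kt pt] := TG t tT; apply: transition_speed => //.
      by apply: cl; case/andP: tT => -> /le_trans ->.
    exact/eta_quad/ltW.
(* A curve leaving the ball of radius [eta] would exit it at a limit of points of
   the closed set [K], which lies inside. *)
pose K := cinv k @` [set v | `|v - p| <= r].
have cK : closed K.
  apply: compact_closed; first exact: m_hausdorff.
  apply: continuous_compact.
    apply: continuous_in_subspaceT => v /set_mem /= vr.
    by apply: cinv_continuous; apply: eta_img; exact: le_trans vr (ltW _).
  apply: bounded_closed_compact.
    exists (`|p| + r); split=> [|M M1 w /= wr]; first exact: num_real.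
    by have := ler_normD (w - p) p; rewrite subrK; lra.
  rewrite (_ : mkset _ = (fun w => `|w - p|) @^-1` [set t | t <= r]) //.
  apply: closed_comp => [w _|]; last exact: closed_le.
  apply: (@cvg_norm _ _ _ _ (nbhs_filter w) (fun w => w - p)).
  by apply: (@cvgB _ _ _ _ (nbhs_filter w) id (fun=> p)); [exact: cvg_id|exact: cvg_cst].
have G0 : Good 0 by split=> //; apply: le_lt_trans r_lt; rewrite lerDl.
have allGood t : 0 <= t <= 1 -> Good t.
  move=> t01; apply: contrapT => Gt.
  pose E := [set t : R | 0 <= t <= 1 /\ ~ Good t].
  have iE : has_inf E by split; [exists t|exists 0 => s [/andP[]]].
  pose T := inf E.
  have lbT s : 0 <= s <= 1 -> s < T -> Good s.
    move=> s01 sT; apply: contrapT => Gs; move: sT; rewrite ltNge => /negP; apply.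
    by apply: ge_inf => //; case: iE.
  have T0 : 0 <= T by apply: lb_le_inf; [by case: iE|move=> s [/andP[]]].
  have T1 : T <= t by apply: ge_inf => //; case: iE.
  have T01 : 0 <= T <= 1 by rewrite T0 (le_trans T1) //; case/andP: t01.
  have GT : Good T.
    have [<-//|Tn0] := eqVneq 0 T.
    have Tpos : 0 < T by rewrite lt_neqAle Tn0.
    have KT : K (Z T).
      apply: contrapT => nK.
      have : \forall s \near T, ~ K (Z s).
        apply: (cZ T T01 (~` K)); apply: open_nbhs_nbhs; split=> //; exact: closed_openC.
      move=> /nbhs_norm_le[e e0 eP].
      pose s := Num.max 0 (T - e).
      have s0 : 0 <= s by rewrite le_max lexx.
      have sT : s < T by rewrite gt_max Tpos gtrBl.
      apply: (eP s).
        rewrite distrC ger0_norm ?subr_ge0 ?(ltW sT) // lerBlDl -lerBlDr /s.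
        by rewrite le_max lexx orbT.
      have s1 : s <= 1 by case/andP: T01 => _; exact: le_trans (ltW sT).
      have Gs : Good s by apply: lbT; rewrite ?s0.
      exists (cmap k (Z s)); last by rewrite cmapK //; case: Gs.
      apply: est; rewrite ?s0 // => u /andP[u0 us]; apply: lbT.
        by rewrite u0 (le_trans us).
      exact: le_lt_trans us sT.
    case: KT => v /= vr vZ; have v_eta := le_lt_trans vr r_lt.
    by have [kv cv] := cimgP (eta_img (ltW v_eta)); rewrite /Good -vZ cv.
  (* Good times are open around [T], while bad times accumulate at their infimum [T]. *)
  have /nbhs_norm_le[e e0 eP] := near_good T T01 GT.
  have [s Es sT] := inf_adherent e0 iE.
  have Ts : T <= s by apply: ge_inf => //; case: iE.
  case: Es => _; apply; apply: eP; rewrite ger0_norm ?subr_ge0 // lerBlDl.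
  exact: ltW.
have [k1 _] := allGood 1 (introT andP (conj ler01 (lexx 1))).
split=> //; apply: (est 1); first by rewrite ler01 lexx.
exact: allGood.
Qed.

Lemma curve_stays x y L : curve_length x y L -> cdom k x ->
  `|cmap k x - p| + m^-1 * L < eta ->
  cdom k y /\ `|cmap k y - p| <= `|cmap k x - p| + m^-1 * L.
Proof.
elim=> [z kz|l c {}y {}L al Cc cL IH k0]; first by rewrite mulr0 addr0.
have L0 := curve_length_ge0 cL.
have iL0 : 0 <= m^-1 * L by rewrite mulr_ge0 // invr_ge0 ltW.
rewrite mulrDr addrA => lt_eta.
have [|k1 le1] := curve_piece al Cc k0.
  by apply: le_lt_trans lt_eta; rewrite lerDl.
have [|ky le2] := IH k1; first by apply: le_lt_trans lt_eta; rewrite lerD2r.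
by split=> //; apply: le_trans le2 _; rewrite lerD2r.
Qed.

End Pieces.

(** * A finite symmetric version of the Riemannian distance *)

Section Distance.
Variables (R : realType) (D : nat) (X : compactRiemannianManifold R D).
Implicit Types (x y z : X).
Local Notation d := (@riemannian_dist R D X).

Lemma dist_ge0 x y : (0 <= d x y)%E.
Proof.
by apply/ereal_infP => _ [L cL <-]; rewrite lee_fin; exact: curve_length_ge0 cL.
Qed.

Lemma dist_refl x : d x x = 0%E.
Proof.
apply/eqP; rewrite eq_le dist_ge0 andbT; apply: ereal_inf_lbound.
by exists 0 => //; exact: CurveNil.
Qed.

Lemma dist_lt x y (e : R) : (d x y < e%:E)%E -> exists2 L, curve_length x y L & L < e.
Proof.
by move=> /ereal_inf_lt[_ [L cL <-]]; rewrite lte_fin => Le; exists L.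
Qed.

Lemma dist_le x y L : curve_length x y L -> (d x y <= L%:E)%E.
Proof. by move=> cL; apply: ereal_inf_lbound; exists L. Qed.

(* Truncated at 1 to be finite. *)
Definition tdist x y : R := fine (mine 1%E (d x y)).

Lemma tdistE x y : (tdist x y)%:E = mine 1%E (d x y).
Proof.
rewrite fineK // ge0_fin_numE ?le_min ?lee01 ?dist_ge0 //.
by apply: le_lt_trans (ltry 1); rewrite ge_min lexx.
Qed.

Lemma tdist_ge0 x y : 0 <= tdist x y.
Proof. by rewrite -lee_fin tdistE le_min lee01 dist_ge0. Qed.

Lemma tdist_refl x : tdist x x = 0.
Proof. by apply: EFin_inj; rewrite tdistE dist_refl min_r // lee01. Qed.

Lemma tdist_ltP x y (e : R) : e <= 1 -> tdist x y < e <-> (d x y < e%:E)%E.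
Proof.
move=> e1; have n1 : (1%:E < e%:E)%E = false by rewrite lte_fin ltNge e1.
by rewrite -lte_fin tdistE gt_min n1.
Qed.

(** If one of the two terms reaches the truncation level the bound is immediate; otherwise nearly
    shortest curves are concatenated. *)
Lemma tdist_triangle y x z : tdist x z <= tdist x y + tdist y z.
Proof.
apply/ler_addgt0Pr => e e0.
have e2 : 0 < e / 2 by exact: divr_gt0.
have le1 u v : tdist u v <= 1 by rewrite -lee_fin tdistE ge_min lexx.
have near u v : tdist u v < 1 -> exists2 L, curve_length u v L & L <= tdist u v + e / 2.
  move=> lt1; have : (d u v < (tdist u v + e / 2)%:E)%E.
    have : (mine 1%E (d u v) < (tdist u v + e / 2)%:E)%E by rewrite -tdistE lte_fin ltrDl.
    have : (mine 1%E (d u v) < 1)%E by rewrite -tdistE lte_fin.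
    by rewrite gt_min ltxx /= => d1; rewrite (min_r (ltW d1)).
  by case/dist_lt => L cL /ltW Le; exists L.
case: (ltP (tdist x y) 1) => [/near[L cL Le]|xy1]; last first.
  by apply: le_trans (le1 x z) _; have := tdist_ge0 y z; lra.
case: (ltP (tdist y z) 1) => [/near[M cM Me]|yz1]; last first.
  by apply: le_trans (le1 x z) _; have := tdist_ge0 x y; lra.
have : (mine 1%E (d x z) <= (L + M)%:E)%E.
  by rewrite ge_min (dist_le (curve_length_trans cL cM)) orbT.
by rewrite -tdistE lee_fin; lra.
Qed.

(* Symmetrized, which avoids reversing curves. *)
Definition sdist x y : R := Num.max (tdist x y) (tdist y x).

Lemma sdist_refl x : sdist x x = 0.
Proof. by rewrite /sdist tdist_refl maxxx. Qed.

Lemma sdist_sym x y : sdist x y = sdist y x.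
Proof. exact: maxC. Qed.

Lemma sdist_triangle x y z : sdist x z <= sdist x y + sdist y z.
Proof.
rewrite ge_max; apply/andP; split.
  by apply: le_trans (tdist_triangle y x z) _; apply: lerD; rewrite le_max lexx.
apply: le_trans (tdist_triangle y z x) _; rewrite addrC.
by apply: lerD; rewrite le_max lexx orbT.
Qed.

Lemma sdist_d x y : 0 < sdist x y < 1 ->
  ((d x y < +oo)%E /\ 0 < fine (d x y) <= sdist x y) \/
  ((d y x < +oo)%E /\ 0 < fine (d y x) <= sdist x y).
Proof.
have fine_t u v : 0 < tdist u v < 1 -> (d u v < +oo)%E /\ fine (d u v) = tdist u v.
  move=> /andP[t0 t1]; have duv := (tdist_ltP u v (lexx 1)).1 t1.
  by split; [exact: lt_trans duv (ltry _)|rewrite /tdist (min_r (ltW duv))].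
rewrite /sdist; case: (leP (tdist x y) (tdist y x)) => _ t01; [right|left];
  by have [? ->] := fine_t _ _ t01; split=> //; case/andP: t01 => -> _; rewrite lexx.
Qed.

End Distance.

(** * The distance induces the manifold topology *)

Section Topology.
Variables (R : realType) (D : nat) (X : compactRiemannianManifold R D).
Implicit Types (x y z : X) (k : chart R X D) (u v w p : 'rV[R]_D).

(** The straight segment in coordinates stays in the ball by convexity and has speed at most
    [M |v - u|]. *)
Lemma segment_curve k p (e M : R) u v : atlas k -> 0 < M ->
  (forall w, `|w - p| <= e -> cimg k w /\
    forall z : 'rV[R]_D, quad (metric k w) z <= (M * `|z|) ^+ 2) ->
  `|u - p| <= e -> `|v - p| <= e ->
  exists2 L, curve_length (cinv k u) (cinv k v) L & L <= M * `|v - u|.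
Proof.
move=> ak M0 H up vp.
pose c : R -> 'rV[R]_D := fun t => t *: (v - u) + u.
have cD (t : R) : is_derive t 1 c (v - u).
  have [|dc Dc] := @is_derive_line R _ _ id u (v - u) t; first exact: derivable_id.
  by split=> //; rewrite Dc derive_id.
have c1E : derive1 c = fun=> v - u.
  by apply/funext => t; rewrite derive1E; have [_ ->] := cD t.
have cp t : 0 <= t <= 1 -> `|c t - p| <= e.
  move=> /andP[t0 t1].
  have -> : c t - p = (1 - t) *: (u - p) + t *: (v - p).
    by rewrite /c scalerBl scale1r !scalerBr; apply/rowP => i; rewrite !mxE; ring.
  apply: le_trans (ler_normD _ _) _; rewrite !normrZ !ger0_norm ?subr_ge0 //.
  have t1' : 0 <= 1 - t by rewrite subr_ge0.
  have := ler_wpM2l t1' up; have := ler_wpM2l t0 vp; lra.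
have Cc : C1_curve_in (cimg k) c.
  split=> [t||t /cp/H[]//]; first by have [] := cD t.
  by rewrite c1E => t; exact: cvg_cst.
have cE0 : c 0 = u by rewrite /c scale0r add0r.
have cE1 : c 1 = v by rewrite /c scale1r subrK.
exists (chart_length k c + 0).
  by rewrite -[u]cE0 -[v]cE1; apply: CurveCons => //; exact: CurveNil.
rewrite addr0.
have -> : M * `|v - u| = \int[@lebesgue_measure R]_(t in `[0, 1]) (M * `|v - u|).
  have mu01 : @lebesgue_measure R `[0, 1]%classic = 1%E.
    by apply: etrans (lebesgue_measure_itv `[0, 1]) _; rewrite /= lte01 oppr0 adde0.
  by rewrite Rintegral_cst //; have /(congr1 fine) := mu01; rewrite /= => ->; rewrite mulr1.
have c0 t : 0 <= t <= 1 -> {for t, continuous (speed k c)} by move=> ?; exact: speed_continuous.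
apply: le_Rintegral => //.
- exact: (@continuous01_integrable _ (speed k c)).
- exact: (@continuous01_integrable _ (fun=> M * `|v - u|) (fun t _ => cvg_cst _)).
move=> t /=; rewrite in_itv /= => /cp/H[_ qt].
have M1 : 0 <= M * `|v - u| by rewrite mulr_ge0 // ltW.
by rewrite c1E -(ger0_norm M1) -sqrtr_sqr ler_wsqrtr.
Qed.

Lemma chart_ball k p : atlas k -> cimg k p -> exists m M e : R,
  [/\ 0 < m, 0 < M, 0 < e & forall v, `|v - p| <= e -> cimg k v /\
     forall w, (m * `|w|) ^+ 2 <= quad (metric k v) w <= (M * `|w|) ^+ 2].
Proof.
move=> ak kp.
have [m [M [m0 M0 mM]]] := near_quad_bounds
  (fun i j => metric_continuous (i := i) (j := j) ak kp) (fun w => metric_pos ak kp).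
have : \forall v \near p, cimg k v by apply: open_nbhs_nbhs; split => //; exact: cimg_open.
move=> kv; have : \forall v \near p, cimg k v /\
    forall w, (m * `|w|) ^+ 2 <= quad (metric k v) w <= (M * `|w|) ^+ 2.
  by apply: filterI kv mM.
by move=> /nbhs_norm_le[e e0 eP]; exists m, M, e; split=> // v /eP[].
Qed.

Lemma sdist_chart k p : atlas k -> cimg k p -> exists M e : R,
  [/\ 0 < M, 0 < e & forall v, `|v - p| <= e -> cimg k v /\
     sdist (cinv k p) (cinv k v) <= M * `|v - p|].
Proof.
move=> ak kp; have [m [M [e [m0 M0 e0 H]]]] := chart_ball ak kp.
exists M, e; split=> // v vp; split; first by have [] := H v vp.
have H' w : `|w - p| <= e -> cimg k w /\
    forall z : 'rV[R]_D, quad (metric k w) z <= (M * `|z|) ^+ 2.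
  by move=> /H[kw Q]; split=> // z; case/andP: (Q z).
have pp : `|p - p| <= e by rewrite subrr normr0 ltW.
have tle u1 u2 : `|u1 - p| <= e -> `|u2 - p| <= e ->
    tdist (cinv k u1) (cinv k u2) <= M * `|u2 - u1|.
  move=> u1p u2p; have [L cL LM] := segment_curve ak M0 H' u1p u2p.
  by rewrite -lee_fin tdistE ge_min (le_trans (dist_le cL)) ?lee_fin // orbT.
by rewrite ge_max tle //= -normrN opprB tle.
Qed.

(** Short curves cannot leave a small chart ball, by [curve_stays], so every neighbourhood contains
    a metric ball. Conversely nearby coordinates are joined by short segments, by [sdist_chart], so
    metric balls are neighbourhoods. *)
Lemma nbhs_sdist x (U : set X) :
  nbhs x U <-> exists2 e, 0 < e & forall y, sdist x y < e -> U y.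
Proof.
have [k ak kx] := atlas_cover x.
have kp : cimg k (cmap k x) by exists x.
split=> [xU|[e e0 eU]].
  have [m [M [e1 [m0 M0 e10 H]]]] := chart_ball ak kp.
  have : nbhs (cmap k x) (cinv k @^-1` U).
    by apply: (cinv_continuous kp); rewrite cmapK.
  move=> /nbhs_norm_le[e2 e20 e2P].
  pose eta := Num.min e1 e2.
  have eta0 : 0 < eta by rewrite lt_min e10.
  have etaP v : `|v - cmap k x| <= eta -> `|v - cmap k x| <= e1 /\ `|v - cmap k x| <= e2.
    by rewrite le_min => /andP[].
  (* Below 1 the truncation is inactive; below [m * eta] a curve moves by less than [eta] in
     coordinates. *)
  exists (Num.min 1 (m * eta)); first by rewrite lt_min ltr01 mulr_gt0.
  move=> y xy.
  have [|L cL Lm] := @dist_lt _ _ _ x y (Num.min 1 (m * eta)).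
    apply/tdist_ltP; first by rewrite ge_min lexx.
    by apply: le_lt_trans xy; rewrite le_max lexx.
  have img v : `|v - cmap k x| <= eta -> cimg k v by move=> /etaP[/H[]].
  have qd v : `|v - cmap k x| <= eta -> forall w, (m * `|w|) ^+ 2 <= quad (metric k v) w.
    by move=> /etaP[/H[_ +] _] w => /(_ w)/andP[].
  have [|ky yp] := curve_stays ak m0 img qd cL kx.
    rewrite subrr normr0 add0r mulrC ltr_pdivrMr // mulrC.
    by apply: lt_le_trans Lm _; rewrite ge_min lexx orbT.
  rewrite -(cmapK ky); apply: e2P; apply: le_trans yp _.
  rewrite subrr normr0 add0r mulrC ler_pdivrMr // mulrC; apply/ltW.
  apply: lt_le_trans Lm _; rewrite ge_min; apply/orP; right.
  by rewrite ler_pM2l // ge_min lexx orbT.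
have [M [e1 [M0 e10 H]]] := sdist_chart ak kp.
have kn : nbhs x (cdom k) by apply: open_nbhs_nbhs; split => //; exact: cdom_open.
have e20 : 0 < Num.min e1 (e / (M * 2)) by rewrite lt_min e10 divr_gt0 // mulr_gt0.
have /cvgrPdistC_le/(_ _ e20) := cmap_continuous kx.
move=> near_x; have near_k : \forall y \near x, cdom k y /\
    `|cmap k y - cmap k x| <= Num.min e1 (e / (M * 2)) by apply: filterI kn near_x.
apply: filterS near_k => y [ky].
rewrite /= le_min => /andP[/H[_]]; rewrite !cmapK // => dxy yM; apply: eU.
apply: le_lt_trans dxy _; apply: le_lt_trans (_ : M * (e / (M * 2)) < e).
  by rewrite ler_pM2l.
have -> : M * (e / (M * 2)) = e / 2 by field; rewrite gt_eqF.
lra.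
Qed.

End Topology.

(** * Smooth measures *)

(* No measurability is needed, the integral being a supremum over simple
   functions; the inner integrals of [lebesgue_int] are not known to be
   measurable. *)
Lemma ge0_le_integral_any d (T : measurableType d) (R : realType)
    (mu : {measure set T -> \bar R}) (f g : T -> \bar R) :
  (forall x, 0 <= f x)%E -> (forall x, f x <= g x)%E ->
  (\int[mu]_x f x <= \int[mu]_x g x)%E.
Proof.
move=> f0 fg; have g0 x : (0 <= g x)%E by exact: le_trans (fg x).
rewrite !ge0_integralTE //; apply/ereal_supP => _ [h hf <-].
by apply: ereal_sup_ubound; exists h => // x; exact: le_trans (hf x) (fg x).
Qed.

Section LebesgueInt.
Variable R : realType.

Lemma integral_ge_itv (f : R -> \bar R) (x s c : R) : 0 <= c -> 0 <= s ->
  (forall t, 0 <= f t)%E -> (forall t, `|t - x| <= s -> (c%:E <= f t)%E) ->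
  ((c * (2 * s))%:E <= \int[lebesgue_measure]_t f t)%E.
Proof.
move=> c0 s0 f0 fc.
pose I : set (measurableTypeR R) := `[x - s, x + s]%classic.
have mI : measurable I by exact: measurable_itv.
have <- : (\int[@lebesgue_measure R]_t (c * \1_I (t : measurableTypeR R))%:E = (c * (2 * s))%:E)%E.
  under eq_integral do rewrite EFinM.
  rewrite ge0_integralZl_EFin //; last first.
    apply/measurable_EFinP; exact: measurable_indic.
  rewrite integral_indic // setIT EFinM; congr (_ * _)%E.
  apply: etrans (lebesgue_measure_itv `[x - s, x + s]) _.
  rewrite /= lte_fin; case: ifPn => h; first by rewrite -EFinB; congr EFin; ring.
  by move: h; rewrite -leNgt => h; congr EFin; lra.
apply: ge0_le_integral_any => t; first by rewrite lee_fin mulr_ge0.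
rewrite indicE; have [tI|_] := boolP (t \in I); last by rewrite mulr0.
rewrite mulr1; apply: fc; move/set_mem: tI; rewrite /I /= in_itv /= => /andP[t1 t2].
by rewrite ler_norml; apply/andP; split; lra.
Qed.

Lemma lebesgue_int_ge0 n (f : 'rV[R]_n -> \bar R) : (forall v, 0 <= f v)%E ->
  (0 <= lebesgue_int f)%E.
Proof.
elim: n f => [|n IH] f f0 /=; first exact: f0.
by apply: integral_ge0 => t _; apply: IH => v; exact: f0.
Qed.

Lemma lebesgue_int0 n (f : 'rV[R]_n -> \bar R) : (forall v, f v = 0)%E ->
  lebesgue_int f = 0%E.
Proof.
elim: n f => [|n IH] f f0 /=; first exact: f0.
by apply: integral0_eq => t _; apply: IH => v; exact: f0.
Qed.

(** Each iterated integral is bounded below by its contribution from an interval of length [2 s],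
    one coordinate of the cube after the other. *)
Lemma lebesgue_int_cube n (f : 'rV[R]_n -> \bar R) (p : 'rV[R]_n) (s c : R) :
  0 <= c -> 0 <= s -> (forall v, 0 <= f v)%E ->
  (forall v : 'rV[R]_n, (forall i, `|v 0 i - p 0 i| <= s) -> (c%:E <= f v)%E) ->
  ((c * (2 * s) ^+ n)%:E <= lebesgue_int f)%E.
Proof.
move=> c0 s0; elim: n f p => [|n IH] f p f0 fc /=.
  by rewrite expr0 mulr1; apply: fc => -[].
rewrite exprSr mulrA; apply: (@integral_ge_itv _ (p 0 0)) => //.
- by rewrite mulr_ge0 // exprn_ge0 // mulr_ge0.
- by move=> t; apply: lebesgue_int_ge0 => v; exact: f0.
move=> t tp; apply: (IH _ (\row_j p 0 (lift ord0 j))) => v; first exact: f0.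
move=> vp; apply: fc => i; rewrite mxE; case: splitP => j ij.
  have -> : i = 0 by apply/val_inj; rewrite /= ij (ord1 j).
  by rewrite mxE (ord1 j) eqxx mulr1n.
have -> : i = lift ord0 j by apply/val_inj; rewrite /= ij.
by have := vp j; rewrite mxE.
Qed.

End LebesgueInt.

Section SmoothMeasure.
Variables (R : realType) (D : nat) (X : compactRiemannianManifold R D).
Variable mu : probability (borelType X) R.
Hypotheses (mu_smooth : smooth_measure mu) (mu_full : full_support mu).

(** The density is positive at some [v0], since otherwise a chart domain would be null. Near [v0] it
    is at least half its value there, and a metric ball contains a coordinate cube of comparable
    size. *)
Lemma smooth_dball_lower : exists (x0 : X) (c0 e0 : R), [/\ 0 < c0, 0 < e0 &
  forall e, 0 < e <= e0 -> ((c0 * e ^+ D)%:E <= mu (dball (@sdist R D X) x0 e))%E].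
Proof.
have [k ak kx] := atlas_cover (point : X).
have [rho [rho_s rho0 muE]] := mu_smooth ak.
have ok := @cdom_open _ _ _ k.
have [v0 kv0 rv0] : exists2 v0, cimg k v0 & 0 < rho v0.
  apply: contrapT => H; have : (0 < mu (cdom k))%E by apply: mu_full => //; exists point.
  rewrite muE // ?lebesgue_int0 ?ltxx //; last exact: measurable_open.
  move=> v; rewrite indicE; have [vk|_] := boolP (v \in _); last by rewrite mul0r.
  rewrite mul1r; congr EFin; apply/eqP; rewrite eq_le rho0 ?andbT; last exact/set_mem.
  by rewrite leNgt; apply/negP => rv; apply: H; exists v => //; exact/set_mem.
have [M [e1 [M0 e10 H]]] := sdist_chart ak kv0.
have [crho _] := rho_s [::] v0 kv0.
have r2 : 0 < rho v0 / 2 by exact: divr_gt0.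
have /nbhs_norm_le[e2 e20 e2P] : \forall v \near v0, rho v0 / 2 <= rho v.
  have /cvgrPdistC_le/(_ _ r2) := crho; apply: filterS => v.
  by rewrite /= ler_norml => /andP[+ _]; lra.
pose s0 := Num.min e1 e2.
have s00 : 0 < s0 by rewrite lt_min e10.
exists (cinv k v0), (rho v0 / 2 / M ^+ D), (2 * M * s0).
split; [by rewrite divr_gt0 // exprn_gt0|by rewrite mulr_gt0 // mulr_gt0|].
move=> e /andP[e0 ee0].
(* Half-side of the cube: a point within [s] of [v0] in coordinates is at distance at most
   [M s = e / 2], and the volume [(2 s)^D = (e / M)^D] explains the constant. *)
pose s := e / (2 * M).
have s_gt0 : 0 < s by rewrite divr_gt0 // mulr_gt0.
have ss0 : s <= s0 by rewrite ler_pdivrMr ?mulr_gt0 // mulrC.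
set B := dball _ _ _.
have oB : open B := @open_dball _ _ _ (@sdist_triangle R D X) (@nbhs_sdist R D X) _ _.
have oBk : open (B `&` cdom k) by exact: openI.
have mBk : measurable (B `&` cdom k : set (borelType X)) by exact: measurable_open.
apply: (@le_trans _ _ (mu (B `&` cdom k))); last first.
  have mB : measurable (B : set (borelType X)) by exact: measurable_open.
  by apply: le_measure; [exact: mem_set|exact: mem_set|exact: subIsetl].
rewrite muE //.
have -> : rho v0 / 2 / M ^+ D * e ^+ D = rho v0 / 2 * (2 * s) ^+ D.
  rewrite -mulrA; congr (_ * _); rewrite -exprVn -exprMn; congr (_ ^+ _).
  by rewrite /s; field; rewrite gt_eqF.
apply: (@lebesgue_int_cube _ _ _ v0); rewrite ?(ltW r2) ?(ltW s_gt0) //.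
  move=> v; rewrite lee_fin indicE; have [vk|_] := boolP (v \in _); last by rewrite mul0r.
  by rewrite mul1r rho0 //; case/set_mem: vk => y [_ ky] <-; exists y.
move=> v vs; have vv0 : `|v - v0| <= s.
  by apply: rV_norm_le => [|i]; [exact: ltW|rewrite !mxE].
have [vv1 vv2] : `|v - v0| <= e1 /\ `|v - v0| <= e2.
  by have := le_trans vv0 ss0; rewrite le_min => /andP[].
have [kv dv] := H v vv1; have [kcv cv] := cimgP kv.
rewrite indicE mem_set ?mul1r ?lee_fin ?e2P //.
exists (cinv k v) => //; split=> //; rewrite /B /dball /=.
apply: le_lt_trans dv _; apply: (@le_lt_trans _ _ (M * s)); first by rewrite ler_pM2l.
have -> : M * s = e / 2 by rewrite /s; field; rewrite gt_eqF.
lra.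
Qed.

End SmoothMeasure.

(** * Compact Riemannian manifolds and the final statement *)

Lemma riemannian_ball_average (R : realType) (r D : nat)
    (X : compactRiemannianManifold R D) (mu : probability (borelType X) R)
    (act : freeGroup r -> X -> X) (a : R) :
  (1 < r)%N -> 0 < a -> is_action act ->
  isometric_action (@riemannian_dist R D X) act -> invariant_measure mu act ->
  smooth_measure mu -> full_support mu -> spectral_gap_L20 mu act ->
  [/\ 0 < rate a r (gap_size mu act) D,
      ball_average_estimate mu act (@riemannian_dist R D X) a
        (rate a r (gap_size mu act) D) &
      connected [set: X] -> Heps_trivial mu act].
Proof.
move=> r1 a0 actP isom act_mu smooth full gap.
pose dd := @sdist R D X.
have dd_act g x y : dd (act g x) (act g y) = dd x y.
  by rewrite /dd /sdist /tdist !isom.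
have act_meas := @measurable_act R r X act dd (@nbhs_sdist R D X) dd_act.
have [kappa k0 kP] := @almost_inv_gap_L20 _ _ _ mu _ act actP act_meas act_mu gap.
have [x0 [c0 [e0 [c00 e00 low]]]] := smooth_dball_lower smooth full.
have [g0 est triv] := @metric_ball_average R r X mu act dd D kappa r1 actP
  (@sdist_refl R D X) (@sdist_sym R D X) (@sdist_triangle R D X)
  (@nbhs_sdist R D X) dd_act act_mu full k0 kP x0 c0 e0 c00 e00 low
  (@riemannian_dist R D X) a a0 (@sdist_d R D X).
split=> //; apply: rate_gt0 => //.
by rewrite g0 (@gap_size_le1 _ _ _ mu _ act r1 act_meas act_mu).
Qed.

Theorem theorem1p1 (R : realType) (r : nat) (a : R) (hr : (2 <= r)%N)
    (ha : 0 < a) :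
  (exists theta : R -> nat -> R,
     forall (D : nat) (X : compactRiemannianManifold R D)
       (mu : probability (borelType X) R) (act : freeGroup r -> X -> X),
       is_action act ->
       isometric_action (@riemannian_dist R D X) act ->
       invariant_measure mu act ->
       ergodic mu act ->
       smooth_measure mu ->
       full_support mu ->
       spectral_gap_L20 mu act ->
       [/\ 0 < theta (gap_size mu act) D,
           ball_average_estimate mu act (@riemannian_dist R D X) a
             (theta (gap_size mu act) D) &
           connected [set: X] -> Heps_trivial mu act]) /\
  (forall (Gam : subgroupChain r)
       (mu : probability (borelType (profinite Gam)) R),
     bounded_steps Gam ->
     property_tau Gam R ->
     invariant_measure mu (@profinite_act r Gam) ->
     exists2 theta : R, 0 < theta &
       ball_average_estimate mu (@profinite_act r Gam)
         (@profinite_dist r Gam R) a theta).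
Proof.
split.
  (* The rate sees the action through its gap size and the dimension only; the implied constant is
     free to depend on everything else. *)
  exists (fun g D => rate a r g D) => D X mu act actP isom act_mu _ smooth full gap.
  exact: riemannian_ball_average.
move=> Gam mu _ tau act_mu; exact: profinite_ball_average.
Qed.
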